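(* Let $\gamma\ge 2$ be real and $\mathbb{H}_{\gamma}=\{(z_1,z_2)\in\mathbb{C}^2:|z_1|^{\gamma}<|z_2|<1\}$. The Bergman kernel $\mathbb{B}_\gamma(z,w)$ of $\mathbb{H}_\gamma$ has zeroes inside $\mathbb{H}_\gamma\times\mathbb{H}_\gamma$, i.e. there exists $(z,w)\in\mathbb{H}_\gamma\times\mathbb{H}_\gamma$ with $\mathbb{B}_\gamma(z,w)=0$.
   Context: The Bergman kernel of a domain $\Omega$ is the reproducing kernel of the space $A^2(\Omega)$ of holomorphic functions on $\Omega$ square integrable with respect to Lebesgue measure. *)

(* Defs.v *)
(* R : realType, complex numbers C := R[i]
   (mathcomp-real-closed), Lebesgue measure on C^2 = R^4 as an iterated
   product of one-dimensional Lebesgue measures. *)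
From HB Require Import structures.
From mathcomp Require Import all_boot all_order all_algebra.
From mathcomp Require Import all_classical all_reals all_analysis.
From mathcomp Require Import complex.
Set Implicit Arguments. Unset Strict Implicit. Unset Printing Implicit Defensive.
Import Order.TTheory GRing.Theory Num.Theory.
Local Open Scope ring_scope.
Local Open Scope classical_set_scope.

Section Bergman.
Variable R : realType.

(* C^2 *)
Definition C2 := (R[i] * R[i])%type.

(* modulus of a complex number *)
Definition cabs (z : R[i]) : R :=
  Num.sqrt (complex.Re z ^+ 2 + complex.Im z ^+ 2).

(* real coordinates (x1,(y1,(x2,y2))) |-> (x1 + i y1, x2 + i y2) *)
Definition toC2 (p : R * (R * (R * R))) : C2 :=
  (p.1 +i* p.2.1, p.2.2.1 +i* p.2.2.2)%C.

(* Lebesgue measure on R^4 = C^2, as the iterated product of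
   one-dimensional Lebesgue measures (m1 \x^ m2 is the product measure
   A |-> int[m2]_y m1(ysection A y)) *)
Definition leb := @lebesgue_measure R.
Definition vol4 : {measure set _ -> \bar R} :=
  (leb \x^ (leb \x^ (leb \x^ leb)))%E.

(* integral over (the real-coordinate preimage of) a set of C^2 of a
   complex-valued function, defined componentwise *)
Definition cintegral (Om : set C2) (g : C2 -> R[i]) : R[i] :=
  ((Rintegral vol4 (toC2 @^-1` Om) (fun p => complex.Re (g (toC2 p))))
   +i* (Rintegral vol4 (toC2 @^-1` Om) (fun p => complex.Im (g (toC2 p)))))%C.

(* complex differentiability of a one-variable function at a point *)
Definition cdifferentiable_at (g : R[i] -> R[i]) (a : R[i]) : Prop :=
  exists L : R[i], forall e : R, 0 < e -> exists d : R, 0 < d /\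
    forall h : R[i], h != 0 -> cabs h < d ->
      cabs ((g (a + h) - g a) / h - L) < e.

(* holomorphy on an open set of C^2 (Osgood's definition): continuous and
   holomorphic in each variable separately *)
Definition holomorphic_on (Om : set C2) (f : C2 -> R[i]) : Prop :=
  forall z, Om z ->
    (forall e : R, 0 < e -> exists d : R, 0 < d /\
       forall w : C2, cabs (w.1 - z.1) < d -> cabs (w.2 - z.2) < d ->
         cabs (f w - f z) < e)
    /\ cdifferentiable_at (fun t => f (t, z.2)) z.1
    /\ cdifferentiable_at (fun t => f (z.1, t)) z.2.

(* the Bergman space A^2(Om) *)
Definition inA2 (Om : set C2) (f : C2 -> R[i]) : Prop :=
  holomorphic_on Om f /\
  (\int[vol4]_(p in toC2 @^-1` Om) ((cabs (f (toC2 p))) ^+ 2)%:E < +oo)%E.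

(* B is the Bergman kernel of Om: the reproducing kernel of A^2(Om),
   i.e. B(., w) is in A^2(Om) and f(w) = int_Om f(z) conj(B(z,w)) dV(z)
   for every f in A^2(Om) and w in Om *)
Definition is_bergman_kernel (Om : set C2) (B : C2 -> C2 -> R[i]) : Prop :=
  forall w, Om w ->
    inA2 Om (fun z => B z w) /\
    forall f, inA2 Om f -> f w = cintegral Om (fun z => f z * (B z w)^*).

(* H_gamma = {(z1,z2) : |z1|^gamma < |z2| < 1} *)
Definition Hgamma (gamma : R) : set C2 :=
  [set z | (cabs z.1) `^ gamma < cabs z.2 /\ cabs z.2 < 1].

End Bergman.

(* Main.v *)
(* Fix w with real coordinates and let F = B(., w). Averaging the reproducing
   identity for the monomials z1^a z2^b over rotations of the two coordinates
   shows that the (a, b) Laurent coefficient of F is, up to a positive constant,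
   (a + 1) (b + 1 + (a + 1) / gamma) conj(w1^a w2^b) when b + 1 + (a + 1) / gamma
   is positive; it is 0 otherwise, because the monomial is then not square
   integrable near z2 = 0 while F is. Hence F(z) is an explicit sum of
   arithmetic-geometric series in s = z1 w1 and t = z2 w2 for real z. If gamma > 2,
   only a = 0 contributes at w1 = 0, and the sum is a multiple of
   t / (1 - t)^2 + 1 / (gamma (1 - t)), which is 0 at t = -1 / (gamma - 1). If
   gamma = 2, summing even and odd a separately gives 0 at s = -1/6, t = -1/4. *)
Require Import Defs.
From HB Require Import structures.
From mathcomp Require Import all_boot all_order all_algebra.
From mathcomp Require Import all_classical all_reals all_analysis.
From mathcomp Require Import complex measurable_realfun.
From mathcomp Require Import ring lra.
Import Order.TTheory GRing.Theory Num.Theory.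
Import numFieldNormedType.Exports.
Local Open Scope ring_scope.
Local Open Scope classical_set_scope.
Set Implicit Arguments. Unset Strict Implicit. Unset Printing Implicit Defensive.

(** * Modulus of a complex number *)

Section Modulus.
Variable R : realType.
Implicit Types z w : R[i].

(** Holomorphy means pointwise complex differentiability in each variable, with nothing assumed on
    the derivative, so the one-variable theory starts from Goursat's bisection. It is run in the
    coordinates (log r, theta), where an annulus is a rectangle. No double series is used: F is
    expanded in z1 along a slice, then each coefficient is expanded in z2. For fixed z2 the slice is
    a full disc, so only powers a >= 0 occur. Writing (a + 1) / gamma = j + d with 0 < d <= 1, the
    lowest power of z2 is -(j + 1), and the z2-series of index a is t^-(j+1) times the sum of (m +
    d) t^m over m >= 0. The coordinates of z are negative and those of w nonnegative, which makes t
    negative, so that t + d (1 - t) can vanish. At gamma = 2 the zero found for gamma > 2 would move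
    to t = -1, on the boundary. There d is 1/2 or 1 according to the parity of a, and pairs of
    consecutive terms form another arithmetic-geometric series, of ratio s^2 / t. *)

Lemma cabsE z : cabs z = complex.ComplexField.Normc.normc z.
Proof. by case: z. Qed.
Lemma cabs_ge0 z : 0 <= cabs z.
Proof. exact: sqrtr_ge0. Qed.
Lemma cabs0 : cabs (0 : R[i]) = 0.
Proof. by rewrite cabsE complex.ComplexField.Normc.normc0. Qed.
Lemma cabs1 : cabs (1 : R[i]) = 1.
Proof. by rewrite cabsE complex.ComplexField.Normc.normc1. Qed.
Lemma cabsM z w : cabs (z * w) = cabs z * cabs w.
Proof. by rewrite !cabsE complex.ComplexField.Normc.normcM. Qed.
Lemma cabsV z : cabs z^-1 = (cabs z)^-1.
Proof. by rewrite !cabsE complex.ComplexField.Normc.normcV. Qed.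
Lemma cabsN z : cabs (- z) = cabs z.
Proof. by rewrite !cabsE normcN. Qed.
Lemma cabsX z n : cabs (z ^+ n) = cabs z ^+ n.
Proof. by elim: n => [|n IH]; rewrite ?expr0 ?cabs1// !exprS cabsM IH. Qed.
Lemma cabsXz z (b : int) : cabs (z ^ b) = cabs z ^ b.
Proof. by case: b => n; rewrite ?NegzE /= -?exprnN -?exprnP ?cabsV cabsX. Qed.
Lemma cabs_eq0 z : (cabs z == 0) = (z == 0).
Proof.
apply/eqP/eqP => [|->]; last exact: cabs0.
by rewrite cabsE => /complex.ComplexField.Normc.eq0_normc.
Qed.
Lemma cabs_gt0 z : (0 < cabs z) = (z != 0).
Proof. by rewrite lt0r cabs_ge0 andbT cabs_eq0. Qed.
Lemma le_cabsD z w : cabs (z + w) <= cabs z + cabs w.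
Proof. by rewrite !cabsE le_normcD. Qed.
Lemma le_cabsB z w : cabs (z - w) <= cabs z + cabs w.
Proof. by rewrite -(cabsN w) le_cabsD. Qed.
Lemma cabsC z w : cabs (z - w) = cabs (w - z).
Proof. by rewrite -cabsN opprB. Qed.
Lemma cabs_sub_ge z w : cabs z - cabs w <= cabs (z - w).
Proof. by rewrite lerBlDr -{1}(subrK w z) le_cabsD. Qed.
Lemma sqr_cabs z : cabs z ^+ 2 = complex.Re z ^+ 2 + complex.Im z ^+ 2.
Proof. by rewrite sqr_sqrtr// addr_ge0// sqr_ge0. Qed.
Lemma Re_le_cabs z : `|complex.Re z| <= cabs z.
Proof. by rewrite -sqrtr_sqr ler_wsqrtr// lerDl sqr_ge0. Qed.
Lemma Im_le_cabs z : `|complex.Im z| <= cabs z.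
Proof. by rewrite -sqrtr_sqr ler_wsqrtr// lerDr sqr_ge0. Qed.
Lemma cabs_le_ReIm z : cabs z <= `|complex.Re z| + `|complex.Im z|.
Proof.
rewrite -(ler_pXn2r (n := 2)) ?nnegrE ?addr_ge0 ?cabs_ge0//.
rewrite sqr_cabs sqrrD !real_normK ?num_real// -addrA lerD2l lerDr.
by rewrite mulrn_wge0// mulr_ge0.
Qed.
Lemma cabs_real (x : R) : cabs (x%:C)%C = `|x|.
Proof. by rewrite /cabs /= expr0n addr0 sqrtr_sqr. Qed.
Lemma cabs_conj z : cabs (z^*)%C = cabs z.
Proof. by case: z => a b; rewrite /cabs /= sqrrN. Qed.
Lemma mul_conj z : z * (z^*)%C = ((cabs z ^+ 2)%:C)%C.
Proof.
rewrite sqr_cabs; case: z => a b; apply/eqP; rewrite eq_complex /=.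
by apply/andP; split; apply/eqP; ring.
Qed.
Lemma CReD z w : complex.Re (z + w) = complex.Re z + complex.Re w.
Proof. by case: z w => ? ? []. Qed.
Lemma CImD z w : complex.Im (z + w) = complex.Im z + complex.Im w.
Proof. by case: z w => ? ? []. Qed.
Lemma CReB z w : complex.Re (z - w) = complex.Re z - complex.Re w.
Proof. by case: z w => ? ? []. Qed.
Lemma CImB z w : complex.Im (z - w) = complex.Im z - complex.Im w.
Proof. by case: z w => ? ? []. Qed.
Lemma CReM z w : complex.Re (z * w) =
  complex.Re z * complex.Re w - complex.Im z * complex.Im w.
Proof. by case: z w => ? ? []. Qed.
Lemma CImM z w : complex.Im (z * w) =
  complex.Re z * complex.Im w + complex.Im z * complex.Re w.
Proof. by case: z w => ? ? []. Qed.
Lemma complex_eq z w : complex.Re z = complex.Re w ->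
  complex.Im z = complex.Im w -> z = w.
Proof. by move=> a b; apply/eqP; rewrite eq_complex a b !eqxx. Qed.
End Modulus.

(** * Goursat's theorem for closed one-forms on rectangles *)

Lemma integrable_EFinB d (T : measurableType d) (R : realType)
    (mu : {measure set T -> \bar R}) (D : set T) (f g : T -> R) : measurable D ->
  mu.-integrable D (EFin \o f) -> mu.-integrable D (EFin \o g) ->
  mu.-integrable D (EFin \o (fun x => f x - g x)).
Proof. by move=> mD fi gi; exact: (integrableB mD fi gi). Qed.

Lemma integrable_EFinD d (T : measurableType d) (R : realType)
    (mu : {measure set T -> \bar R}) (D : set T) (f g : T -> R) : measurable D ->
  mu.-integrable D (EFin \o f) -> mu.-integrable D (EFin \o g) ->
  mu.-integrable D (EFin \o (fun x => f x + g x)).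
Proof. by move=> mD fi gi; exact: (integrableD mD fi gi). Qed.

Section IntervalIntegral.
Variable R : realType.
Notation mu := (@lebesgue_measure R).
Implicit Types f g : R -> R.

Lemma integrable_segment f a b : {within `[a, b], continuous f} ->
  mu.-integrable `[a, b] (EFin \o f).
Proof. by apply: continuous_compact_integrable; exact: segment_compact. Qed.

Lemma integrable_segment_pt f a b :
  (forall x, a <= x <= b -> {for x, continuous f}) ->
  mu.-integrable `[a, b] (EFin \o f).
Proof.
move=> fc; apply: integrable_segment; apply: continuous_in_subspaceT => x.
by rewrite inE /= in_itv /=; exact: fc.
Qed.

Lemma Rintegral_segmentD f a b c : a <= c -> c <= b ->
  mu.-integrable `[a, b] (EFin \o f) ->
  \int[mu]_(x in `[a, b]) f x =
  \int[mu]_(x in `[a, c]) f x + \int[mu]_(x in `[c, b]) f x.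
Proof.
move=> ac cb fi.
have := @Rintegral_itvB _ f (BLeft a) (BRight b) c fi.
rewrite !bnd_simp => /(_ ac cb) H.
rewrite -(Rintegral_itv_obnd_cbnd (r := c)); first by rewrite -H addrC subrK.
apply: integrableS fi => //; apply: subset_itv; rewrite ?bnd_simp//.
Qed.

Lemma Rintegral_segment_cst (k a b : R) : a <= b ->
  \int[mu]_(x in `[a, b]) k = k * (b - a).
Proof.
move=> ab; rewrite Rintegral_cst//= lebesgue_measure_itv /= lte_fin.
by case: ltgtP ab => // ->; rewrite subrr.
Qed.

Lemma Rintegral_segment_near f (k e a b : R) : a <= b ->
  mu.-integrable `[a, b] (EFin \o f) ->
  (forall x, a <= x <= b -> `|f x - k| <= e) ->
  `|\int[mu]_(x in `[a, b]) f x - k * (b - a)| <= e * (b - a).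
Proof.
move=> ab fi H.
have ci (c : R) : mu.-integrable `[a, b] (EFin \o (fun=> c)).
  by apply: integrable_segment_pt => x _; exact: cst_continuous.
rewrite ler_distl -mulrBl -mulrDl -!Rintegral_segment_cst//.
by apply/andP; split; apply: le_Rintegral => // x; rewrite /= in_itv /= => /H;
  rewrite ler_distl => /andP[].
Qed.
End IntervalIntegral.

Section Goursat.
Variable R : realType.
Notation mu := (@lebesgue_measure R).
Variables P Q : R -> R -> R.

(* [P dx + Q dy] has a linear approximation at [(x0, y0)] which is closed. *)
Definition closed_at (x0 y0 : R) := exists p q r : R,
  forall e, 0 < e -> exists2 d : R, 0 < d & forall x y, `|x - x0| < d -> `|y - y0| < d ->
    `|P x y - P x0 y0 - (p * (x - x0) + q * (y - y0))| <= e * (`|x - x0| + `|y - y0|) /\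
    `|Q x y - Q x0 y0 - (q * (x - x0) + r * (y - y0))| <= e * (`|x - x0| + `|y - y0|).

Lemma approx_continuous (f : R -> R) (x0 p : R) :
  (forall e, 0 < e -> exists2 d : R, 0 < d & forall x, `|x - x0| < d ->
    `|f x - f x0 - p * (x - x0)| <= e * `|x - x0|) -> {for x0, continuous f}.
Proof.
move=> H; apply/(@cvgrPdist_lt _ R^o) => e e0.
have [d d0 Hd] := H 1 ltr01.
have k0 : 0 < `|p| + 1 by rewrite ltr_wpDl.
near=> x.
have xd : `|x - x0| < d.
  by near: x; apply/nbhs_ballP; exists d => // y; rewrite /ball/= distrC.
have xe : `|x - x0| < e / (`|p| + 1).
  near: x; apply/nbhs_ballP; exists (e / (`|p| + 1)); first exact: divr_gt0.
  by move=> y; rewrite /ball/= distrC.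
rewrite distrC -(subrK (p * (x - x0)) (f x - f x0)) (le_lt_trans (ler_normD _ _))//.
rewrite (@le_lt_trans _ _ ((`|p| + 1) * `|x - x0|))//.
  by rewrite mulrDl addrC lerD ?normrM// Hd.
by rewrite mulrC -ltr_pdivlMr.
Unshelve. all: by end_near. Qed.

Lemma closed_at_contP x0 y0 : closed_at x0 y0 -> {for x0, continuous (P ^~ y0)}.
Proof.
move=> [p [q [r H]]]; apply: (@approx_continuous _ _ p) => e /H[d d0 Hd].
by exists d => // x xd; have [] := Hd x y0 xd; rewrite subrr normr0// mulr0 !addr0.
Qed.

Lemma closed_at_contQ x0 y0 : closed_at x0 y0 -> {for y0, continuous (Q x0)}.
Proof.
move=> [p [q [r H]]]; apply: (@approx_continuous _ _ r) => e /H[d d0 Hd].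
by exists d => // y yd; have [|_] := Hd x0 y _ yd; rewrite subrr normr0// mulr0 !add0r.
Qed.

(** The integral of [P] dx + [Q] dy along the boundary of the rectangle, counterclockwise, with
    opposite sides grouped together. *)
Definition circulation a b c d : R :=
  \int[mu]_(x in `[a, b]) (P x c - P x d) + \int[mu]_(y in `[c, d]) (Q b y - Q a y).

Let iP a b c := mu.-integrable `[a, b] (EFin \o (P ^~ c)).
Let iQ a c d := mu.-integrable `[c, d] (EFin \o Q a).

Lemma circulation_splitx a b c d e : a <= e -> e <= b ->
  iP a b c -> iP a b d -> iQ a c d -> iQ e c d -> iQ b c d ->
  circulation a b c d = circulation a e c d + circulation e b c d.
Proof.
move=> ae eb P1 P2 Q1 Q2 Q3; rewrite /circulation (Rintegral_segmentD ae eb); last first.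
  exact: integrable_EFinB.
rewrite !(@RintegralB _ _ _ mu `[c, d]%classic)//; lra.
Qed.

Lemma circulation_splity a b c d e : c <= e -> e <= d ->
  iP a b c -> iP a b e -> iP a b d -> iQ a c d -> iQ b c d ->
  circulation a b c d = circulation a b c e + circulation a b e d.
Proof.
move=> ce ed P1 P2 P3 Q1 Q2.
rewrite /circulation [in LHS](Rintegral_segmentD (a := c) ce ed); last first.
  exact: integrable_EFinB.
rewrite !(@RintegralB _ _ _ mu `[a, b]%classic)//; lra.
Qed.

Definition closed_in a b c d := forall x y, a <= x <= b -> c <= y <= d -> closed_at x y.

Lemma closed_in_intP a b c d y : closed_in a b c d -> c <= y <= d -> iP a b y.
Proof.
by move=> H yd; apply: integrable_segment_pt => x xab; apply/closed_at_contP/H.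
Qed.
Lemma closed_in_intQ a b c d x : closed_in a b c d -> a <= x <= b -> iQ x c d.
Proof.
by move=> H yd; apply: integrable_segment_pt => y yab; apply/closed_at_contQ/H.
Qed.

(** The affine part of the form has zero circulation: the shared slope [q] contributes -q and +q
    times the area. The rest is at most [e] times the half perimeter on each pair of opposite
    sides. *)
Lemma circulation_local (x0 y0 e : R) : 0 < e -> closed_at x0 y0 ->
  exists2 D : R, 0 < D & forall a b c d, a <= x0 <= b -> c <= y0 <= d -> b - a < D -> d - c < D ->
  closed_in a b c d ->
  `|circulation a b c d| <= e * (b - a + (d - c)) ^+ 2.
Proof.
move=> e0 [p [q [r H]]]; have e20 : 0 < e / 2 by rewrite divr_gt0.
have [D D0 HD] := H _ e20; exists D => // a b c d /andP[ax xb] /andP[cy yd] ba dc cl.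
have ab := le_trans ax xb; have cd := le_trans cy yd.
have s0 : `|b - x0| <= b - a by rewrite ger0_norm; lra.
have dl x : a <= x <= b -> `|x - x0| <= b - a.
  by move=> /andP[? ?]; rewrite ler_norml; lra.
have dm y : c <= y <= d -> `|y - y0| <= d - c.
  by move=> /andP[? ?]; rewrite ler_norml; lra.
pose s := b - a + (d - c).
have step x y : a <= x <= b -> c <= y <= d ->
  `|P x y - P x0 y0 - (p * (x - x0) + q * (y - y0))| <= e / 2 * s /\
  `|Q x y - Q x0 y0 - (q * (x - x0) + r * (y - y0))| <= e / 2 * s.
  move=> xab ycd; have [] := HD x y (le_lt_trans (dl _ xab) ba) (le_lt_trans (dm _ ycd) dc).
  have k : e / 2 * (`|x - x0| + `|y - y0|) <= e / 2 * s.
    by rewrite ler_pM2l// lerD ?dl ?dm.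
  by move=> h1 h2; split; [exact: le_trans h1 k|exact: le_trans h2 k].
have aab : a <= a <= b by rewrite lexx.
have bab : a <= b <= b by rewrite lexx andbT.
have ccd : c <= c <= d by rewrite lexx.
have dcd : c <= d <= d by rewrite lexx andbT.
have B1 : `|\int[mu]_(x in `[a, b]) (P x c - P x d) - (- q * (d - c)) * (b - a)| <= (e * s) * (b - a).
  apply: Rintegral_segment_near => // [|x xab].
    by apply: integrable_EFinB => //; [exact: (closed_in_intP cl)|exact: (closed_in_intP cl)].
  have [h1 _] := step x c xab ccd; have [h2 _] := step x d xab dcd.
  move: h1 h2; rewrite !ler_norml => /andP[h1 h2] /andP[h3 h4].
  by clear -h1 h2 h3 h4; apply/andP; split; lra.
have B2 : `|\int[mu]_(y in `[c, d]) (Q b y - Q a y) - (q * (b - a)) * (d - c)| <= (e * s) * (d - c).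
  apply: Rintegral_segment_near => // [|y ycd].
    by apply: integrable_EFinB => //; [exact: (closed_in_intQ cl)|exact: (closed_in_intQ cl)].
  have [_ h1] := step b y bab ycd; have [_ h2] := step a y aab ycd.
  move: h1 h2; rewrite !ler_norml => /andP[h1 h2] /andP[h3 h4].
  by clear -h1 h2 h3 h4; apply/andP; split; lra.
rewrite /circulation; move: B1 B2.
set I := Rintegral _ _ _; set J := Rintegral _ _ _ => B1 B2.
have -> : e * (b - a + (d - c)) ^+ 2 = e * s * (b - a) + e * s * (d - c).
  by rewrite /s; ring.
have -> : I + J = (I - - q * (d - c) * (b - a)) + (J - q * (b - a) * (d - c)) by ring.
by rewrite (le_trans (ler_normD _ _))// lerD.
Qed.
End Goursat.

(** * Goursat's bisection and removable singularities *)

Section GoursatTheorem.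
Variable R : realType.
Notation mu := (@lebesgue_measure R).
Variables P Q : R -> R -> R.

Lemma closed_inS a b c d a' b' c' d' : a <= a' -> b' <= b -> c <= c' -> d' <= d ->
  closed_in P Q a b c d -> closed_in P Q a' b' c' d'.
Proof.
by move=> aa bb cc dd H x y /andP[? ?] /andP[? ?]; apply: H; apply/andP; split;
  apply: le_trans; eassumption.
Qed.

Lemma closed_in_splitx a b c d e : c <= d -> a <= e <= b -> closed_in P Q a b c d ->
  circulation P Q a b c d = circulation P Q a e c d + circulation P Q e b c d.
Proof.
move=> cd /andP[ae eb] H; have ab := le_trans ae eb.
by apply: circulation_splitx => //; first [apply: (closed_in_intP H)|apply: (closed_in_intQ H)];
  rewrite ?lexx ?ae ?eb ?ab ?cd.
Qed.

Lemma closed_in_splity a b c d e : a <= b -> c <= e <= d -> closed_in P Q a b c d ->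
  circulation P Q a b c d = circulation P Q a b c e + circulation P Q a b e d.
Proof.
move=> ab /andP[ce ed] H; have cd := le_trans ce ed.
by apply: circulation_splity => //; first [apply: (closed_in_intP H)|apply: (closed_in_intQ H)];
  rewrite ?lexx ?ce ?ed ?ab ?cd.
Qed.

Lemma closed_in_split4 a b c d e f : a <= e <= b -> c <= f <= d ->
  closed_in P Q a b c d ->
  circulation P Q a b c d = (circulation P Q a e c f + circulation P Q a e f d) +
    (circulation P Q e b c f + circulation P Q e b f d).
Proof.
move=> aeb cfd H; have [ae eb] := andP aeb; have [cf fd] := andP cfd.
rewrite (closed_in_splitx (le_trans cf fd) aeb H); congr (_ + _).
  by apply: closed_in_splity => //; apply: closed_inS H.
by apply: closed_in_splity => //; apply: closed_inS H.
Qed.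

(** The circulations of the four quarters add up to that of the rectangle, so one of them carries at
    least a quarter of it. *)
Lemma bisect_circulation a b c d : a <= b -> c <= d -> closed_in P Q a b c d ->
  exists x y, [/\ a <= x, x + (b - a) / 2 <= b, c <= y, y + (d - c) / 2 <= d &
   `|circulation P Q a b c d| <=
   4 * `|circulation P Q x (x + (b - a) / 2) y (y + (d - c) / 2)|].
Proof.
move=> ab cd H; set l := (b - a) / 2; set m := (d - c) / 2.
have El : (a + l) + l = b by rewrite /l; field.
have Em : (c + m) + m = d by rewrite /m; field.
have l0 : 0 <= l by rewrite divr_ge0// subr_ge0.
have m0 : 0 <= m by rewrite divr_ge0// subr_ge0.
have aeb : a <= a + l <= b by rewrite -El !lerDl l0.
have ced : c <= c + m <= d by rewrite -Em !lerDl m0.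
have S := closed_in_split4 aeb ced H.
have [ae eb] := andP aeb; have [ce ed] := andP ced.
have ae' : a <= a + l by []. have ce' : c <= c + m by [].
have eb' : a + l + l <= b by rewrite El. have ed' : c + m + m <= d by rewrite Em.
pose good x y := `|circulation P Q a b c d| <= 4 * `|circulation P Q x (x + l) y (y + m)|.
have [g1|g1] := boolP (good a c); first by exists a, c; split; [exact: lexx|exact: eb|exact: lexx|exact: ed|exact: g1].
have [g2|g2] := boolP (good a (c + m)); first by exists a, (c + m); split; [exact: lexx|exact: eb|exact: ce'|exact: ed'|exact: g2].
have [g3|g3] := boolP (good (a + l) c); first by exists (a + l), c; split; [exact: ae'|exact: eb'|exact: lexx|exact: ed|exact: g3].
exists (a + l), (c + m); split; [exact: ae'|exact: eb'|exact: ce'|exact: ed'|].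
rewrite El Em; move: g1 g2 g3; rewrite /good El Em -!ltNge S.
set u1 := circulation _ _ _ _ _ _; set u2 := circulation _ _ _ _ _ _.
set u3 := circulation _ _ _ _ _ _; set u4 := circulation _ _ _ _ _ _.
move: u1 u2 u3 u4 => u1 u2 u3 u4 g1 g2 g3.
have h1 := ler_normD (u1 + u2) (u3 + u4); have h2 := ler_normD u1 u2.
have h3 := ler_normD u3 u4.
clear -g1 g2 g3 h1 h2 h3; lra.
Qed.

Lemma nested_point (u : nat -> R) (l : R) : 0 <= l ->
  (forall n, u n <= u n.+1 /\ u n.+1 + l / 2 ^+ n.+1 <= u n + l / 2 ^+ n) ->
  exists x, forall n, u n <= x <= u n + l / 2 ^+ n.
Proof.
move=> l0 H; have q n : 0 <= l / 2 ^+ n by rewrite divr_ge0// exprn_ge0.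
have ule n k : u n <= u (n + k)%N.
  by elim: k => [|k IH]; rewrite ?addn0// addnS (le_trans IH)//; case: (H (n + k)%N).
have uge n k : u (n + k)%N + l / 2 ^+ (n + k) <= u n + l / 2 ^+ n.
  by elim: k => [|k IH]; rewrite ?addn0// addnS (le_trans _ IH)//; case: (H (n + k)%N).
have ub n : ubound (range u) (u n + l / 2 ^+ n).
  move=> _ [k _ <-]; have [/subnKC <-|/ltnW/subnKC <-] := leqP n k.
    by rewrite (le_trans _ (uge n (k - n)%N))// lerDl.
  by rewrite (le_trans (ule k (n - k)%N))// lerDl.
exists (sup (range u)) => n; apply/andP; split.
  by apply: ub_le_sup; [exists (u 0%N + l / 2 ^+ 0)|exists n].
by apply: ge_sup; [exists (u 0%N); exists 0%N|].
Qed.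

(** After n bisections the circulation has lost at most a factor 4^n, while the local estimate at
    the limit point gains exactly 4^n from the squared perimeter. What remains is an arbitrarily
    small multiple of the original squared half perimeter. *)
Theorem goursat a b c d : a <= b -> c <= d -> closed_in P Q a b c d ->
  circulation P Q a b c d = 0.
Proof.
move=> ab cd H; pose l := b - a; pose m := d - c.
have l0 : 0 <= l by rewrite subr_ge0.
have m0 : 0 <= m by rewrite subr_ge0.
pose sub n (s : R * R) := [/\ a <= s.1, s.1 + l / 2 ^+ n <= b, c <= s.2 & s.2 + m / 2 ^+ n <= d].
pose E n (s : R * R) := circulation P Q s.1 (s.1 + l / 2 ^+ n) s.2 (s.2 + m / 2 ^+ n).
have q n : 0 <= l / 2 ^+ n /\ 0 <= m / 2 ^+ n by rewrite !divr_ge0// exprn_ge0.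
have clsub n s : sub n s -> closed_in P Q s.1 (s.1 + l / 2 ^+ n) s.2 (s.2 + m / 2 ^+ n).
  by case=> *; apply: closed_inS H.
have sq4 (u v : R) n : (u / 2 ^+ n + v / 2 ^+ n) ^+ 2 = (u + v) ^+ 2 / 4 ^+ n.
  rewrite -mulrDl expr_div_n -[(2 ^+ n) ^+ 2]exprM mulnC exprM.
  suff -> : (2 : R) ^+ 2 = 4 by []; ring.
have half (k : R) n : k / 2 ^+ n / 2 = k / 2 ^+ n.+1 by rewrite exprSr invfM mulrA.
(* The depth n is part of the argument and admissibility is a premise, so a plain choice function
   suffices and the nested sequence is its iteration. *)
have /choice[f Hf] : forall ns : nat * (R * R), exists s' : R * R, sub ns.1 ns.2 ->
    [/\ sub ns.1.+1 s', ns.2.1 <= s'.1 /\ s'.1 + l / 2 ^+ ns.1.+1 <= ns.2.1 + l / 2 ^+ ns.1,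
     ns.2.2 <= s'.2 /\ s'.2 + m / 2 ^+ ns.1.+1 <= ns.2.2 + m / 2 ^+ ns.1 &
    `|E ns.1 ns.2| <= 4 * `|E ns.1.+1 s'|].
  move=> [n s] /=; have [sn|nsn] := pselect (sub n s); last by exists s.
  have [qn1 qn2] := q n; have [s1 s2 s3 s4] := sn.
  have [||x [y [h1 h2 h3 h4 h5]]] := bisect_circulation _ _ (clsub _ _ sn); rewrite ?lerDl//.
  exists (x, y) => _; move: h2 h4 h5; rewrite ![_ + _ - _]addrC !addKr !half => h2 h4 h5.
  split => //; split=> //=; first exact: le_trans s1 h1.
  - exact: le_trans h2 s2.
  - exact: le_trans s3 h3.
  - exact: le_trans h4 s4.
pose st := fix st n := if n is k.+1 then f (k, st k) else (a, c).
have sub0 : sub 0%N (a, c) by rewrite /sub expr0 !divr1 /l /m /=; split; lra.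
have sst n : sub n (st n) by elim: n => //= n /(Hf (n, _))[].
have st1 n := Hf (n, st n) (sst n).
have [x Hx] := @nested_point (fun n => (st n).1) l l0 (fun n => let: And4 _ h _ _ := st1 n in h).
have [y Hy] := @nested_point (fun n => (st n).2) m m0 (fun n => let: And4 _ _ h _ := st1 n in h).
have En n : `|E 0%N (a, c)| <= 4 ^+ n * `|E n (st n)|.
  elim: n => [|n IH]; first by rewrite expr0 mul1r.
  rewrite (le_trans IH)// exprSr -mulrA ler_pM2l ?exprn_gt0//.
  by case: (st1 n).
have xy : closed_at P Q x y.
  have := Hx 0%N; have := Hy 0%N; rewrite /= expr0 !divr1 /l /m !(addrC _ (_ - _)) !subrK.
  by move=> yc xa; apply: H.
have E0 : E 0%N (a, c) = circulation P Q a b c d.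
  by rewrite /E /= expr0 !divr1 /l /m !(addrC _ (_ - _)) !subrK.
rewrite -E0; apply/eqP; rewrite -normr_le0; apply/ler_addgt0Pl => e e0; rewrite addr0.
have lm0 : 0 <= (l + m) ^+ 2 by apply: sqr_ge0.
(* The added 1 keeps the divisor positive for a rectangle reduced to a point. *)
have e'0 : 0 < e / ((l + m) ^+ 2 + 1) by rewrite divr_gt0// ltr_wpDl.
have [D D0 HD] := circulation_local e'0 xy.
have [n Hn] : exists n, (l + m) / 2 ^+ n < D.
  exists (Num.bound ((l + m) / D)); rewrite ltr_pdivrMr ?exprn_gt0// mulrC -ltr_pdivrMr//.
  apply: lt_trans (archi_boundP _) _; first by apply: divr_ge0; [exact: addr_ge0|exact: ltW].
  by rewrite -natrX ltr_nat ltn_expl.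
have [qn1 qn2] := q n.
have := HD _ _ _ _ (Hx n) (Hy n); rewrite ![_ + _ - _]addrC !addKr => /(_ _ _ (clsub _ _ (sst n))).
have ln : l / 2 ^+ n < D by rewrite (le_lt_trans _ Hn)// ler_pM2r ?invr_gt0 ?exprn_gt0// lerDl.
have mn : m / 2 ^+ n < D by rewrite (le_lt_trans _ Hn)// ler_pM2r ?invr_gt0 ?exprn_gt0// lerDr.
move=> /(_ ln mn) HE; apply: le_trans (En n) _.
rewrite sq4 in HE.
rewrite (@le_trans _ _ (4 ^+ n * (e / ((l + m) ^+ 2 + 1) * ((l + m) ^+ 2 / 4 ^+ n))))//.
  by rewrite ler_pM2l; [exact: HE|exact: exprn_gt0].
have n4 : 4 ^+ n != 0 :> R by rewrite expf_neq0.
have -> : 4 ^+ n * (e / ((l + m) ^+ 2 + 1) * ((l + m) ^+ 2 / 4 ^+ n)) =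
   e * ((l + m) ^+ 2 / ((l + m) ^+ 2 + 1)).
  by field; rewrite n4 andbT gt_eqF// ltr_wpDl.
apply: ler_piMr; first exact: ltW.
by rewrite ler_pdivrMr ?mul1r ?lerDl// ltr_wpDl.
Qed.

(** Two vertical and two horizontal cuts remove four strips that avoid the exceptional point; each
    has zero circulation by [goursat]. *)
Lemma circulation_shrink (a b c d x0 y0 x1 x2 y1 y2 : R) :
  a <= x1 -> x1 < x0 -> x0 < x2 -> x2 <= b -> c <= y1 -> y1 < y0 -> y0 < y2 -> y2 <= d ->
  (forall x y, a <= x <= b -> c <= y <= d -> (x != x0) || (y != y0) -> closed_at P Q x y) ->
  circulation P Q a b c d = circulation P Q x1 x2 y1 y2.
Proof.
move=> ax1 x10 x02 x2b cy1 y10 y02 y2d H.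
have nlt (u v : R) : u < v -> u != v by move=> uv; rewrite lt_eqF.
have ngt (u v : R) : v < u -> u != v by move=> uv; rewrite gt_eqF.
have [x1b x12] : x1 <= b /\ x1 <= x2 by split; lra.
have [y1d y12] : y1 <= d /\ y1 <= y2 by split; lra.
have [ax2 cy2] : a <= x2 /\ c <= y2 by split; lra.
have [ab cd] : a <= b /\ c <= d by split; lra.
have ip y : c <= y -> y <= d -> y != y0 -> forall a' b', a <= a' -> b' <= b ->
    mu.-integrable `[a', b'] (EFin \o (P ^~ y)).
  move=> cy yd ne a' b' aa bb; apply: integrable_segment_pt => x /andP[xa' xb'].
  apply: closed_at_contP; apply: H; last by rewrite ne orbT.
    by rewrite (le_trans aa)// (le_trans xb').
  by rewrite cy.
have iq x : a <= x -> x <= b -> x != x0 -> forall c' d', c <= c' -> d' <= d ->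
    mu.-integrable `[c', d'] (EFin \o Q x).
  move=> ax xb ne a' b' aa bb; apply: integrable_segment_pt => y /andP[xa' xb'].
  apply: closed_at_contQ; apply: H; last by rewrite ne.
    by rewrite ax.
  by rewrite (le_trans aa)// (le_trans xb').
have y1n := nlt _ _ y10; have x1n := nlt _ _ x10.
have y2n := ngt _ _ y02; have x2n := ngt _ _ x02.
have cn : c != y0 by apply: nlt; rewrite (le_lt_trans cy1).
have dn : d != y0 by apply: ngt; rewrite (lt_le_trans y02).
have an : a != x0 by apply: nlt; rewrite (le_lt_trans ax1).
have bn : b != x0 by apply: ngt; rewrite (lt_le_trans x02).
have ll (u : R) : u <= u by [].
have zero a' b' c' d' : a <= a' -> b' <= b -> c <= c' -> d' <= d -> a' <= b' -> c' <= d' ->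
  (b' < x0) || (x0 < a') || (d' < y0) || (y0 < c') -> circulation P Q a' b' c' d' = 0.
  move=> aa bb cc dd ab' cd' h; apply: goursat => // x y /andP[xa xb] /andP[yc yd].
  apply: H; [by rewrite (le_trans aa)// (le_trans xb)|by rewrite (le_trans cc)// (le_trans yd)|].
  case/orP: h => [/orP[/orP[h|h]|h]|h].
  - by rewrite nlt// (le_lt_trans xb).
  - by rewrite ngt// (lt_le_trans h).
  - by rewrite (nlt y) ?orbT// (le_lt_trans yd).
  - by rewrite (ngt y) ?orbT// (lt_le_trans h).
rewrite (@circulation_splitx _ P Q a b c d x1) ?ip ?iq//.
rewrite (@circulation_splitx _ P Q x1 b c d x2) ?ip ?iq//.
rewrite (@circulation_splity _ P Q x1 x2 c d y1) ?ip ?iq//.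
rewrite (@circulation_splity _ P Q x1 x2 y1 d y2) ?ip ?iq//.
by rewrite (zero a x1) ?(zero x2 b) ?(zero x1 x2 c y1) ?(zero x1 x2 y2 d) ?x10 ?x02 ?y10 ?y02 ?orbT//
  !add0r !addr0.
Qed.

(** The circulation equals that around a square of side 2e centred at the exceptional point, which
    is at most 8 K e, and e can be taken arbitrarily small. *)
Theorem goursat_removable (a b c d x0 y0 K : R) : a < x0 < b -> c < y0 < d ->
  (forall x y, a <= x <= b -> c <= y <= d -> (x, y) != (x0, y0) -> closed_at P Q x y) ->
  (exists2 D : R, 0 < D & forall x y, `|x - x0| < D -> `|y - y0| < D ->
    (x, y) != (x0, y0) -> `|P x y| <= K /\ `|Q x y| <= K) ->
  circulation P Q a b c d = 0.
Proof.
move=> /andP[ax xb] /andP[cy yd] H [D D0 HD].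
apply/eqP; rewrite -normr_le0; apply/ler_addgt0Pl => e0 e0_gt0; rewrite addr0.
have K0 : 0 <= K.
  have [|||h _] := HD (x0 + D / 2) y0.
  - by rewrite addrC addKr ger0_norm; lra.
  - by rewrite subrr normr0.
  - by rewrite xpair_eqE negb_and gt_eqF// ltrDl; lra.
  exact: le_trans h.
(* The square must stay in the rectangle and in the region where the form is bounded, and 8 (K + 1)
   e must not exceed [e0]. *)
pose e := Num.min (Num.min (x0 - a) (b - x0)) (Num.min (Num.min (y0 - c) (d - y0))
  (Num.min (D / 2) (e0 / (8 * (K + 1))))).
have [e_gt0 [ea [eb [ec [ed [eD ee]]]]]] : 0 < e /\ (e <= x0 - a /\ e <= b - x0 /\
    e <= y0 - c /\ e <= d - y0 /\ e <= D / 2 /\ e <= e0 / (8 * (K + 1))).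
  split; last by rewrite /e !ge_min !lexx !orbT.
  by rewrite /e !lt_min !subr_gt0 ax xb cy yd !divr_gt0// mulr_gt0//; lra.
have cat x y : a <= x <= b -> c <= y <= d -> (x != x0) || (y != y0) -> closed_at P Q x y.
  by move=> xab ycd ne; apply: H => //; rewrite xpair_eqE negb_and.
pose x1 := x0 - e; pose x2 := x0 + e; pose y1 := y0 - e; pose y2 := y0 + e.
have [ax1 [x10 [x02 x2b]]] : a <= x1 /\ (x1 < x0 /\ x0 < x2 /\ x2 <= b).
  by rewrite /x1 /x2; clear -ea eb e_gt0; move: e ea eb e_gt0 => e *; lra.
have [cy1 [y10 [y02 y2d]]] : c <= y1 /\ (y1 < y0 /\ y0 < y2 /\ y2 <= d).
  by rewrite /y1 /y2; clear -ec ed e_gt0; move: e ec ed e_gt0 => e *; lra.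
rewrite (circulation_shrink ax1 x10 x02 x2b cy1 y10 y02 y2d cat).
have [x12 y12] : x1 <= x2 /\ y1 <= y2 by split; apply: ltW; [exact: lt_trans x02|exact: lt_trans y02].
have xin x : x1 <= x <= x2 -> `|x - x0| < D.
  rewrite /x1 /x2 => /andP[h1 h2]; rewrite ltr_norml; clear -h1 h2 eD D0.
  by move: e h1 h2 eD => e *; lra.
have yin y : y1 <= y <= y2 -> `|y - y0| < D.
  rewrite /y1 /y2 => /andP[h1 h2]; rewrite ltr_norml; clear -h1 h2 eD D0.
  by move: e h1 h2 eD => e *; lra.
have bdP x y : x1 <= x <= x2 -> y1 <= y <= y2 -> (x != x0) || (y != y0) ->
    `|P x y| <= K /\ `|Q x y| <= K.
  by move=> xx yy ne; apply: HD; rewrite ?xin ?yin// xpair_eqE negb_and.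
have ll (u : R) : u <= u by [].
have tK u v : `|u| <= K -> `|v| <= K -> `|u - v| <= 2 * K.
  by move=> h1 h2; rewrite (le_trans (ler_normB _ _))// mulr2n mulrDl mul1r lerD.
have [x1n x2n] : x1 != x0 /\ x2 != x0 by rewrite (lt_eqF x10) (gt_eqF x02).
have [y1n y2n] : y1 != y0 /\ y2 != y0 by rewrite (lt_eqF y10) (gt_eqF y02).
have I1 : `|\int[mu]_(x in `[x1, x2]) (P x y1 - P x y2) - 0 * (x2 - x1)| <= (2 * K) * (x2 - x1).
  apply: Rintegral_segment_near => //.
    have ip y : y1 <= y <= y2 -> y != y0 -> mu.-integrable `[x1, x2] (EFin \o (P ^~ y)).
      move=> /andP[yc yd'] ne; apply: integrable_segment_pt => x /andP[xa' xb'].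
      apply: closed_at_contP; apply: cat; last by rewrite ne orbT.
        by rewrite (le_trans ax1)// (le_trans xb').
      by rewrite (le_trans cy1 yc)// (le_trans yd').
    by apply: integrable_EFinB => //; apply: ip; rewrite ?ll ?y12 ?y1n ?y2n.
  move=> x xx; rewrite subr0; apply: tK.
    by have [] := bdP x y1 xx; rewrite ?ll ?y12// (lt_eqF y10) orbT.
  by have [] := bdP x y2 xx; rewrite ?ll ?y12// (gt_eqF y02) orbT.
have I2 : `|\int[mu]_(y in `[y1, y2]) (Q x2 y - Q x1 y) - 0 * (y2 - y1)| <= (2 * K) * (y2 - y1).
  apply: Rintegral_segment_near => //.
    have iq x : x1 <= x <= x2 -> x != x0 -> mu.-integrable `[y1, y2] (EFin \o Q x).
      move=> /andP[xa xb''] ne; apply: integrable_segment_pt => y /andP[xa' xb'].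
      apply: closed_at_contQ; apply: cat; last by rewrite ne.
        by rewrite (le_trans ax1 xa)// (le_trans xb'').
      by rewrite (le_trans cy1)// (le_trans xb').
    by apply: integrable_EFinB => //; apply: iq; rewrite ?ll ?x12 ?x1n ?x2n.
  move=> y yy; rewrite subr0; apply: tK.
    by have [] := bdP x2 y _ yy; rewrite ?ll ?x12// (gt_eqF x02).
  by have [] := bdP x1 y _ yy; rewrite ?ll ?x12// (lt_eqF x10).
move: I1 I2; rewrite !mul0r !subr0 => I1 I2.
rewrite /circulation (le_trans (ler_normD _ _))// (le_trans (lerD I1 I2))//.
have -> : 2 * K * (x2 - x1) + 2 * K * (y2 - y1) = 8 * K * e.
  by rewrite /x1 /x2 /y1 /y2; ring.
rewrite (@le_trans _ _ (8 * (K + 1) * e))//.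
  by rewrite ler_pM2r// ler_pM2l// lerDl.
by rewrite mulrC -ler_pdivlMr ?ee// mulr_gt0// ltr_wpDl.
Qed.
End GoursatTheorem.

(** * Complex differentiability *)

Section ComplexDerivative.
Variable R : realType.
Implicit Types (f g : R[i] -> R[i]) (a z : R[i]).

Definition ccont f a := forall e : R, 0 < e -> exists2 d : R, 0 < d &
  forall z, cabs (z - a) < d -> cabs (f z - f a) < e.

Lemma ccont_cst c a : ccont (fun=> c) a.
Proof. by move=> e e0; exists 1 => // z _; rewrite subrr cabs0. Qed.

Lemma ccont_id a : ccont id a.
Proof. by move=> e e0; exists e. Qed.

Lemma ccontD f g a : ccont f a -> ccont g a -> ccont (fun z => f z + g z) a.
Proof.
move=> fc gc e e0; have e2 : 0 < e / 2 by rewrite divr_gt0.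
have [d d0 Hd] := fc _ e2; have [d' d'0 Hd'] := gc _ e2.
exists (Num.min d d'); first by rewrite lt_min d0.
move=> z; rewrite lt_min => /andP[/Hd h1 /Hd' h2].
by rewrite opprD addrACA (le_lt_trans (le_cabsD _ _))// (splitr e) ltrD.
Qed.

(** Continuity of multiplication, isolated from any function so that it serves both one and two
    complex variables. *)
Lemma cmul_close (a b : R[i]) (e : R) : 0 < e -> exists2 d : R, 0 < d &
  forall x y, cabs (x - a) < d -> cabs (y - b) < d -> cabs (x * y - a * b) < e.
Proof.
move=> e0; pose M := cabs a + cabs b + 1.
have M0 : 0 < M by rewrite ltr_wpDl// addr_ge0// cabs_ge0.
pose e' := Num.min 1 (e / (2 * M)).
have e'0 : 0 < e' by rewrite lt_min ltr01 divr_gt0// mulr_gt0.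
exists e' => // x y h1 h2.
have -> : x * y - a * b = (x - a) * (y - b) + a * (y - b) + (x - a) * b by ring.
rewrite (le_lt_trans (le_cabsD _ _))// (le_lt_trans (lerD (le_cabsD _ _) (lexx _)))//.
rewrite !cabsM.
move: h1 h2; set u := cabs (x - a); set v := cabs (y - b) => h1 h2.
have u0 : 0 <= u := cabs_ge0 _. have v0 : 0 <= v := cabs_ge0 _.
have u1 : u <= 1 by apply: ltW; rewrite (lt_le_trans h1)// ge_min lexx.
have e'e : e' <= e / (2 * M) by rewrite ge_min lexx orbT.
have eM : e' * (2 * M) <= e by rewrite -ler_pdivlMr// mulr_gt0.
have F0 : 0 <= cabs a := cabs_ge0 _. have G0 : 0 <= cabs b := cabs_ge0 _.
have k1 : u * v <= 1 * v by rewrite ler_wpM2r.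
have k2 : cabs a * v <= cabs a * e' by rewrite ler_wpM2l// ltW.
have k3 : u * cabs b <= e' * cabs b by rewrite ler_wpM2r// ltW.
rewrite /M in eM.
have p1 : 0 <= e' * cabs a by rewrite mulr_ge0// ltW.
have p2 : 0 <= e' * cabs b by rewrite mulr_ge0// ltW.
by nra.
Qed.

Lemma ccontM f g a : ccont f a -> ccont g a -> ccont (fun z => f z * g z) a.
Proof.
move=> fc gc e e0; have [c c0 Hc] := cmul_close (f a) (g a) e0.
have [d d0 Hd] := fc _ c0; have [d' d'0 Hd'] := gc _ c0.
exists (Num.min d d'); first by rewrite lt_min d0.
by move=> z; rewrite lt_min => /andP[/Hd h1 /Hd' h2]; exact: Hc.
Qed.

Lemma ccontV f a : f a != 0 -> ccont f a -> ccont (fun z => (f z)^-1) a.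
Proof.
move=> fa0 fc e e0; set k := cabs (f a).
have k0 : 0 < k by rewrite cabs_gt0.
pose e' := Num.min (k / 2) (e * (k * (k / 2))).
have e'0 : 0 < e' by rewrite lt_min !mulr_gt0.
have [d d0 Hd] := fc _ e'0; exists d => // z /Hd h.
have h1 : k / 2 < cabs (f z).
  have := cabs_sub_ge (f a) (f z); rewrite cabsC -/k.
  have : cabs (f z - f a) < k / 2 by rewrite (lt_le_trans h)// ge_min lexx.
  lra.
have fz : f z != 0 by rewrite -cabs_gt0 (lt_trans _ h1)// divr_gt0.
have -> : (f z)^-1 - (f a)^-1 = (f a - f z) / (f a * f z) by field; rewrite fa0 fz.
rewrite cabsM cabsV cabsM cabsC -/k ltr_pdivrMr ?mulr_gt0 ?cabs_gt0//.
rewrite (lt_le_trans h)// (@le_trans _ _ (e * (k * (k / 2))))//.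
  by rewrite ge_min lexx orbT.
by rewrite !ler_pM2l// ltW.
Qed.

(** Carathéodory's form of differentiability: a difference quotient continuous at [a]. It turns the
    rules for products and inverses into algebra. *)
Lemma cdiffP f a : cdifferentiable_at f a <->
  exists2 phi, ccont phi a & exists2 d : R, 0 < d &
    forall z, cabs (z - a) < d -> f z = f a + phi z * (z - a).
Proof.
split=> [[L HL]|[phi pc [d d0 Hd]]].
  exists (fun z => if z == a then L else (f z - f a) / (z - a)).
    move=> e e0; have [d [d0 Hd]] := HL e e0; exists d => // z zd; rewrite eqxx.
    case: eqP => [_|/eqP za]; first by rewrite subrr cabs0.
    by have := Hd (z - a); rewrite subr_eq0 subrKC; apply.
  exists 1 => // z _; case: eqP => [->|/eqP za]; first by rewrite subrr mulr0 addr0.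
  by rewrite divfK ?subr_eq0// subrKC.
exists (phi a) => e /pc[d' d'0 Hd']; exists (Num.min d d'); split; first by rewrite lt_min d0.
move=> h h0; rewrite lt_min => /andP[hd hd'].
have ah : (a + h) - a = h by rewrite addrC addKr.
rewrite (Hd (a + h)) ?ah// [f a + _]addrC addrK mulfK//.
by apply: Hd'; rewrite ah.
Qed.

Lemma cdiff_ccont f a : cdifferentiable_at f a -> ccont f a.
Proof.
move=> /cdiffP[phi pc [d d0 Hd]] e e0.
have H : ccont (fun z => f a + phi z * (z - a)) a.
  apply: ccontD; first exact: ccont_cst.
  by apply: ccontM => //; apply: ccontD; [exact: ccont_id|exact: ccont_cst].
have [d' d'0 Hd'] := H e e0; exists (Num.min d d'); first by rewrite lt_min d0.
move=> z; rewrite lt_min => /andP[zd /Hd'].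
by rewrite -Hd// subrr mulr0 addr0.
Qed.

Lemma cdiff_cst c a : cdifferentiable_at (fun=> c) a.
Proof.
apply/cdiffP; exists (fun=> 0); first exact: ccont_cst.
by exists 1 => // z _; rewrite mul0r addr0.
Qed.

Lemma cdiff_id a : cdifferentiable_at id a.
Proof.
apply/cdiffP; exists (fun=> 1); first exact: ccont_cst.
by exists 1 => // z _; rewrite mul1r subrKC.
Qed.

Lemma cdiffD f g a : cdifferentiable_at f a -> cdifferentiable_at g a ->
  cdifferentiable_at (fun z => f z + g z) a.
Proof.
move=> /cdiffP[p pc [d d0 Hd]] /cdiffP[q qc [d' d'0 Hd']]; apply/cdiffP.
exists (fun z => p z + q z); first exact: ccontD.
exists (Num.min d d'); first by rewrite lt_min d0.
by move=> z; rewrite lt_min => /andP[/Hd -> /Hd' ->]; ring.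
Qed.

Lemma cdiffM f g a : cdifferentiable_at f a -> cdifferentiable_at g a ->
  cdifferentiable_at (fun z => f z * g z) a.
Proof.
move=> /cdiffP[p pc [d d0 Hd]] gd; have gc := cdiff_ccont gd.
have /cdiffP[q qc [d' d'0 Hd']] := gd; apply/cdiffP.
exists (fun z => p z * g z + f a * q z).
  by apply: ccontD; apply: ccontM => //; exact: ccont_cst.
exists (Num.min d d'); first by rewrite lt_min d0.
by move=> z; rewrite lt_min => /andP[/Hd -> /Hd' ->]; ring.
Qed.

Lemma cdiffV f a : f a != 0 -> cdifferentiable_at f a ->
  cdifferentiable_at (fun z => (f z)^-1) a.
Proof.
move=> fa0 fd; have fc := cdiff_ccont fd.
have /cdiffP[q qc [d' d'0 Hd']] := fd; apply/cdiffP.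
exists (fun z => - q z * ((f a)^-1 * (f z)^-1)).
  apply: ccontM; first by rewrite (_ : (fun z => - q z) = (fun z => -1 * q z));
    [apply: ccontM => //; exact: ccont_cst|apply/funext => z; rewrite mulN1r].
  by apply: ccontM; [exact: ccont_cst|exact: ccontV].
have [d d0 Hd] := fc (cabs (f a)) (ltac:(by rewrite cabs_gt0)).
exists (Num.min d d'); first by rewrite lt_min d0.
move=> z; rewrite lt_min => /andP[/Hd zd /Hd' zd'].
have fz : f z != 0.
  by apply/negP => /eqP fz; move: zd; rewrite fz sub0r cabsN ltxx.
have -> : - q z * ((f a)^-1 * (f z)^-1) * (z - a) = - (q z * (z - a)) * ((f a)^-1 * (f z)^-1).
  by ring.
have -> : q z * (z - a) = f z - f a by rewrite zd'; ring.
by field; rewrite fa0 fz.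
Qed.

Lemma cdiffX f n a : cdifferentiable_at f a -> cdifferentiable_at (fun z => f z ^+ n) a.
Proof.
move=> fd; elim: n => [|n IH]; first exact: cdiff_cst.
rewrite (_ : (fun z => _) = (fun z => f z * f z ^+ n)); first exact: cdiffM.
by apply/funext => z; rewrite exprS.
Qed.

Lemma cdiffXz f (b : int) a : f a != 0 -> cdifferentiable_at f a ->
  cdifferentiable_at (fun z => f z ^ b) a.
Proof.
case: b => n fa0 fd; first exact: cdiffX.
by rewrite /exprz; apply: cdiffV; [rewrite expf_neq0|exact: cdiffX].
Qed.
End ComplexDerivative.

(** * Circle integrals and Laurent expansion *)

Section Polar.
Variable R : realType.
Implicit Types (x y : R) (h : R[i] -> R[i]).

Definition cis y : R[i] := (cos y +i* sin y)%C.
(** The complex exponential of x + i y. Circles centred at 0 become vertical segments and annuli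
    become rectangles. *)
Definition pol x y : R[i] := ((expR x)%:C)%C * cis y.

Lemma cis0 : cis 0 = 1.
Proof. by rewrite /cis cos0 sin0. Qed.
Lemma cisD x y : cis (x + y) = cis x * cis y.
Proof. by apply: complex_eq; rewrite ?CReM ?CImM /= ?cosD ?sinD; ring. Qed.
Lemma cabs_cis y : cabs (cis y) = 1.
Proof. by rewrite /cabs /= cos2Dsin2 sqrtr1. Qed.
Lemma cis2pi : cis (pi *+ 2) = 1.
Proof. by rewrite /cis cos2pi sin2pi. Qed.
Lemma cabs_pol x y : cabs (pol x y) = expR x.
Proof. by rewrite cabsM cabs_cis mulr1 cabs_real ger0_norm// expR_ge0. Qed.
Lemma polD x y x' y' : pol (x + x') (y + y') = pol x y * pol x' y'.
Proof. by rewrite /pol expRD cisD rmorphM /=; ring. Qed.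

Lemma is_derive_approx (f : R -> R) x l : is_derive x 1 f l ->
  forall e, 0 < e -> exists2 d : R, 0 < d & forall k, `|k| < d ->
    `|f (x + k) - f x - l * k| <= e * `|k|.
Proof.
move=> [df vf] e e0; have := df; rewrite /derivable.
move=> df1; have {df1} : (k^-1 *: ((f \o shift x) (k *: 1) - f x)) @[k --> 0^'] --> 'D_1 f x.
  exact: df1.
rewrite vf => /(@cvgrPdist_lt _ R^o) /(_ e e0) /nbhs_ballP[d /= d0 Hd].
exists d => // k kd; have [->|k0] := eqVneq k 0.
  by rewrite addr0 subrr mulr0 subr0 normr0 mulr0.
have := Hd k; rewrite /ball /= sub0r normrN => /(_ kd k0).
rewrite /= [k *: 1]mulr1 [_ *: _]/(_ * _) [k + x]addrC distrC => /ltW.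
rewrite -(ler_pM2r (x := `|k|)) ?normr_gt0// -normrM mulrBl.
by rewrite mulrAC mulVf// mul1r.
Qed.

Lemma pol_approx0 e : 0 < e -> exists2 d : R, 0 < d & forall x y, `|x| < d -> `|y| < d ->
  cabs (pol x y - 1 - (x +i* y)%C) <= e * (`|x| + `|y|).
Proof.
move=> e0; pose e' := Num.min 1 (e / 6).
have e'0 : 0 < e' by rewrite lt_min ltr01 divr_gt0.
have [d1 d10 H1] := is_derive_approx (is_derive_expR (0 : R)) e'0.
have [d2 d20 H2] := is_derive_approx (is_derive_cos (0 : R)) e'0.
have [d3 d30 H3] := is_derive_approx (is_derive_sin (0 : R)) e'0.
exists (Num.min (Num.min d1 (e' / 2)) (Num.min d2 d3)); first by rewrite !lt_min d10 d20 d30 !andbT divr_gt0.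
move=> x y; rewrite !lt_min => /andP[/andP[xd1 xe] _] /andP[_ /andP[yd2 yd3]].
have := H1 x xd1; have := H2 y yd2; have := H3 y yd3; rewrite !add0r expR0 cos0 sin0 !subr0 oppr0 mul0r !subr0 !mul1r.
move=> h3 h2 h1.
have e'1 : e' <= 1 by rewrite ge_min lexx.
have e'6 : e' * 6 <= e by rewrite -ler_pdivlMr// ge_min lexx orbT.
have ex : `|expR x - 1| <= e'.
  have -> : expR x - 1 = (expR x - 1 - x) + x by ring.
  rewrite (le_trans (ler_normD _ _))//.
  have : e' * `|x| <= 1 * `|x| by rewrite ler_wpM2r.
  by move: h1 xe; lra.
have ex2 : `|expR x| <= 2.
  have -> : expR x = (expR x - 1) + 1 by ring.
  by rewrite (le_trans (ler_normD _ _))// normr1; lra.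
have -> : pol x y - 1 - (x +i* y)%C = ((expR x)%:C)%C * ((cos y - 1) +i* (sin y - y))%C
   + ((expR x - 1 - x) +i* ((expR x - 1) * y))%C.
  by apply: complex_eq; rewrite /pol /cis ?CReD ?CImD ?CReB ?CImB ?CReM ?CImM /=; ring.
rewrite (le_trans (le_cabsD _ _))// cabsM cabs_real.
have A1 : cabs ((cos y - 1) +i* (sin y - y))%C <= 2 * e' * `|y|.
  by rewrite (le_trans (cabs_le_ReIm _))//= (le_trans (lerD h2 h3))//; lra.
have A2 : cabs ((expR x - 1 - x) +i* ((expR x - 1) * y))%C <= e' * `|x| + e' * `|y|.
  by rewrite (le_trans (cabs_le_ReIm _))//= lerD// normrM ler_wpM2r.
have A3 : `|expR x| * cabs ((cos y - 1) +i* (sin y - y))%C <= 2 * (2 * e' * `|y|).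
  by rewrite ler_pM// cabs_ge0.
have x0 : 0 <= `|x| by []. have y0 : 0 <= `|y| by [].
have k1 : e' * 6 * `|x| <= e * `|x| by rewrite ler_wpM2r.
have k2 : e' * 6 * `|y| <= e * `|y| by rewrite ler_wpM2r.
have k3 : 0 <= e' * `|x| by rewrite mulr_ge0// ltW.
have k4 : 0 <= e' * `|y| by rewrite mulr_ge0// ltW.
by rewrite (le_trans (lerD A3 A2))//; clear -k1 k2 k3 k4; lra.
Qed.

Lemma cabs_dz x y : cabs (x +i* y)%C <= `|x| + `|y|.
Proof. exact: cabs_le_ReIm. Qed.

Lemma pol_approx x0 y0 e : 0 < e -> exists2 d : R, 0 < d & forall x y,
  `|x - x0| < d -> `|y - y0| < d ->
  cabs (pol x y - pol x0 y0 - pol x0 y0 * ((x - x0) +i* (y - y0))%C)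
   <= e * (`|x - x0| + `|y - y0|).
Proof.
move=> e0; have E0 := expR_gt0 x0.
have [d d0 Hd] := @pol_approx0 (e / expR x0) (divr_gt0 e0 E0); exists d => // x y xd yd.
have -> : pol x y = pol x0 y0 * pol (x - x0) (y - y0) by rewrite -polD !subrKC.
have -> : pol x0 y0 * pol (x - x0) (y - y0) - pol x0 y0 - pol x0 y0 * ((x - x0) +i* (y - y0))%C
  = pol x0 y0 * (pol (x - x0) (y - y0) - 1 - ((x - x0) +i* (y - y0))%C) by ring.
rewrite cabsM cabs_pol mulrC -ler_pdivlMr// mulrAC.
exact: Hd.
Qed.

Lemma pol_near x0 y0 e : 0 < e -> exists2 d : R, 0 < d & forall x y,
  `|x - x0| < d -> `|y - y0| < d -> cabs (pol x y - pol x0 y0) < e.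
Proof.
move=> e0; have [d d0 Hd] := pol_approx x0 y0 ltr01; pose M := 1 + expR x0.
have M0 : 0 < M by rewrite addr_gt0// expR_gt0.
exists (Num.min d (e / (2 * M))); first by rewrite lt_min d0 divr_gt0// mulr_gt0.
move=> x y; rewrite !lt_min => /andP[xd xe] /andP[yd ye].
rewrite -(subrK (pol x0 y0 * ((x - x0) +i* (y - y0))%C) (pol x y - pol x0 y0)).
rewrite (le_lt_trans (le_cabsD _ _))// cabsM cabs_pol.
rewrite (@le_lt_trans _ _ (M * (`|x - x0| + `|y - y0|)))//.
  by rewrite mulrDl lerD ?Hd// ler_pM2l ?expR_gt0// cabs_dz.
rewrite mulrC -ltr_pdivlMr//.
have -> : e / M = e / (2 * M) + e / (2 * M) by field; rewrite gt_eqF.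
exact: ltrD.
Qed.

(** The chain rule for h composed with the exponential; the derivative k is h'(z0) z0. *)
Lemma cdiff_pol_approx h x0 y0 : cdifferentiable_at h (pol x0 y0) ->
  exists k : R[i], forall e, 0 < e -> exists2 d : R, 0 < d & forall x y,
  `|x - x0| < d -> `|y - y0| < d ->
  cabs (h (pol x y) - h (pol x0 y0) - k * ((x - x0) +i* (y - y0))%C)
   <= e * (`|x - x0| + `|y - y0|).
Proof.
move=> /cdiffP[phi pc [d d0 Hd]]; set z0 := pol x0 y0 in pc Hd *; pose L := phi z0.
exists (L * z0) => e e0; pose M := cabs L + (expR x0 + 1).
have E0 := expR_gt0 x0.
have M0 : 0 < M by rewrite ltr_wpDl ?cabs_ge0// addr_gt0.
have eM : 0 < e / M by rewrite divr_gt0.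
have [d1 d10 H1] := pol_approx x0 y0 eM.
have [d2 d20 H2] := pol_approx x0 y0 ltr01.
have [d3 d30 H3] := pc _ eM.
have dd : 0 < Num.min d d3 by rewrite lt_min d0.
have [d4 d40 H4] := pol_near x0 y0 dd.
exists (Num.min (Num.min d1 d2) d4); first by rewrite !lt_min d10 d20 d40.
move=> x y; rewrite !lt_min => /andP[/andP[x1 x2] x4] /andP[/andP[y1 y2] y4].
have := H4 _ _ x4 y4; rewrite lt_min => /andP[/Hd -> /H3 /ltW h3].
have := H1 _ _ x1 y1; have := H2 _ _ x2 y2; rewrite -/z0.
set z := pol x y in h3 *; set dz := (_ +i* _)%C; set s := `|x - x0| + _ => h2 h1.
have s0 : 0 <= s by rewrite addr_ge0.
have h4 : cabs (z - z0) <= (expR x0 + 1) * s.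
  rewrite -(subrK (z0 * dz) (z - z0)) (le_trans (le_cabsD _ _))// addrC mulrDl lerD//.
  by rewrite cabsM cabs_pol ler_pM2l// cabs_dz.
have -> : h z0 + phi z * (z - z0) - h z0 - L * z0 * dz =
  L * (z - z0 - z0 * dz) + (phi z - phi z0) * (z - z0) by rewrite /L; ring.
rewrite (le_trans (le_cabsD _ _))// !cabsM.
have -> : e * s = cabs L * (e / M * s) + (e / M) * ((expR x0 + 1) * s).
  by rewrite -[in LHS](divfK (lt0r_neq0 M0) e) {2}/M; ring.
by rewrite lerD// ?ler_wpM2l ?cabs_ge0// ler_pM// cabs_ge0.
Qed.

(** The two forms are the imaginary and real parts of h(z) (dx + i dy), that is of h(z) dz / z. The
    shared slope in [closed_at] is the Cauchy-Riemann equation. *)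
Lemma cdiff_closed_at h x0 y0 : cdifferentiable_at h (pol x0 y0) ->
  closed_at (fun x y => complex.Im (h (pol x y))) (fun x y => complex.Re (h (pol x y))) x0 y0 /\
  closed_at (fun x y => complex.Re (h (pol x y))) (fun x y => - complex.Im (h (pol x y))) x0 y0.
Proof.
move=> /cdiff_pol_approx[[a b] H]; split.
- exists b, a, (- b) => e /H[d d0 Hd]; exists d => // x y xd yd.
  have := Hd x y xd yd; set w := cabs _ => wle.
  split; apply: le_trans wle.
    apply: le_trans (Im_le_cabs _); rewrite !CImB CImM /= le_eqVlt; apply/orP; left; apply/eqP.
    by congr `| _ |; ring.
  apply: le_trans (Re_le_cabs _); rewrite !CReB CReM /= le_eqVlt; apply/orP; left; apply/eqP.
  by congr `| _ |; ring.
- exists a, (- b), (- a) => e /H[d d0 Hd]; exists d => // x y xd yd.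
  have := Hd x y xd yd; set w := cabs _ => wle.
  split; apply: le_trans wle.
    apply: le_trans (Re_le_cabs _); rewrite !CReB CReM /= le_eqVlt; apply/orP; left; apply/eqP.
    by congr `| _ |; ring.
  apply: le_trans (Im_le_cabs _); rewrite !CImB CImM /= le_eqVlt; apply/orP; left; apply/eqP.
  by rewrite -normrN; congr `| _ |; ring.
Qed.
End Polar.

Section ComplexIntegral.
Context d (T : measurableType d) (R : realType).
Variables (mu : {measure set T -> \bar R}) (D : set T).
Hypothesis mD : measurable D.
Implicit Types (g h : T -> R[i]).

Definition Cint g : R[i] := ((\int[mu]_(x in D) complex.Re (g x)) +i*
  (\int[mu]_(x in D) complex.Im (g x)))%C.

Definition Cintegrable g := mu.-integrable D (EFin \o (fun x => complex.Re (g x))) /\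
  mu.-integrable D (EFin \o (fun x => complex.Im (g x))).

Lemma eq_Cint g h : (forall x, D x -> g x = h x) -> Cint g = Cint h.
Proof.
by move=> gh; rewrite /Cint; congr (_ +i* _)%C; apply: eq_Rintegral => x;
  rewrite inE => Dx; rewrite gh.
Qed.

Lemma eq_Cintegrable g h : (forall x, D x -> g x = h x) -> Cintegrable g -> Cintegrable h.
Proof.
by move=> gh [g1 g2]; split; [move: g1|move: g2]; apply: eq_integrable => // x;
  rewrite inE => Dx /=; rewrite gh.
Qed.

Lemma CintegrableD g h : Cintegrable g -> Cintegrable h ->
  Cintegrable (fun x => g x + h x).
Proof.
move=> [g1 g2] [h1 h2]; split.
- by under [X in EFin \o X]funext do rewrite CReD; exact: integrable_EFinD.
- by under [X in EFin \o X]funext do rewrite CImD; exact: integrable_EFinD.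
Qed.

Lemma integrable_EFinZl (k : R) (f : T -> R) : mu.-integrable D (EFin \o f) ->
  mu.-integrable D (EFin \o (fun x => k * f x)).
Proof. by move=> fi; exact: (integrableZl mD k fi). Qed.

Lemma CintegrableZ (c : R[i]) g : Cintegrable g -> Cintegrable (fun x => c * g x).
Proof.
move=> [g1 g2]; split.
- under [X in EFin \o X]funext do rewrite CReM.
  by apply: integrable_EFinB => //; exact: integrable_EFinZl.
- under [X in EFin \o X]funext do rewrite CImM.
  by apply: integrable_EFinD => //; exact: integrable_EFinZl.
Qed.

Lemma CintD g h : Cintegrable g -> Cintegrable h ->
  Cint (fun x => g x + h x) = Cint g + Cint h.
Proof.
move=> [g1 g2] [h1 h2]; apply: complex_eq; rewrite ?CReD ?CImD /=.
- by rewrite -RintegralD//; apply: eq_Rintegral => x _; rewrite CReD.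
- by rewrite -RintegralD//; apply: eq_Rintegral => x _; rewrite CImD.
Qed.

Lemma CintZ (c : R[i]) g : Cintegrable g -> Cint (fun x => c * g x) = c * Cint g.
Proof.
move=> [g1 g2]; apply: complex_eq; rewrite ?CReM ?CImM /=.
- rewrite -!RintegralZl// -RintegralB//; try exact: integrable_EFinZl.
  by apply: eq_Rintegral => x _; rewrite CReM.
- rewrite -!RintegralZl// -RintegralD//; try exact: integrable_EFinZl.
  by apply: eq_Rintegral => x _; rewrite CImM.
Qed.

Lemma Cint0 : Cint (fun=> 0) = 0.
Proof.
by rewrite /Cint /= !(Rintegral_cst mu mD) mul0r.
Qed.

Lemma Cintegrable0 : Cintegrable (fun=> 0).
Proof. by split; exact: integrable0. Qed.

Lemma Cintegrable_sum I (r : seq I) (F : I -> T -> R[i]) :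
  (forall i, Cintegrable (F i)) -> Cintegrable (fun x => \sum_(i <- r) F i x).
Proof.
move=> H; elim: r => [|i r IH].
  by apply: eq_Cintegrable Cintegrable0 => x _; rewrite big_nil.
by apply: eq_Cintegrable (CintegrableD (H i) IH) => x _; rewrite big_cons.
Qed.

Lemma Cint_sum I (r : seq I) (F : I -> T -> R[i]) :
  (forall i, Cintegrable (F i)) ->
  Cint (fun x => \sum_(i <- r) F i x) = \sum_(i <- r) Cint (F i).
Proof.
move=> H; elim: r => [|i r IH].
  by rewrite big_nil -[RHS]Cint0; apply: eq_Cint => x _; rewrite big_nil.
rewrite big_cons -IH -CintD//; last exact: Cintegrable_sum.
by apply: eq_Cint => x _; rewrite big_cons.
Qed.
End ComplexIntegral.

(** * Circle integrals and Cauchy's theorem on an annulus *)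

Section CircleMean.
Variable R : realType.
Notation mu := (@lebesgue_measure R).
Implicit Types (h g : R[i] -> R[i]) (r : R).

(** The angular integral without the factor 1 / (2 pi), that is the contour integral of h(z) dz / (i
    z). The factors [pi *+ 2] in the expansions below come from this normalisation. *)
Definition circ r h : R[i] := Cint mu `[0, pi *+ 2] (fun y => h ((r%:C)%C * cis y)).

Definition circ_cont r h := forall y, ccont h ((r%:C)%C * cis y).

Lemma circ_cont_pt r h y0 : 0 <= r -> circ_cont r h ->
  {for y0, continuous (fun y => complex.Re (h ((r%:C)%C * cis y)))} /\
  {for y0, continuous (fun y => complex.Im (h ((r%:C)%C * cis y)))}.
Proof.
move=> r0 H.
have K : forall e : R, 0 < e -> \forall y \near y0,
    cabs (h ((r%:C)%C * cis y) - h ((r%:C)%C * cis y0)) < e.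
  move=> e e0; have [d d0 Hd] := H y0 _ e0.
  have d2 : 0 < d / (2 * (r + 1)) by rewrite divr_gt0// mulr_gt0// ltr_wpDl.
  have /(@cvgrPdist_lt _ R^o) /(_ _ d2) h1 := @continuous_cos R y0.
  have /(@cvgrPdist_lt _ R^o) /(_ _ d2) h2 := @continuous_sin R y0.
  near=> y; apply: Hd; rewrite -mulrBr cabsM cabs_real ger0_norm//.
  have : cabs (cis y - cis y0) <= d / (2 * (r + 1)) + d / (2 * (r + 1)).
    rewrite (le_trans (cabs_le_ReIm _))// /= lerD//= distrC ltW//.
      by near: y; exact: h1.
    by near: y; exact: h2.
  have -> : d / (2 * (r + 1)) + d / (2 * (r + 1)) = d / (r + 1).
    by field; rewrite gt_eqF// ltr_wpDl.
  rewrite ler_pdivlMr ?ltr_wpDl//; set k := cabs _ => kd.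
  have [->|k0] := eqVneq k 0; first by rewrite mulr0.
  by rewrite (lt_le_trans _ kd)// mulrC ltr_pM2l ?ltrDl// lt0r k0 cabs_ge0.
split; apply/(@cvgrPdist_lt _ R^o) => e /K; apply: filterS => y; rewrite distrC;
  apply: le_lt_trans; rewrite -?CReB -?CImB; [exact: Re_le_cabs|exact: Im_le_cabs].
Unshelve. all: by end_near. Qed.

Lemma circ_integrable r h : 0 <= r -> circ_cont r h ->
  Cintegrable mu `[0, pi *+ 2] (fun y => h ((r%:C)%C * cis y)).
Proof.
by move=> r0 H; split; apply: integrable_segment_pt => y _;
  have [] := circ_cont_pt y r0 H.
Qed.

Lemma circD r h g : 0 <= r -> circ_cont r h -> circ_cont r g ->
  circ r (fun z => h z + g z) = circ r h + circ r g.
Proof. by move=> r0 hc gc; apply: CintD => //; exact: circ_integrable. Qed.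

Lemma circZ r c h : 0 <= r -> circ_cont r h ->
  circ r (fun z => c * h z) = c * circ r h.
Proof. by move=> r0 hc; apply: CintZ => //; exact: circ_integrable. Qed.

Lemma circ_sum r n (F : nat -> R[i] -> R[i]) : 0 <= r -> (forall i, circ_cont r (F i)) ->
  circ r (fun z => \sum_(0 <= i < n) F i z) = \sum_(0 <= i < n) circ r (F i).
Proof. by move=> r0 hc; apply: Cint_sum => // i; exact: circ_integrable. Qed.

Lemma eq_circ r h g : 0 <= r -> (forall z, cabs z = r -> h z = g z) -> circ r h = circ r g.
Proof.
move=> r0 hg; apply: eq_Cint => y _; apply: hg.
by rewrite cabsM cabs_cis cabs_real mulr1 ger0_norm.
Qed.

Lemma pi2_ge0 : 0 <= pi *+ 2 :> R.
Proof. by rewrite mulrn_wge0// pi_ge0. Qed.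

Lemma circ_cst r c : circ r (fun=> c) = ((pi *+ 2)%:C)%C * c.
Proof.
rewrite /circ /Cint /= !Rintegral_segment_cst ?pi2_ge0// subr0.
by apply: complex_eq; rewrite ?CReM ?CImM /= mul0r ?subr0 ?addr0 mulrC.
Qed.

(** Real and imaginary parts are bounded separately, which accounts for the factor 2. *)
Lemma le_cabs_Cint (f : R -> R[i]) M : Cintegrable mu `[0, pi *+ 2] f ->
  (forall y, 0 <= y <= pi *+ 2 -> cabs (f y) <= M) ->
  cabs (Cint mu `[0, pi *+ 2] f) <= 2 * M * (pi *+ 2).
Proof.
move=> [i1 i2] hM; rewrite (le_trans (cabs_le_ReIm _))//= -mulrA mulr2n [2 * _]mulrDl mul1r.
have := @Rintegral_segment_near _ _ 0 M _ _ pi2_ge0 i1.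
have := @Rintegral_segment_near _ _ 0 M _ _ pi2_ge0 i2.
rewrite !mul0r !subr0 => h2 h1; rewrite lerD//.
  by apply: h1 => y yI; rewrite subr0 (le_trans (Re_le_cabs _))// hM.
by apply: h2 => y yI; rewrite subr0 (le_trans (Im_le_cabs _))// hM.
Qed.

Lemma le_cabs_circ r h M : 0 <= r -> circ_cont r h -> (forall z, cabs z = r -> cabs (h z) <= M) ->
  cabs (circ r h) <= 2 * M * (pi *+ 2).
Proof.
move=> r0 hc hM; apply: le_cabs_Cint => [|y _]; first exact: circ_integrable.
by apply: hM; rewrite cabsM cabs_cis cabs_real mulr1 ger0_norm.
Qed.

(** By periodicity the sides at angles 0 and 2 pi cancel, so the two circulations are the components
    of the difference of the circle integrals. *)
Lemma circulation_circ h r r' : 0 < r -> 0 < r' -> circ_cont r h -> circ_cont r' h ->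
  let P := (fun x y => complex.Im (h (pol x y))) in
  let Q := (fun x y => complex.Re (h (pol x y))) in
  let Q' := (fun x y => - complex.Im (h (pol x y))) in
  circulation P Q (ln r) (ln r') 0 (pi *+ 2) = 0 ->
  circulation Q Q' (ln r) (ln r') 0 (pi *+ 2) = 0 -> circ r h = circ r' h.
Proof.
move=> r0 r'0 hc hc' P Q Q'.
have [i1 i2] := circ_integrable (ltW r0) hc.
have [i1' i2'] := circ_integrable (ltW r'0) hc'.
have per x : pol x (pi *+ 2) = pol x 0 by rewrite /pol cis2pi cis0.
have polr s y : 0 < s -> pol (ln s) y = (s%:C)%C * cis y by move=> s0; rewrite /pol lnK.
rewrite /circulation.
under eq_Rintegral do rewrite /P per subrr.
under [in X in _ -> X -> _]eq_Rintegral do rewrite /Q per subrr.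
rewrite [in X in _ -> X -> _]/Q'.
rewrite !Rintegral_cst// !mul0r !add0r.
under eq_Rintegral do rewrite /Q !polr//.
under [in X in _ -> X -> _]eq_Rintegral do rewrite /Q' !polr// opprK addrC.
rewrite !RintegralB// => /eqP; rewrite subr_eq0 => /eqP e1 /eqP; rewrite subr_eq0 => /eqP e2.
by rewrite /circ /Cint e1 e2.
Qed.

(** Cauchy's theorem on an annulus, which is Goursat's theorem on the rectangle [ln r, ln r'] x
    [0, 2 pi]. *)
Theorem circ_eq h r r' : 0 < r -> r <= r' ->
  (forall z, r <= cabs z <= r' -> cdifferentiable_at h z) -> circ r h = circ r' h.
Proof.
move=> r0 rr' H; have r'0 := lt_le_trans r0 rr'.
have cc s : r <= s <= r' -> circ_cont s h.
  move=> /andP[rs sr'] y; apply/cdiff_ccont/H; have s0 := lt_le_trans r0 rs.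
  by rewrite cabsM cabs_cis cabs_real mulr1 gtr0_norm// rs.
have ll : ln r <= ln r' by rewrite ler_ln.
have cl x : ln r <= x <= ln r' -> r <= expR x <= r'.
  by move=> /andP[a b]; rewrite -[leLHS]lnK// ler_expR a -[leRHS]lnK// ler_expR.
apply: circulation_circ => //; try by apply: cc; rewrite lexx rr'.
- apply: goursat; [exact: ll|exact: pi2_ge0|] => x y xr _.
  by apply: (cdiff_closed_at _).1; apply: H; rewrite cabs_pol cl.
- apply: goursat; [exact: ll|exact: pi2_ge0|] => x y xr _.
  by apply: (cdiff_closed_at _).2; apply: H; rewrite cabs_pol cl.
Qed.
End CircleMean.

(** * Truncated Laurent expansion with an explicit remainder *)

Section Laurent.
Variable R : realType.
Implicit Types (h g : R[i] -> R[i]) (r : R).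

Lemma ccont_sum n (F : nat -> R[i] -> R[i]) (a : R[i]) : (forall k, ccont (F k) a) ->
  ccont (fun z => \sum_(0 <= k < n) F k z) a.
Proof.
move=> H; elim: n => [|n IH].
  by rewrite (_ : (fun z => _) = (fun=> 0)); [exact: ccont_cst|apply/funext => z; rewrite big_nil].
rewrite (_ : (fun z => _) = (fun z => \sum_(0 <= k < n) F k z + F n z)); first exact: ccontD.
by apply/funext => z; rewrite big_nat_recr.
Qed.

Lemma circ_cont_cdiff r h : 0 <= r -> (forall z, cabs z = r -> cdifferentiable_at h z) ->
  circ_cont r h.
Proof.
move=> r0 H y; apply/cdiff_ccont/H.
by rewrite cabsM cabs_cis cabs_real mulr1 ger0_norm.
Qed.

(** A negative real has a single preimage in the rectangle, away from the sides at angles 0 and 2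
    pi; a positive real would have two, both on these sides. *)
Lemma pol_eqN (x y r0 : R) : 0 < r0 -> 0 <= y <= pi *+ 2 -> pol x y = - ((r0%:C)%C) ->
  x = ln r0 /\ y = pi.
Proof.
move=> r00 /andP[y0 y2] E; have Ex : expR x = r0.
  by rewrite -(cabs_pol x y) E cabsN cabs_real gtr0_norm.
split; first by rewrite -Ex expRK.
have cy : cos y = -1.
  move: E; rewrite /pol Ex => /(congr1 (@complex.Re R)).
  rewrite CReM /= mul0r subr0 -mulrN1 => E; apply: (mulfI (lt0r_neq0 r00)).
  by rewrite E.
have [yp|py] := leP y pi.
  by apply: cos_inj; rewrite ?in_itv /= ?y0 ?yp ?lexx ?pi_ge0// cospi.
have : pi *+ 2 - y = pi.
  apply: cos_inj; rewrite ?in_itv /= ?lexx ?pi_ge0//.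
    rewrite subr_ge0 y2 /=; move: py; rewrite mulr2n; lra.
  by rewrite addrC cosD2pi cosN cy cospi.
by rewrite mulr2n => h; lra.
Qed.

Theorem circ_eq_removable h r r0 r' K : 0 < r -> r < r0 -> r0 < r' ->
  (forall z, r <= cabs z <= r' -> z != - ((r0%:C)%C) -> cdifferentiable_at h z) ->
  (exists2 d : R, 0 < d & forall z : R[i], cabs (z - - ((r0%:C)%C)) < d -> z != - ((r0%:C)%C) ->
    cabs (h z) <= K) -> circ r h = circ r' h.
Proof.
move=> rp rr0 r0r' H [d d0 Hd]; have r0p := lt_trans rp rr0; have r'p := lt_trans r0p r0r'.
have cw : cabs (- ((r0%:C)%C)) = r0 by rewrite cabsN cabs_real gtr0_norm.
have ll1 : ln r < ln r0 by rewrite ltr_ln.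
have ll2 : ln r0 < ln r' by rewrite ltr_ln.
have pi0 := @pi_gt0 R.
have cl x : ln r <= x <= ln r' -> r <= expR x <= r'.
  by move=> /andP[a b]; rewrite -[leLHS]lnK// ler_expR a -[leRHS]lnK// ler_expR.
have polw : pol (ln r0) pi = - ((r0%:C)%C).
  by apply: complex_eq; rewrite /pol ?CReM ?CImM /= lnK// cospi sinpi ?mulr0 ?mul0r ?subr0 ?addr0 ?mulrN1 ?oppr0.
have [D D0 HD] := pol_near (ln r0) pi d0; rewrite polw in HD.
have near0 : exists2 E : R, 0 < E & forall x y : R, `|x - ln r0| < E -> `|y - pi| < E ->
    (x, y) != (ln r0, pi) -> cabs (h (pol x y)) <= K.
  exists (Num.min D pi); first by rewrite lt_min D0.
  move=> x y; rewrite !lt_min => /andP[xD _] /andP[yD yp] ne; apply: Hd; first exact: HD.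
  apply/negP => /eqP /pol_eqN[]//; last by move=> ex ey; rewrite ex ey eqxx in ne.
  by move: yp; rewrite ltr_norml mulr2n => /andP[y1 y2]; apply/andP; split; lra.
have cd (x y : R) : ln r <= x <= ln r' -> 0 <= y <= pi *+ 2 -> (x, y) != (ln r0, pi) ->
    cdifferentiable_at h (pol x y).
  move=> xr yr ne; apply: H; first by rewrite cabs_pol cl.
  by apply/negP => /eqP /pol_eqN[]// ex ey; rewrite ex ey eqxx in ne.
have piin : (0 < pi :> R) && (pi < pi *+ 2 :> R) by rewrite pi0 mulr2n ltrDr pi0.
have lnin : ln r < ln r0 < ln r' by rewrite ll1.
have [E E0 HE] := near0.
apply: circulation_circ => //.
- apply: circ_cont_cdiff => [|z zr]; first exact: ltW.
  by apply: H; rewrite ?zr ?lexx ?(ltW (lt_trans rr0 _))//; apply/eqP => zw; move: rr0; rewrite -zr zw cw ltxx.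
- apply: circ_cont_cdiff => [|z zr]; first exact: ltW.
  by apply: H; rewrite ?zr ?lexx ?(ltW (lt_trans rr0 _))//; apply/eqP => zw; move: r0r'; rewrite -zr zw cw ltxx.
- apply: (goursat_removable (K := K) lnin piin).
    by move=> x y xr yr ne; apply: (cdiff_closed_at _).1; exact: cd.
  by exists E => // x y xE yE ne; split; [apply: le_trans (Im_le_cabs _) _|apply: le_trans (Re_le_cabs _) _];
    exact: HE.
- apply: (goursat_removable (K := K) lnin piin).
    by move=> x y xr yr ne; apply: (cdiff_closed_at _).2; exact: cd.
  by exists E => // x y xE yE ne; rewrite normrN; split; [apply: le_trans (Re_le_cabs _) _|apply: le_trans (Im_le_cabs _) _];
    exact: HE.
Qed.

(** Doubling the radius leaves the integral unchanged by Cauchy's theorem, yet multiplies it by 2^b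
    by homogeneity. *)
Lemma circ_monomial r (b : int) : 0 < r -> b != 0 -> circ r (fun z : R[i] => z ^ b) = 0.
Proof.
move=> r0 b0.
have nz s : 0 < s -> forall z : R[i], cabs z = s -> z != 0.
  by move=> s0 z zs; rewrite -cabs_gt0 zs.
have cd s : 0 < s -> circ_cont s (fun z : R[i] => z ^ b).
  move=> s0; apply: circ_cont_cdiff => [|z zs]; first exact: ltW.
  by apply: cdiffXz; [exact: nz zs|exact: cdiff_id].
have E : circ r (fun z : R[i] => z ^ b) = circ (2 * r) (fun z : R[i] => z ^ b).
  apply: circ_eq => //; first by rewrite ler_peMl ?ler1n// ltW.
  move=> z /andP[rz _]; apply: cdiffXz; last exact: cdiff_id.
  by rewrite -cabs_gt0 (lt_le_trans r0).
have E2 y : (((2 * r)%:C)%C * cis y) ^ b = 2%:R ^ b * ((r%:C)%C * cis y) ^ b :> R[i].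
  have -> : ((2 * r)%:C)%C = 2%:R * (r%:C)%C :> R[i] by rewrite rmorphM /= rmorph_nat.
  by rewrite -mulrA expfzMl.
have : circ (2 * r) (fun z : R[i] => z ^ b) = (2%:R ^ b) * circ r (fun z : R[i] => z ^ b).
  rewrite -(circZ (2%:R ^ b) (ltW r0) (cd _ r0)).
  by apply: eq_Cint => y _; exact: E2.
rewrite -E => /eqP; rewrite -subr_eq0 -{1}[circ r _]mul1r -mulrBl mulf_eq0 => /orP[|/eqP//].
rewrite subr_eq0 => /eqP /(congr1 (@cabs R)); rewrite cabs1 cabsXz.
have -> : cabs (2%:R : R[i]) = 2 by rewrite -(rmorph_nat (real_complex R)) cabs_real normr_nat.
move=> /esym/eqP; rewrite (pexprz_eq1 _ (ler0n R 2)) => h2; exfalso; move: h2.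
case/orP => [/eqP b00|/eqP h]; first by rewrite b00 in b0.
have h1 : (1 : R) < 2 := ltr1n R 2.
by rewrite h ltxx in h1.
Qed.

(** 2 pi times the Laurent coefficient of index [b]. *)
Definition coef r (b : int) h := circ r (fun z : R[i] => h z * z ^ (- b)).

(** The geometric expansion of the Cauchy kernel, here for |z| > |w| and next for |z| < |w|. With
    the exact remainder it is a finite identity, so no series has to be integrated term by term. *)
Lemma geom_outer (z w : R[i]) N : z != 0 -> z != w ->
  z / (z - w) = \sum_(0 <= k < N) w ^+ k * z ^ (- k%:Z) + (w / z) ^+ N * (z / (z - w)).
Proof.
move=> z0 zw; have zw0 : z - w != 0 by rewrite subr_eq0.
elim: N => [|N IH]; first by rewrite big_nil expr0 mul1r add0r.
rewrite big_nat_recr//= {1}IH -!addrA; congr (_ + _).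
have -> : w ^+ N * z ^ (- N%:Z) = (w / z) ^+ N by rewrite -exprnN -expr_div_n.
by rewrite exprSr; move: ((w / z) ^+ N) => P; field; rewrite z0 zw0.
Qed.

Lemma geom_inner (z w : R[i]) N : w != 0 -> z != w ->
  z / (z - w) = - (\sum_(0 <= k < N) w ^ (- k.+1%:Z) * z ^+ k.+1) + (z / w) ^+ N * (z / (z - w)).
Proof.
move=> w0 zw; have zw0 : z - w != 0 by rewrite subr_eq0.
elim: N => [|N IH]; first by rewrite big_nil expr0 mul1r oppr0 add0r.
rewrite big_nat_recr//= {1}IH opprD -!addrA; congr (_ + _).
have -> : w ^ (- N.+1%:Z) * z ^+ N.+1 = (z / w) ^+ N * (z / w).
  by rewrite -exprnN mulrC -expr_div_n exprSr.
by rewrite exprSr; move: ((z / w) ^+ N) => P; field; rewrite w0 zw0.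
Qed.

(* At a negative real point the singularity of the Cauchy kernel lies at the argument
   pi, in the interior of the interval [0, 2 pi] used for circle integrals. *)
Theorem laurent h r r0 r' M N (w := - ((r0%:C)%C)) : 0 < r -> r < r0 -> r0 < r' ->
  (forall z, r <= cabs z <= r' -> cdifferentiable_at h z) ->
  (forall z, cabs z = r \/ cabs z = r' \/ z = w -> cabs (h z) <= M) ->
  cabs (((pi *+ 2)%:C)%C * h w
    - \sum_(0 <= k < N.+1) w ^+ k * coef r' k h
    - \sum_(0 <= k < N.+1) w ^ (- k.+1%:Z) * coef r (- k.+1%:Z) h)
  <= 4 * M * (pi *+ 2) * ((r0 / r') ^+ N.+1 * (r' / (r' - r0)) + (r / r0) ^+ N.+1 * (r / (r0 - r))).
Proof.
move=> rp rr0 r0r' H HM; have r0p := lt_trans rp rr0; have r'p := lt_trans r0p r0r'.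
have cw : cabs w = r0 by rewrite cabsN cabs_real gtr0_norm.
have w0 : w != 0 by rewrite -cabs_gt0 cw.
have ne0 s z : 0 < s -> cabs z = s -> z != 0 by move=> s0 zs; rewrite -cabs_gt0 zs.
have new s z : s != r0 -> cabs z = s -> z != w.
  by move=> sr zs; apply/eqP => zw; move/eqP: sr; rewrite -zs zw cw.
have nr : r != r0 by rewrite lt_eqF.
have nr' : r' != r0 by rewrite gt_eqF.
have inr z : cabs z = r -> r <= cabs z <= r'.
  by move=> ->; rewrite lexx (ltW (lt_trans rr0 r0r')).
have inr' z : cabs z = r' -> r <= cabs z <= r'.
  by move=> ->; rewrite lexx (ltW (lt_trans rr0 r0r')).
pose q z := z / (z - w).
have cq z : z != w -> cdifferentiable_at q z.
  move=> zw; apply: cdiffM; first exact: cdiff_id.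
  by apply: cdiffV; [rewrite subr_eq0|apply: cdiffD; [exact: cdiff_id|exact: cdiff_cst]].
(* The singularity of f at w is removable, so its integrals over both circles agree. Expanding the
   kernel outward on one circle and inward on the other turns this equality into Cauchy's formula
   with Laurent terms. *)
pose f z := (h z - h w) * q z.
have chw z : r <= cabs z <= r' -> cdifferentiable_at (fun z => h z - h w) z.
  by move=> zr; apply: cdiffD; [exact: H|exact: cdiff_cst].
have cf : circ r f = circ r' f.
  have /cdiffP[phi pc [d d0 Hd]] : cdifferentiable_at h w by apply: H; rewrite cw !ltW.
  (* Near w, f(z) equals phi(z) z with phi continuous at w, whence this bound. *)
  apply: (@circ_eq_removable _ r r0 r' ((cabs (phi w) + 1) * (r0 + 1))) => //.
    by move=> z zr zw; apply: cdiffM; [exact: chw|exact: cq].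
  have [d' d'0 Hd'] := pc 1 ltr01.
  exists (Num.min (Num.min d d') 1); first by rewrite !lt_min d0 d'0 ltr01.
  move=> z; rewrite -/w !lt_min => /andP[/andP[/Hd zd /Hd' zd'] z1] zw.
  rewrite /f /q zd addrAC subrr add0r.
  have -> : phi z * (z - w) * (z / (z - w)) = phi z * z by field; rewrite subr_eq0.
  rewrite cabsM ler_pM ?cabs_ge0//.
    by rewrite -[phi z](subrK (phi w)) (le_trans (le_cabsD _ _))// addrC lerD2l ltW.
  by rewrite -[z](subrK w) (le_trans (le_cabsD _ _))// addrC cw lerD2l ltW.
have cz s (b : int) : 0 < s -> circ_cont s (fun z : R[i] => z ^ b).
  move=> s0; apply: circ_cont_cdiff => [|z zs]; first exact: ltW.
  by apply: cdiffXz; [exact: ne0 zs|exact: cdiff_id].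
have chz s (b : int) : s = r \/ s = r' -> circ_cont s (fun z : R[i] => (h z - h w) * z ^ b).
  move=> sr; have s0 : 0 < s by case: sr => ->.
  apply: circ_cont_cdiff => [|z zs]; first exact: ltW.
  apply: cdiffM; last by apply: cdiffXz; [exact: ne0 zs|exact: cdiff_id].
  by apply: chw; case: sr zs => ->; [exact: inr|exact: inr'].
have chb s (b : int) : s = r \/ s = r' -> circ_cont s (fun z : R[i] => h z * z ^ b).
  move=> sr; have s0 : 0 < s by case: sr => ->.
  apply: circ_cont_cdiff => [|z zs]; first exact: ltW.
  apply: cdiffM; last by apply: cdiffXz; [exact: ne0 zs|exact: cdiff_id].
  by apply: H; case: sr zs => ->; [exact: inr|exact: inr'].
have cT s (u : R[i] -> R[i]) n : s = r \/ s = r' ->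
    (forall z, z != 0 -> cdifferentiable_at u z) ->
    circ_cont s (fun z : R[i] => (h z - h w) * (u z ^+ n * q z)).
  move=> sr ud; have s0 : 0 < s by case: sr => ->.
  have sr0 : s != r0 by case: sr => ->.
  apply: circ_cont_cdiff => [|z zs]; first exact: ltW.
  apply: cdiffM; first by apply: chw; case: sr zs => ->; [exact: inr|exact: inr'].
  apply: cdiffM; last by apply: cq; exact: new zs.
  by apply: cdiffX; apply: ud; exact: ne0 zs.
have split s (b : int) : s = r \/ s = r' ->
    circ s (fun z : R[i] => (h z - h w) * z ^ b) = coef s (- b) h - h w * circ s (fun z : R[i] => z ^ b).
  move=> sr; have s0 : 0 < s by case: sr => ->.
  rewrite /coef opprK -mulNr -circZ ?ltW//; last exact: cz.
  rewrite -circD ?ltW//; last 2 first.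
  - exact: chb.
  - by apply: circ_cont_cdiff => [|z zs]; [exact: ltW|
      apply: cdiffM; [exact: cdiff_cst|apply: cdiffXz; [exact: ne0 zs|exact: cdiff_id]]].
  by apply: eq_Cint => y _; ring.
pose T u z := (h z - h w) * (u z ^+ N.+1 * q z).
have expand s (a : nat -> R[i]) (e : nat -> int) (u : R[i] -> R[i]) : s = r \/ s = r' ->
    (forall z, z != 0 -> cdifferentiable_at u z) ->
    (forall z, cabs z = s -> q z = \sum_(0 <= k < N.+1) a k * z ^ e k + u z ^+ N.+1 * q z) ->
    circ s f = \sum_(0 <= k < N.+1) a k * coef s (- e k) h
      - h w * (\sum_(0 <= k < N.+1) a k * circ s (fun z : R[i] => z ^ e k)) + circ s (T u).
  move=> sr ud E; have s0 : 0 < s by case: sr => ->.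
  have cc k : circ_cont s (fun z => a k * ((h z - h w) * z ^ e k)).
    by move=> y; apply: ccontM; [exact: ccont_cst|exact: chz].
  have -> : circ s f = circ s (fun z =>
      \sum_(0 <= k < N.+1) a k * ((h z - h w) * z ^ e k) + T u z).
    apply: eq_circ => [|z zr]; first exact: ltW.
    rewrite /f /T {1}E// mulrDr big_distrr /=; congr (_ + _); apply: eq_bigr => k _.
    by rewrite mulrCA.
  rewrite circD ?ltW//; last 2 first.
  - by move=> y; apply: ccont_sum => k; exact: cc.
  - exact: cT.
  congr (_ + _); rewrite circ_sum ?ltW// big_distrr -sumrB /=; apply: eq_bigr => k _.
  rewrite circZ ?ltW//; last exact: chz.
  by rewrite split// mulrBr; congr (_ - _); rewrite mulrCA.
have ro : r' = r \/ r' = r' by right.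
have ri : r = r \/ r = r' by left.
have outer : circ r' f = \sum_(0 <= k < N.+1) w ^+ k * coef r' k h - h w * ((pi *+ 2)%:C)%C
    + circ r' (T (fun z => w / z)).
  rewrite (@expand r' (fun k => w ^+ k) (fun k => - k%:Z) (fun z => w / z))//; first last.
  - by move=> z zr; apply: geom_outer; [exact: ne0 zr|exact: new zr].
  - by move=> z z0; apply: cdiffM; [exact: cdiff_cst|apply: cdiffV => //; exact: cdiff_id].
  congr (_ - _ * _ + _); first by apply: eq_bigr => k _; rewrite opprK.
  (* Among the powers of z only the exponent 0 has a nonzero circle integral; it produces the term 2
     pi h(w). On the inner circle all exponents are positive and no such term arises. *)
  rewrite big_nat_recl// big1_seq ?addr0; last first.
    by move=> k _; rewrite circ_monomial ?mulr0// oppr_eq0.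
  rewrite expr0 mul1r -[RHS]mulr1 -(circ_cst r').
  by apply: eq_Cint => y _; rewrite oppr0 expr0z.
have inner : circ r f = - (\sum_(0 <= k < N.+1) w ^ (- k.+1%:Z) * coef r (- k.+1%:Z) h)
    + circ r (T (fun z => z / w)).
  rewrite (@expand r (fun k => - w ^ (- k.+1%:Z)) (fun k => k.+1%:Z) (fun z => z / w))//; first last.
  - move=> z zr; rewrite [LHS](@geom_inner _ _ N.+1)//; last exact: new zr.
    by rewrite -sumrN; congr (_ + _); apply: eq_bigr => k _; rewrite mulNr.
  - by move=> z z0; apply: cdiffM; [exact: cdiff_id|exact: cdiff_cst].
  rewrite [X in _ * X]big1_seq ?mulr0 ?subr0; last first.
    by move=> k _; rewrite circ_monomial ?mulr0.
  by rewrite -sumrN; congr (_ + _); apply: eq_bigr => k _; rewrite mulNr.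
have -> : ((pi *+ 2)%:C)%C * h w
    - \sum_(0 <= k < N.+1) w ^+ k * coef r' k h
    - \sum_(0 <= k < N.+1) w ^ (- k.+1%:Z) * coef r (- k.+1%:Z) h =
    circ r' (T (fun z => w / z)) - circ r (T (fun z => z / w)).
  move: cf; rewrite outer inner.
  move: (\sum_(0 <= k < N.+1) w ^+ k * _) (\sum_(0 <= k < N.+1) w ^ _ * _) (circ r _) (circ r' _).
  by move=> S1 S2 t t' /eqP; rewrite -subr_eq0 => /eqP E; apply/eqP; rewrite -subr_eq0 -E; apply/eqP; ring.
have M0 : 0 <= M by apply: le_trans (HM w _); [exact: cabs_ge0|right; right].
have hM z : cabs z = r \/ cabs z = r' -> cabs (h z - h w) <= 2 * M.
  move=> zr; rewrite (le_trans (le_cabsB _ _))// mulr2n mulrDl mul1r lerD//.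
    by apply: HM; case: zr; [left|right; left].
  by apply: HM; right; right.
have qle s z : cabs z = s -> s != r0 -> cabs (q z) <= s / `|s - r0|.
  move=> zs sr; have s0 : 0 <= s by rewrite -zs cabs_ge0.
  have sw : `|s - r0| <= cabs (z - w).
    rewrite ler_norml -zs -cw cabs_sub_ge andbT lerNl opprB cabsC.
    exact: cabs_sub_ge.
  have sr' : 0 < `|s - r0| by rewrite normr_gt0 subr_eq0.
  by rewrite cabsM cabsV zs ler_wpM2l// lef_pV2// posrE (lt_le_trans sr').
rewrite (le_trans (le_cabsB _ _))// mulrDr lerD//.
- rewrite (le_trans (le_cabs_circ (M := 2 * M * ((r0 / r') ^+ N.+1 * (r' / (r' - r0)))) _ _ _))//.
  + exact: ltW.
  + by apply: cT => // z z0; apply: cdiffM; [exact: cdiff_cst|apply: cdiffV => //; exact: cdiff_id].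
  + move=> z zr; rewrite cabsM ler_pM ?cabs_ge0//; first by apply: hM; right.
    rewrite cabsM ler_pM ?cabs_ge0//; first by rewrite cabsX cabsM cabsV cw zr.
    by rewrite (le_trans (qle _ _ zr nr'))// gtr0_norm// subr_gt0.
  + by rewrite le_eqVlt; apply/orP; left; apply/eqP; ring.
- rewrite (le_trans (le_cabs_circ (M := 2 * M * ((r / r0) ^+ N.+1 * (r / (r0 - r)))) _ _ _))//.
  + exact: ltW.
  + by apply: cT => // z z0; apply: cdiffM; [exact: cdiff_id|exact: cdiff_cst].
  + move=> z zr; rewrite cabsM ler_pM ?cabs_ge0//; first by apply: hM; left.
    rewrite cabsM ler_pM ?cabs_ge0//; first by rewrite cabsX cabsM cabsV cw zr.
    by rewrite (le_trans (qle _ _ zr nr))// distrC gtr0_norm// subr_gt0.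
  + by rewrite le_eqVlt; apply/orP; left; apply/eqP; ring.
Qed.
End Laurent.

(** * Measure-preserving maps and polar coordinates *)

Section MeasurePreserving.
Local Open Scope ereal_scope.

Section Preserving.
Context d (T : measurableType d) (R : realType).

Definition preserving (mu : set T -> \bar R) (f : T -> T) :=
  measurable_fun setT f /\ forall A, measurable A -> mu (f @^-1` A) = mu A.

Lemma preserving_comp mu f g : preserving mu f -> preserving mu g -> preserving mu (f \o g).
Proof.
move=> [mf pf] [mg pg]; split; first exact: measurableT_comp.
by move=> A mA; rewrite comp_preimage pg ?pf// -[X in measurable X]setTI; exact: mf.
Qed.
End Preserving.

Section LebesgueAffine.
Variable R : realType.
Notation leb := (@lebesgue_measure R).
Notation mR := (measurableTypeR R).

Lemma preimage_measurable d d' (T : measurableType d) (T' : measurableType d') (f : T -> T') A :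
  measurable_fun setT f -> measurable A -> measurable (f @^-1` A).
Proof. by move=> mf mA; rewrite -[X in measurable X]setTI; exact: mf. Qed.

(** The right side is a measure in A that agrees with Lebesgue measure on half-open intervals. *)
Lemma lebesgue_affine (a b : R) (A : set mR) : (0 < a)%R -> measurable A ->
  leb A = a%:E * leb ((fun x : mR => (a * x + b)%R : mR) @^-1` A).
Proof.
move=> a0 mA; pose f (x : mR) : mR := (a * x + b)%R.
have mf : measurable_fun [set: mR] f.
  have : measurable_fun [set: R] (fun x : R => (a * x + b)%R).
    by apply: measurable_funD => //; apply: measurable_funM.
  exact.
pose nu := mscale (NngNum (ltW a0)) (pushforward leb f) : {measure set mR -> \bar R}.
have -> : a%:E * leb (f @^-1` A) = nu mf A by [].
apply: lebesgue_measure_unique => // X [[x y] _ <-] /=.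
rewrite /nu /mscale /= /pushforward.
have -> : f @^-1` `]x, y]%classic = `]((x - b) / a)%R, ((y - b) / a)%R]%classic.
  by apply/seteqP; split => t /=; rewrite /f !in_itv /= ltr_pdivrMr// ler_pdivlMr// ltrBlDr lerBrDr [(t * a)%R]mulrC.
rewrite !lebesgue_measure_itv /= !lte_fin ltr_pM2r ?invr_gt0// ltrD2r.
case: ifP => _; last by rewrite mule0.
rewrite !EFinN -!EFinB -EFinM; congr _%:E; field.
by rewrite gt_eqF.
Qed.

Lemma lebesgue_shift (b : R) : preserving leb (fun x : mR => (x + b)%R : mR).
Proof.
split.
  have : measurable_fun [set: R] (fun x : R => (x + b)%R) by exact: measurable_funD.
  exact.
move=> A mA; rewrite (lebesgue_affine b ltr01 mA) mul1e; congr (leb _).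
by apply/funext => x /=; rewrite /preimage /= mul1r.
Qed.
End LebesgueAffine.

(* The library's sigma-finite instance on [\x] is shadowed by the one for
   subprobabilities, hence this copy. *)
Section ProductPreserving.
Context d1 d2 (T1 : measurableType d1) (T2 : measurableType d2) (R : realType).
Variable m1 : {sigma_finite_measure set T1 -> \bar R}.
Variable m2 : {sigma_finite_measure set T2 -> \bar R}.

Definition prodm (A : set (T1 * T2)) : \bar R := (m1 \x m2) A.

HB.instance Definition _ := Measure.copy prodm (m1 \x m2).

Lemma prodm_sigma_finite : sigma_finite setT prodm.
Proof.
have /sigma_finiteP[F [TF ndF Foo]] := sigma_finiteT m1.
have /sigma_finiteP[G [TG ndG Goo]] := sigma_finiteT m2.
exists (fun n => F n `*` G n) => [|k].
  apply/seteqP; split=> // -[x y] _.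
  have [i _ Fx] : (\bigcup_k F k) x by rewrite -TF.
  have [j _ Gy] : (\bigcup_k G k) y by rewrite -TG.
  exists (maxn i j) => //; split => /=.
    by move: Fx; apply/subsetPset/ndF/leq_maxl.
  by move: Gy; apply/subsetPset/ndG/leq_maxr.
have [? ?] := Foo k; have [? ?] := Goo k; split; first exact: measurableX.
by rewrite /prodm product_measure1E// lte_mul_pinfty// ge0_fin_numE.
Qed.

HB.instance Definition _ := Measure_isSigmaFinite.Build _ _ _ prodm prodm_sigma_finite.

Lemma prodmE2 A : measurable A -> prodm A = (m1 \x^ m2) A.
Proof.
by move=> mA; apply: product_measure_unique => // B C mB mC /=; rewrite product_measure2E.
Qed.

Lemma prodm_tonelli2 (f : T1 * T2 -> \bar R) : measurable_fun setT f ->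
  (forall x, 0 <= f x) -> \int[prodm]_z f z = \int[m2]_y \int[m1]_x f (x, y).
Proof. by move=> mf f0; exact: (fubini_tonelli2 f mf f0). Qed.

(** Cavalieri's principle: the map acts inside the fibres, possibly differently in each, and
    preserves the measure of every section. *)
Lemma preserving_fst (f : T2 -> T1 -> T1) :
  measurable_fun setT (fun p : T1 * T2 => (f p.2 p.1, p.2)) ->
  (forall y, preserving m1 (f y)) -> preserving prodm (fun p => (f p.2 p.1, p.2)).
Proof.
move=> mf H; split => // A mA; rewrite [LHS]prodmE2 ?[RHS]prodmE2//; last exact: preimage_measurable.
apply: eq_integral => y _ /=; rewrite -[RHS](H y).2; last exact: measurable_ysection.
by congr (m1 _); apply/seteqP; split => x; rewrite /= /ysection /= !inE.
Qed.

Lemma preserving_snd (f : T1 -> T2 -> T2) :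
  measurable_fun setT (fun p : T1 * T2 => (p.1, f p.1 p.2)) ->
  (forall x, preserving m2 (f x)) -> preserving prodm (fun p => (p.1, f p.1 p.2)).
Proof.
move=> mf H; split => // A mA.
apply: eq_integral => x _ /=; rewrite -[RHS](H x).2; last exact: measurable_xsection.
by congr (m2 _); apply/seteqP; split => y; rewrite /= /xsection /= !inE.
Qed.
End ProductPreserving.

(** * Rotation invariance in the plane and in C^2 *)

Section Plane.
Variable R : realType.
Notation leb := (@lebesgue_measure R).
Notation mR := (measurableTypeR R).

Definition plane := prodm leb leb.

Lemma preserving_shear1 (k : R) : preserving plane (fun p => (p.1 + k * p.2, p.2))%R.
Proof.
apply: (@preserving_fst _ _ _ _ _ leb leb (fun y x => x + k * y)%R).
  apply: measurable_fun_pair => //=; apply: measurable_funD => //; exact: measurable_funM.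
by move=> y; exact: lebesgue_shift.
Qed.

Lemma preserving_shear2 (k : R) : preserving plane (fun p => (p.1, p.2 + k * p.1))%R.
Proof.
apply: (@preserving_snd _ _ _ _ _ leb leb (fun x y => y + k * x)%R).
  apply: measurable_fun_pair => //=; apply: measurable_funD => //; exact: measurable_funM.
by move=> y; exact: lebesgue_shift.
Qed.

Definition rotation (t : R) (p : mR * mR) : mR * mR :=
  (p.1 * cos t - p.2 * sin t, p.1 * sin t + p.2 * cos t)%R.

(* A rotation is a product of three shears, except the half turn, which is the
   square of a quarter turn. *)
Lemma preserving_rotation (c s : R) : (c ^+ 2 + s ^+ 2 = 1)%R ->
  preserving plane (fun p => (p.1 * c - p.2 * s, p.1 * s + p.2 * c))%R.
Proof.
have gen (c' s' : R) : (c' ^+ 2 + s' ^+ 2 = 1)%R -> (1 + c' != 0)%R ->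
    preserving plane (fun p => (p.1 * c' - p.2 * s', p.1 * s' + p.2 * c'))%R.
  (* For c' = cos theta and s' = sin theta, k is minus the tangent of theta / 2, the slope of the
     outer two shears. *)
  move=> cs c1; pose k := (- s' / (1 + c'))%R.
  rewrite (_ : (fun p => _) = (fun p => (p.1 + k * p.2, p.2))%R \o
    ((fun p => (p.1, p.2 + s' * p.1))%R \o (fun p => (p.1 + k * p.2, p.2))%R)).
    by apply: preserving_comp; [exact: preserving_shear1|
      apply: preserving_comp; [exact: preserving_shear2|exact: preserving_shear1]].
  apply/funext => -[x y] /=.
  have s2 : (s' ^+ 2 = (1 - c') * (1 + c'))%R.
    by have -> : (s' ^+ 2 = 1 - c' ^+ 2)%R; [rewrite -cs addrC addKr|ring].
  have ks : (s' * k = c' - 1)%R.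
    by rewrite /k mulrA mulrN -expr2 s2 mulNr mulfK// opprB.
  have kc : (k * (1 + c') = - s')%R by rewrite /k divfK.
  have e2 : (y + s' * (x + k * y) = x * s' + y * c')%R.
    by rewrite mulrDr [(s' * (k * y))%R]mulrA ks; ring.
  congr pair => //; rewrite e2.
  transitivity (x + (k * (1 + c')) * y + (s' * k) * x)%R; last by ring.
  by rewrite kc ks; ring.
move=> cs; have [c1|] := eqVneq (1 + c)%R 0%R; last exact: gen.
have cE : (c = - 1)%R by apply/eqP; rewrite -addr_eq0 addrC c1.
have s0 : (s = 0)%R.
  move: cs; rewrite cE sqrrN expr1n => /(canRL (addKr _)).
  by rewrite addNr => /eqP; rewrite sqrf_eq0 => /eqP.
have g := gen 0%R 1%R; rewrite expr0n expr1n add0r addr0 oner_eq0 in g.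
rewrite (_ : (fun p => _) = (fun p => (p.1 * 0 - p.2 * 1, p.1 * 1 + p.2 * 0))%R \o
  (fun p => (p.1 * 0 - p.2 * 1, p.1 * 1 + p.2 * 0))%R); first by apply: preserving_comp; exact: g.
by apply/funext => -[x y] /=; congr pair; rewrite cE s0; ring.
Qed.

Lemma preserving_rot t : preserving plane (rotation t).
Proof. by apply: preserving_rotation; rewrite cos2Dsin2. Qed.

Definition plane2 := prodm plane plane.

Definition assoc4 (p : (mR * mR) * (mR * mR)) : mR * (mR * (mR * mR)) := (p.1.1, (p.1.2, p.2)).

Lemma measurable_assoc4 : measurable_fun setT assoc4.
Proof.
apply: measurable_fun_pair; first exact: measurableT_comp.
by apply: measurable_fun_pair => //; exact: measurableT_comp.
Qed.

(** The four real coordinates are regrouped into two planes, so that each complex coordinate can be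
    rotated on its own. Both sides are iterated integrals of the same sections, matched by Tonelli's
    theorem. *)
Lemma vol4_assoc A : measurable A -> vol4 R A = plane2 (assoc4 @^-1` A).
Proof.
move=> mA.
have mleb B : measurable B -> (leb \x^ leb) B = plane B.
  by move=> mB; rewrite /plane prodmE2.
have m3 B : measurable B -> (leb \x^ (leb \x^ leb)) B = prodm leb plane B.
  move=> mB; apply: etrans (esym (prodmE2 _ _ mB)).
  apply: (@eq_measure_integral _ _ _ _ plane (leb \x^ leb)) => C mC _; exact: mleb mC.
rewrite /vol4 /Defs.leb /=.
transitivity (\int[prodm leb plane]_y (leb (ysection A y))).
  apply: (@eq_measure_integral _ _ _ _ (prodm leb plane) (leb \x^ (leb \x^ leb))) => C mC _.
  exact: m3 mC.
have mA4 := preimage_measurable measurable_assoc4 mA.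
have mg : measurable_fun setT (fun y => leb (ysection A y)).
  exact: measurable_fun_ysection.
rewrite (prodm_tonelli2 leb plane mg (fun y => measure_ge0 _ _)).
apply: etrans (esym (prodmE2 plane plane mA4)).
apply: eq_integral => q _; apply: etrans (esym (prodmE2 leb leb (measurable_ysection q mA4))).
apply: eq_integral => y _ /=; congr (_ _).
by apply/seteqP; split => x; rewrite /ysection /= !inE /= /ysection /= !inE.
Qed.

Lemma preserving_rot2 s t : preserving plane2 (fun p => (rotation s p.1, rotation t p.2)).
Proof.
have mr u : measurable_fun setT (rotation u) by have [] := preserving_rot u.
have h1 : preserving plane2 (fun p : (mR * mR) * (mR * mR) => (rotation s p.1, p.2)).
  apply: (@preserving_fst _ _ _ _ _ plane plane (fun=> rotation s)) => [|_].
    by apply: measurable_fun_pair; [exact: measurableT_comp|exact: measurable_snd].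
  exact: preserving_rot.
have h2 : preserving plane2 (fun p : (mR * mR) * (mR * mR) => (p.1, rotation t p.2)).
  apply: (@preserving_snd _ _ _ _ _ plane plane (fun=> rotation t)) => [|_].
    by apply: measurable_fun_pair; [exact: measurable_fst|exact: measurableT_comp].
  exact: preserving_rot.
exact: (preserving_comp h1 h2).
Qed.
End Plane.
End MeasurePreserving.

(** * Polar coordinates through the squared radius *)

Section PolarCoordinates.
Local Open Scope ereal_scope.

Section Radial.
Variable R : realType.
Notation leb := (@lebesgue_measure R).
Notation mR := (measurableTypeR R).
Notation plane := (@plane R).

(** The squared radius is the polar variable: area pushes forward to a constant multiple of Lebesgue
    measure, with no Jacobian. *)
Definition sq (p : mR * mR) : mR := (p.1 ^+ 2 + p.2 ^+ 2)%R.

Lemma measurable_sq : measurable_fun setT sq.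
Proof.
have : measurable_fun [set: mR * mR] (fun p : mR * mR => (p.1 ^+ 2 + p.2 ^+ 2)%R : R).
  by apply: measurable_funD; apply: measurable_funX; [exact: measurable_fst|exact: measurable_snd].
exact.
Qed.

Lemma sq_ge0 p : (0 <= sq p)%R.
Proof. by rewrite addr_ge0// sqr_ge0. Qed.

Lemma planeX (A B : set mR) : measurable A -> measurable B ->
  plane (A `*` B) = leb A * leb B.
Proof. by move=> mA mB; exact: product_measure1E. Qed.

Lemma plane_scale (k : R) (A : set (mR * mR)) : (0 < k)%R -> measurable A ->
  plane A = (k ^+ 2)%:E * plane ((fun p : mR * mR => (k * p.1, k * p.2)%R : mR * mR) @^-1` A).
Proof.
move=> k0 mA; pose f (p : mR * mR) : mR * mR := (k * p.1, k * p.2)%R.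
have mf : measurable_fun setT f.
  have h1 : measurable_fun [set: mR * mR] (fun p : mR * mR => (k * p.1)%R : R).
    by apply: measurable_funM => //; exact: measurable_fst.
  have h2 : measurable_fun [set: mR * mR] (fun p : mR * mR => (k * p.2)%R : R).
    by apply: measurable_funM => //; exact: measurable_snd.
  by apply: measurable_fun_pair; [exact: h1|exact: h2].
have k2 : (0 <= k ^+ 2)%R by exact: sqr_ge0.
pose nu := mscale (NngNum k2) (pushforward plane f) : {measure set (mR * mR)%type -> \bar R}.
have -> : (k ^+ 2)%:E * plane (f @^-1` A) = nu mf A by [].
apply: (@product_measure_unique _ _ _ _ _ leb leb) => // B C mB mC.
pose g (x : mR) : mR := (k * x + 0)%R.
have mk (D : set mR) : measurable D -> measurable (g @^-1` D).
  move=> mD; apply: preimage_measurable mD.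
  have : measurable_fun [set: R] (fun x : R => (k * x + 0)%R).
    by apply: measurable_funD => //; apply: measurable_funM.
  exact.
have fBC : f @^-1` (B `*` C) = (g @^-1` B) `*` (g @^-1` C).
  by apply/seteqP; split => -[x y] /=; rewrite /g !addr0.
transitivity ((k ^+ 2)%:E * plane (f @^-1` (B `*` C))); first by [].
rewrite fBC planeX; [|exact: mk|exact: mk].
apply: etrans (f_equal2 mule (esym (lebesgue_affine 0 k0 mB)) (esym (lebesgue_affine 0 k0 mC))).
by rewrite muleACA -EFinM expr2.
Qed.

Definition disc (u : R) : set (mR * mR) := [set p | (sq p <= u)%R].

Lemma measurable_disc u : measurable (disc u).
Proof.
have -> : disc u = sq @^-1` `]-oo, u]%classic.
  by apply/seteqP; split => p; rewrite /disc /= /preimage /= in_itv.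
exact: preimage_measurable measurable_sq _.
Qed.

Lemma plane_disc1_lty : plane (disc 1) < +oo.
Proof.
have h : disc 1 `<=` `[(-1)%R, 1%R]%classic `*` `[(-1)%R, 1%R]%classic.
  move=> [x y]; rewrite /disc /sq /= => xy.
  have x2 : (x ^+ 2 <= 1)%R by rewrite (le_trans _ xy)// lerDl sqr_ge0.
  have y2 : (y ^+ 2 <= 1)%R by rewrite (le_trans _ xy)// lerDr sqr_ge0.
  by split; rewrite /= in_itv /= -ler_norml -(expr_le1 (n := 2))// real_normK ?num_real.
apply: (@le_lt_trans _ _ (plane (`[(-1)%R, 1%R]%classic `*` `[(-1)%R, 1%R]%classic))).
  apply: le_measure => //; rewrite inE; first exact: measurable_disc.
  exact: measurableX.
by rewrite planeX// lebesgue_measure_itv /= lte_fin ifT ?ltry// lt_neqAle; lra.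
Qed.

(* Only the positivity of this constant matters, so it is never identified with pi. *)
Definition disc_area : R := fine (plane (disc 1)).

Lemma disc_areaE : plane (disc 1) = disc_area%:E.
Proof. by rewrite fineK// ge0_fin_numE// plane_disc1_lty. Qed.

Lemma disc_area_gt0 : (0 < disc_area)%R.
Proof.
have h : `[0%R, (1 / 2)%R]%classic `*` `[0%R, (1 / 2)%R]%classic `<=` disc 1.
  move=> [x y] [] /=; rewrite !in_itv /= => /andP[x0 x1] /andP[y0 y1].
  by rewrite /disc /sq /=; nra.
rewrite -lte_fin -disc_areaE.
apply: (@lt_le_trans _ _ (plane (`[0%R, (1 / 2)%R]%classic `*` `[0%R, (1 / 2)%R]%classic))).
  rewrite planeX// lebesgue_measure_itv /= lte_fin ifT; last by lra.
  by rewrite -EFinB -EFinM lte_fin; lra.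
apply: le_measure => //; rewrite inE; last exact: measurable_disc.
exact: measurableX.
Qed.

(** For u > 0 the disc of squared radius u is the unit disc scaled by the square root of u; for u =
    0 it is a point. *)
Lemma plane_disc (u : R) : (0 <= u)%R -> plane (disc u) = (u * disc_area)%:E.
Proof.
rewrite le_eqVlt => /predU1P[<-|u0].
  have -> : disc 0 = [set 0%R] `*` [set 0%R].
    apply/seteqP; split => -[x y]; rewrite /disc /sq /=.
      move=> xy; have [x2 y2] : (0 <= x ^+ 2 /\ 0 <= y ^+ 2)%R by rewrite !sqr_ge0.
      by split; apply/eqP; rewrite -sqrf_eq0; apply/eqP; lra.
    by case=> -> ->; rewrite expr0n addr0.
  by rewrite planeX// lebesgue_measure_set1 mule0 mul0r.
have k0 : (0 < Num.sqrt u)%R by rewrite sqrtr_gt0.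
rewrite (plane_scale k0 (measurable_disc u)) sqr_sqrtr ?ltW// EFinM -disc_areaE; congr (_ * plane _).
have E (p : mR * mR) : sq ((Num.sqrt u * p.1)%R, (Num.sqrt u * p.2)%R) = (u * sq p)%R.
  by rewrite /sq /= !exprMn sqr_sqrtr ?ltW// mulrDr.
apply/funext => p; rewrite /preimage /disc /mkset E; congr (is_true _).
by rewrite -[X in (_ <= X)%R]mulr1 ler_pM2l.
Qed.

(** The measure of an interval is a difference of disc areas, hence proportional to its length;
    uniqueness of Lebesgue measure extends this to Borel sets. *)
Lemma plane_sq (B : set mR) : measurable B -> B `<=` [set x | (0 <= x)%R] ->
  plane (sq @^-1` B) = disc_area%:E * leb B.
Proof.
move=> mB B0.
have A0 := disc_area_gt0; have iA0 : (0 <= disc_area^-1)%R by rewrite invr_ge0 ltW.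
have main (x y : R) : leb (`]x, y]%classic : set mR) =
    disc_area^-1%:E * plane (sq @^-1` (`]x, y]%classic : set mR)) +
    leb ((`]x, y]%classic : set mR) `&` `]-oo, 0%R]%classic).
  pose I : set mR := `]x, y]%classic; rewrite -/I.
  have leb0 : leb set0 = 0 := measure0 leb.
  have plane0 D : D = set0 -> plane D = 0 by move=> ->; exact: measure0.
  have [yx|xy] := leP y x.
    have I0 : I = set0 by rewrite /I set_itv_ge// bnd_simp -leNgt.
    by rewrite plane0 ?I0 ?preimage_set0// set0I leb0 mule0 adde0.
  have disc0 u : (u < 0)%R -> disc u = set0.
    move=> u0; apply/seteqP; split => // p; rewrite /disc /= => pu.
    by have := le_lt_trans (le_trans (sq_ge0 p) pu) u0; rewrite ltxx.
  have sqE : sq @^-1` I = disc y `\` disc x.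
    apply/seteqP; split => p; rewrite /I /disc /preimage /= in_itv /=.
      by move=> /andP[h1 h2]; split=> //; apply/negP; rewrite -ltNge.
    by move=> [h1 /negP]; rewrite -ltNge h1 => ->.
  have lI : leb I = (y - x)%:E by rewrite /I lebesgue_measure_itv /= lte_fin xy EFinB.
  have iA : (disc_area^-1 * disc_area = 1)%R by rewrite mulVf// gt_eqF.
  have [y0|y0] := ltP y 0%R.
    rewrite plane0 ?mule0 ?add0e; last by rewrite sqE disc0// set0D.
    congr (leb _); apply/esym/setIidl => t; rewrite /I /= !in_itv /= => /andP[_ ty].
    by rewrite (le_trans ty)// ltW.
  have [x0|x0] := ltP x 0%R.
    have -> : I `&` `]-oo, 0%R]%classic = `]x, 0%R]%classic.
      apply/seteqP; split => t; rewrite /I /= !in_itv /=.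
        by move=> [/andP[-> _] ->].
      by move=> /andP[xt t0]; rewrite xt t0 (le_trans t0).
    have -> : plane (sq @^-1` I) = (y * disc_area)%:E.
      apply: etrans (plane_disc y0); congr (plane _).
      by rewrite sqE [X in _ `\` X]disc0// setD0.
    rewrite lI lebesgue_measure_itv /= lte_fin x0 -EFinM mulrCA iA mulr1.
    by rewrite -EFinB -EFinD; congr _%:E; ring.
  have -> : I `&` `]-oo, 0%R]%classic = set0.
    apply/seteqP; split => t //; rewrite /I /= !in_itv /= => -[/andP[xt _] t0].
    by have := lt_le_trans xt (le_trans t0 x0); rewrite ltxx.
  have sub : disc x `<=` disc y by move=> p; rewrite /disc /= => /le_trans; apply; exact: ltW.
  have -> : plane (sq @^-1` I) = (y * disc_area - x * disc_area)%:E.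
    have ylty : plane (disc y) < +oo by rewrite plane_disc// ltry.
    rewrite sqE; apply: etrans (measureD (mu := plane) (measurable_disc _) (measurable_disc _) ylty) _.
    rewrite setIidr// EFinB; congr (_ - _); exact: plane_disc.
  by rewrite lI leb0 adde0 -EFinM -mulrBl mulrCA iA mulr1.
(* The uniqueness theorem concerns measures on the whole line, so the normalised push-forward, which
   lives on the half line, is completed by Lebesgue measure on the negative side. *)
pose nu1 := mscale (NngNum iA0) (pushforward plane sq) : {measure set mR -> \bar R}.
have mN : measurable (`]-oo, 0%R]%classic : set mR) by exact: measurable_itv.
pose nu2 := mrestr leb mN : {measure set mR -> \bar R}.
pose nu := measure_add (nu1 measurable_sq) nu2.
have nuE (D : set mR) : nu D = disc_area^-1%:E * plane (sq @^-1` D) + leb (D `&` `]-oo, 0%R]%classic).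
  exact: measure_addE.
have E : leb B = nu B.
  apply: lebesgue_measure_unique => // X [[x y] _ <-].
  exact: etrans (main x y) (esym (nuE _)).
rewrite (etrans E (nuE B)).
have -> : leb (B `&` `]-oo, 0%R]%classic) = 0.
  apply/eqP; rewrite -measure_le0 -(lebesgue_measure_set1 (0%R : R)).
  apply: le_measure; rewrite ?inE//; first exact: measurableI.
  by move=> t /= [/B0 /= t0]; rewrite in_itv /= => t1; apply/eqP; rewrite eq_le t0 t1.
by rewrite adde0 muleA -EFinM divff ?gt_eqF// mul1e.
Qed.

Lemma integral_radial (D : set mR) (phi : mR -> \bar R) : measurable D ->
  D `<=` [set x | (0 <= x)%R] -> measurable_fun D phi -> {in D, forall u, 0 <= phi u} ->
  \int[plane]_(p in sq @^-1` D) phi (sq p) = disc_area%:E * \int[leb]_(u in D) phi u.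
Proof.
move=> mD D0 mphi phi0; rewrite -(ge0_integral_pushforward measurable_sq plane mD mphi phi0).
have dA : (0 <= disc_area)%R by rewrite ltW// disc_area_gt0.
pose nu := mscale (NngNum dA) leb : {measure set mR -> \bar R}.
transitivity (\int[nu]_(u in D) phi u).
  pose nu1 := pushforward plane sq : {measure set mR -> \bar R}.
  apply: (@eq_measure_integral _ _ _ D nu (nu1 measurable_sq)) => A mA AD.
  have P := plane_sq mA (subset_trans AD D0).
  by first [exact: P|exact: esym P].
by rewrite ge0_integral_mscale// => u Du; apply: phi0; rewrite inE.
Qed.
End Radial.
End PolarCoordinates.

(** * Norms of monomials *)

Section PowerIntegrals.
Variable R : realType.
Notation leb := (@lebesgue_measure R).
Notation mR := (measurableTypeR R).
Implicit Types (f F : R -> R) (e b p : R).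

Lemma FTC_pos f F e b : 0 < e -> e < b ->
  (forall x : R, 0 < x -> is_derive x 1 F (f x)) ->
  (forall x : R, 0 < x -> {for x, continuous f}) ->
  (\int[leb]_(x in `[e, b]) (f x)%:E = (F b - F e)%:E)%E.
Proof.
move=> e0 eb dF cf.
have Fc x : 0 < x -> {for x, continuous F}.
  move=> x0; apply: (@differentiable_continuous _ R^o R^o).
  by apply/derivable1_diffP; case: (dF x x0).
rewrite (@continuous_FTC2 _ f F)//.
- apply: continuous_in_subspaceT => x; rewrite inE /= in_itv /= => /andP[ex _].
  by apply: cf; exact: lt_le_trans ex.
- split.
  + move=> x; rewrite in_itv /= => /andP[ex _].
    by case: (dF x (lt_trans e0 ex)).
  + exact/cvg_at_right_filter/Fc.
  + by apply/cvg_at_left_filter/Fc; exact: lt_trans eb.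
- move=> x; rewrite in_itv /= => /andP[ex _].
  by rewrite derive1E; have := dF x (lt_trans e0 ex) => -[_ ->].
Qed.

Lemma continuous_powR_pos p x : 0 < x -> {for x, continuous (fun y : R => y `^ p)}.
Proof.
move=> x0; apply: (@differentiable_continuous _ R^o R^o).
by apply/derivable1_diffP; case: (is_derive1_powR p x0).
Qed.

Lemma integral_powR_segment p e b : 0 < e -> e < b -> p + 1 != 0 ->
  (\int[leb]_(x in `[e, b]) (x `^ p)%:E = ((b `^ (p + 1) - e `^ (p + 1)) / (p + 1))%:E)%E.
Proof.
move=> e0 eb p1.
have dF (x : R) : 0 < x -> is_derive x 1 (fun x => (p + 1)^-1 *: x `^ (p + 1)) (x `^ p).
  move=> x0; have h := is_derive1_powR (p + 1) x0.
  rewrite addrK in h.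
  have -> : x `^ p = (p + 1)^-1 *: ((p + 1) * x `^ p).
    by rewrite [_ *: _]mulrA mulVf// mul1r.
  exact: is_deriveZ.
rewrite (FTC_pos e0 eb dF (@continuous_powR_pos p)).
by rewrite -mulrBr mulrC.
Qed.

(** On (0, 1] the power dominates 1/x. The resulting logarithmic divergence makes monomials of
    infinite norm detectable. *)
Lemma integral_powR_ge p e : 0 < e -> e < 1 -> p <= -1 ->
  ((- ln e)%:E <= \int[leb]_(x in `[e, 1%R]) (x `^ p)%:E)%E.
Proof.
move=> e0 e1 p1.
have -> : ((- ln e)%:E = \int[leb]_(x in `[e, 1%R]) (x^-1)%:E)%E.
  have cV (x : R) : 0 < x -> {for x, continuous (fun x : R => x^-1)}.
    by move=> x0; apply: inv_continuous; rewrite gt_eqF.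
  by rewrite (FTC_pos e0 e1 (@is_derive1_ln R) cV) ln1 sub0r.
apply: ge0_le_integral => //.
- by move=> x; rewrite /= in_itv /= lee_fin invr_ge0 => /andP[ex _]; rewrite ltW// (lt_le_trans e0).
- apply/measurable_EFinP; apply: subspace_continuous_measurable_fun => //.
  apply: continuous_in_subspaceT => x; rewrite inE /= in_itv /= => /andP[ex _].
  by apply: inv_continuous; rewrite gt_eqF// (lt_le_trans e0).
- by apply/measurable_EFinP; apply: measurable_funTS; exact: measurable_powR.
- move=> x; rewrite /= in_itv /= lee_fin => /andP[ex x1].
  have x0 := lt_le_trans e0 ex.
  have x01 : 0 < x <= 1 by rewrite x0.
  have h := ger_powR x01 p1; rewrite powR_inv1 in h; last exact: ltW. exact: h.
Qed.

Lemma integral_powR0 p b : - 1 < p -> 0 < b ->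
  (\int[leb]_(x in `]0%R, b[) (x `^ p)%:E = (b `^ (p + 1) / (p + 1))%:E)%E.
Proof.
move=> p1 b0; have p0 : 0 < p + 1 by rewrite -ltrBlDr sub0r.
have mf D : measurable_fun D (fun x : R => (x `^ p)%:E).
  by apply/measurable_EFinP; apply: measurable_funTS; exact: measurable_powR.
rewrite integral_itv_bndo_bndc//.
(* Monotone convergence along segments exhausting (0, b]; the shift by 2 keeps the left end strictly
   below b already at n = 0. *)
pose F n : set mR := `[b / n.+2%:R, b]%classic.
have bn n : 0 < b / n.+2%:R :> R by rewrite divr_gt0.
have FU : \bigcup_n F n = `]0, b]%classic.
  apply/seteqP; split => x; rewrite /F /= ?in_itv /=.
    by case=> n _; rewrite /= in_itv /= => /andP[nx ->]; rewrite (lt_le_trans (bn n)).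
  move=> /andP[x0 xb]; exists (Num.bound (b / x)) => //=; rewrite in_itv /= xb andbT.
  rewrite ler_pdivrMr// mulrC -ler_pdivrMr// ltW// (lt_le_trans (archi_boundP _))//.
    by rewrite divr_ge0// ltW.
  by rewrite ler_nat ltnW.
have c1 : (\int[leb]_(x in F n) (x `^ p)%:E @[n --> \oo] -->
    \int[leb]_(x in `]0%R, b]) (x `^ p)%:E)%E.
  rewrite -FU; apply: ge0_nondecreasing_set_cvg_integral => //.
  - move=> n m nm; rewrite subsetEset => x; rewrite /F /= !in_itv /= => /andP[h ->].
    by rewrite andbT (le_trans _ h)// ler_pM2l// lef_pV2 ?posrE// ler_nat ltnS.
  - by move=> n; exact: measurable_itv.
  - by move=> n; exact: mf.
  - by move=> n x Fx; rewrite lee_fin powR_ge0.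
have c2 : (\int[leb]_(x in F n) (x `^ p)%:E @[n --> \oo] -->
    (b `^ (p + 1) / (p + 1))%:E)%E.
  have -> : (fun n => \int[leb]_(x in F n) (x `^ p)%:E)%E =
      (fun n => ((b `^ (p + 1) - (b / n.+2%:R) `^ (p + 1)) / (p + 1))%:E).
    apply/funext => n; rewrite integral_powR_segment// ?gt_eqF//.
    by rewrite ltr_pdivrMr// ltr_pMr// ltr1n.
  apply: cvg_EFin; first exact: nearW.
  have -> : b `^ (p + 1) / (p + 1) = (b `^ (p + 1) - 0) / (p + 1) by rewrite subr0.
  apply: cvgMr_tmp; apply: cvgB; first exact: cvg_cst.
  apply: (cvg_at_rightP _ _ _).1 (powR_cvg0 p0) _ _; split=> //.
  have h := @cvg_harmonic R; rewrite -cvg_shiftS in h.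
  have := @cvgMl_tmp _ _ _ _ _ b _ h; rewrite mulr0; exact.
exact: cvg_unique c1 c2.
Qed.
End PowerIntegrals.

Section MonomialNorm.
Variable R : realType.
Notation leb := (@lebesgue_measure R).
Notation mR := (measurableTypeR R).
Notation plane := (@plane R).
Notation plane2 := (@plane2 R).
Notation R4 := ((mR * mR) * (mR * mR))%type.

Definition cz (p : mR * mR) : R[i] := (p.1 +i* p.2)%C.

Lemma sqr_cabs_cz p : cabs (cz p) ^+ 2 = sq p.
Proof. by rewrite sqr_cabs. Qed.

(* The null set z1 = 0 is removed so that both coordinates have a polar form, and
   e > 0 cuts off the part near z2 = 0 where a monomial may fail to be square integrable. *)
Definition Hset (g e : R) : set R4 :=
  [set x | Hgamma g (cz x.1, cz x.2) /\ 0 < sq x.1 /\ e < sq x.2].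

(** In squared moduli both sides of |z1|^g < |z2| carry an exponent 1/2, which cancels after raising
    to the power 2/g. *)
Lemma HsetE (g e : R) (x : R4) : 0 < g -> 0 <= e ->
  Hset g e x <-> (0 < sq x.1 < sq x.2 `^ g^-1 /\ e < sq x.2 < 1).
Proof.
move=> g0 e0; case: x => p q; rewrite /Hset /Hgamma /=.
have cE (r : mR * mR) : cabs (cz r) = sq r `^ 2^-1 by rewrite powR12_sqrt// sq_ge0.
have p0 : 0 <= sq p := sq_ge0 p. have q0 : 0 <= sq q := sq_ge0 q.
rewrite !cE; move: (sq p) (sq q) p0 q0 => s v s0 v0 {cE p q}.
have n (u r : R) : u `^ r \is Num.nneg by rewrite nnegrE powR_ge0.
have h1 : (s `^ 2^-1 `^ g < v `^ 2^-1) <-> (s < v `^ g^-1).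
  split.
    move=> /(gt0_ltr_powR (r := 2 / g) (divr_gt0 (ltr0n _ 2) g0) (n _ _) (n _ _)).
    have -> : s `^ 2^-1 `^ g `^ (2 / g) = s.
      by rewrite -!powRrM (_ : _ * _ = 1) ?powRr1//; field; rewrite gt_eqF.
    have -> // : v `^ 2^-1 `^ (2 / g) = v `^ g^-1.
    by rewrite -powRrM; congr (_ `^ _); field; rewrite gt_eqF.
  have sn : s \is Num.nneg by rewrite nnegrE.
  move=> /(gt0_ltr_powR (r := g / 2) (divr_gt0 g0 (ltr0n _ 2)) sn (n _ _)).
  have -> : s `^ (g / 2) = s `^ 2^-1 `^ g by rewrite -powRrM mulrC.
  have -> // : v `^ g^-1 `^ (g / 2) = v `^ 2^-1.
  by rewrite -powRrM; congr (_ `^ _); field; rewrite gt_eqF.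
have h2 : (v `^ 2^-1 < 1) = (v < 1).
  by rewrite powR12_sqrt// -[X in _ < X]sqrtr1 ltr_sqrt.
rewrite h2; split; first by move=> [[/h1 -> ->] [-> ->]].
by move=> [/andP[-> /h1 ->] /andP[-> ->]].
Qed.

Lemma measurable_lt_fun d (T : measurableType d) (f h : T -> R) :
  measurable_fun setT f -> measurable_fun setT h -> measurable [set x | f x < h x].
Proof.
move=> mf mh; have m := measurable_funB mh mf.
have -> : [set x | f x < h x] = (h \- f) @^-1` `]0, +oo[%classic.
  by apply/funext => x; rewrite /preimage /mkset /= in_itv /= andbT subr_gt0.
exact: preimage_measurable m _.
Qed.

Lemma measurable_sq1 : measurable_fun [set: R4] (fun x : R4 => sq x.1 : R).
Proof. exact: (measurableT_comp (@measurable_sq R) measurable_fst). Qed.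
Lemma measurable_sq2 : measurable_fun [set: R4] (fun x : R4 => sq x.2 : R).
Proof. exact: (measurableT_comp (@measurable_sq R) measurable_snd). Qed.

Lemma measurable_Hset (g e : R) : 0 < g -> 0 <= e -> measurable (Hset g e).
Proof.
move=> g0 e0.
have -> : Hset g e = [set x : R4 | 0 < sq x.1] `&` [set x : R4 | sq x.1 < sq x.2 `^ g^-1] `&`
    ([set x : R4 | e < sq x.2] `&` [set x : R4 | sq x.2 < 1]).
  apply/seteqP; split => x; first by move=> /(HsetE _ g0 e0)[/andP[h0 h1] /andP[h2 h3]].
  by move=> [[h0 h1] [h2 h3]]; apply/(HsetE _ g0 e0); split; apply/andP.
have m1 := measurable_sq1; have m2 := measurable_sq2.
apply: measurableI; [apply: measurableI|apply: measurableI].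
- by apply: measurable_lt_fun.
- apply: measurable_lt_fun => //.
  exact: (measurableT_comp (measurable_powR g^-1) m2).
- by apply: measurable_lt_fun.
- by apply: measurable_lt_fun.
Qed.

Local Open Scope ereal_scope.

Lemma integral_powRn (a : nat) (r : R) : (0 < r)%R ->
  \int[leb]_(u in `]0%R, r[) (u ^+ a)%:E = (r ^+ a.+1 / a.+1%:R)%:E.
Proof.
move=> r0; transitivity (\int[leb]_(u in `]0%R, r[) (u `^ a%:R)%:E).
  apply: eq_integral => u; rewrite inE /= in_itv /= => /andP[u0 _].
  by rewrite powR_mulrn// ltW.
rewrite integral_powR0//; last by rewrite (lt_le_trans _ (ler0n R a))// ltrN10.
by rewrite natr1 powR_mulrn// ltW.
Qed.

(** For fixed z2 with squared modulus v, z1 runs over a disc of squared radius v^(1/g). Integrating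
    u^a over it gives v^((a+1)/g) / (a+1), the source of the shift (a+1)/g in the exponent. *)
Lemma integral_monomial (g e : R) (a : nat) (b : R) : (0 < g)%R -> (0 <= e)%R ->
  \int[plane2]_(x in Hset g e) (sq x.1 ^+ a * sq x.2 `^ b)%:E =
  (disc_area R ^+ 2 / a.+1%:R)%:E *
    \int[leb]_(v in `]e, 1%R[) (v `^ (b + a.+1%:R / g))%:E.
Proof.
move=> g0 e0; pose f (x : R4) : \bar R := (sq x.1 ^+ a * sq x.2 `^ b)%:E.
pose A := disc_area R.
have mf : measurable_fun setT f.
  apply/measurable_EFinP; apply: measurable_funM.
    by apply: measurable_funX; exact: measurable_sq1.
  exact: (measurableT_comp (measurable_powR b) measurable_sq2).
have mH := measurable_Hset g0 e0.
have mfH : measurable_fun setT (f \_ (Hset g e)).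
  by apply/(measurable_restrictT f) => //; apply: measurable_funTS.
have fH0 x : 0 <= (f \_ (Hset g e)) x.
  rewrite patchE; case: ifP => // _.
  by rewrite lee_fin mulr_ge0 ?exprn_ge0 ?sq_ge0 ?powR_ge0.
rewrite integral_mkcond (prodm_tonelli2 plane plane mfH fH0).
pose h (v : mR) : \bar R := (A / a.+1%:R * v `^ (b + a.+1%:R / g))%:E.
pose D : set mR := `]e, 1%R[%classic.
have mD : measurable D by exact: measurable_itv.
transitivity (\int[plane]_(q in @sq R @^-1` D) h (sq q)).
  rewrite [RHS]integral_mkcond; apply: eq_integral => q _.
  rewrite patchE; case: ifPn => [|/negP qD].
    rewrite inE /D /preimage /= in_itv /= => /andP[eq1 q1].
    have q0 : (0 < sq q)%R by rewrite (le_lt_trans e0).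
    pose r := (sq q `^ g^-1)%R; have r0 : (0 < r)%R by rewrite powR_gt0.
    pose I : set mR := `]0%R, r[%classic.
    have mI : measurable I by exact: measurable_itv.
    pose k (u : mR) : \bar R := (sq q `^ b)%:E * (u ^+ a)%:E.
    transitivity (\int[plane]_(p in @sq R @^-1` I) k (sq p)).
      rewrite [RHS]integral_mkcond; apply: eq_integral => p _; rewrite !patchE.
      case: ifPn => [|/negP pH].
        rewrite inE => /(HsetE _ g0 e0)[/= pr _]; rewrite ifT.
          by rewrite /f /k /= -EFinM mulrC.
        by rewrite inE /I /preimage /= in_itv /= pr.
      rewrite ifF//; apply/negP; rewrite inE /I /preimage /= in_itv /= => pr.
      by apply: pH; rewrite inE; apply/(HsetE _ g0 e0); rewrite /= eq1.
    have mua E' : measurable_fun E' (fun u : R => (u ^+ a)%:E).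
      by apply/measurable_EFinP; exact: exprn_measurable.
    rewrite (@integral_radial _ I k)//; last 3 first.
    - by move=> u; rewrite /I /= in_itv /= => /andP[/ltW].
    - by apply: measurable_funeM; exact: mua.
    - move=> u; rewrite inE /I /= in_itv /= => /andP[/ltW u0 _].
      by rewrite /k mule_ge0// lee_fin ?powR_ge0 ?exprn_ge0.
    rewrite /k ge0_integralZl//; last 3 first.
    - exact: mua.
    - by move=> u; rewrite /I /= in_itv /= => /andP[/ltW u0 _]; rewrite lee_fin exprn_ge0.
    - by rewrite lee_fin powR_ge0.
    rewrite integral_powRn// -!EFinM /h -/A; congr _%:E.
    rewrite powRD; last by rewrite (gt_eqF q0) implybT.
    have -> : (r ^+ a.+1 = sq q `^ (a.+1%:R / g))%R.
      by rewrite -powR_mulrn ?ltW// /r -powRrM mulrC.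
    by field; rewrite ?nat1r ?natr1 pnatr_eq0.
  apply: integral0_eq => p _; rewrite patchE ifF//; apply/negP; rewrite inE.
  move=> /(HsetE _ g0 e0)[_ /= qq]; apply: qD.
  by rewrite inE /D /preimage /= in_itv.
have mp E' : measurable_fun E' (fun v : R => (v `^ (b + a.+1%:R / g))%:E).
  by apply/measurable_EFinP; apply: measurable_funTS; exact: measurable_powR.
have A0 : (0 <= A / a.+1%:R)%R by rewrite divr_ge0// ltW// disc_area_gt0.
rewrite (@integral_radial _ D h)//; last 3 first.
- by move=> v; rewrite /D /= in_itv /= => /andP[ev _]; rewrite ltW// (le_lt_trans e0).
- rewrite (_ : h = (fun v => (A / a.+1%:R)%:E * (v `^ (b + a.+1%:R / g))%:E)).
    by apply: measurable_funeM; exact: mp.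
  by apply/funext => v; rewrite /h EFinM.
- by move=> v _; rewrite /h lee_fin mulr_ge0// powR_ge0.
rewrite /h; under eq_integral do rewrite EFinM.
rewrite ge0_integralZl//; last 2 first.
- exact: mp.
- by move=> v _; rewrite lee_fin powR_ge0.
by rewrite muleA -EFinM mulrA -expr2.
Qed.
End MonomialNorm.

(** * Averages over tori *)

Section Continuity2.
Variable R : realType.
Notation mR := (measurableTypeR R).
Notation R4 := ((mR * mR) * (mR * mR))%type.
Implicit Types (F G : C2 R -> R[i]) (z w : C2 R).

Definition c2cont F z := forall e : R, 0 < e -> exists d : R, 0 < d /\
  forall w, cabs (w.1 - z.1) < d -> cabs (w.2 - z.2) < d -> cabs (F w - F z) < e.

Lemma c2contM F G z : c2cont F z -> c2cont G z -> c2cont (fun w => F w * G w) z.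
Proof.
move=> fc gc e e0; have [c c0 Hc] := cmul_close (F z) (G z) e0.
have [d [d0 Hd]] := fc _ c0; have [d' [d'0 Hd']] := gc _ c0.
exists (Num.min d d'); split; first by rewrite lt_min d0.
by move=> w; rewrite !lt_min => /andP[w1 w1'] /andP[w2 w2']; apply: Hc; [exact: Hd|exact: Hd'].
Qed.

Lemma c2cont_conj F z : c2cont F z -> c2cont (fun w => (F w)^*%C) z.
Proof.
move=> fc e /fc[d [d0 Hd]]; exists d; split=> // w w1 w2.
by rewrite -rmorphB /= cabs_conj Hd.
Qed.

Lemma c2cont_fst (f : R[i] -> R[i]) z : ccont f z.1 -> c2cont (fun w => f w.1) z.
Proof. by move=> fc e /fc[d d0 Hd]; exists d; split=> // w w1 _; exact: Hd. Qed.

Lemma c2cont_snd (f : R[i] -> R[i]) z : ccont f z.2 -> c2cont (fun w => f w.2) z.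
Proof. by move=> fc e /fc[d d0 Hd]; exists d; split=> // w _ w2; exact: Hd. Qed.

Definition czz (x : R4) : C2 R := (cz x.1, cz x.2).

Definition close (d : R) (x y : R4) := `|y.1.1 - x.1.1| < d /\ `|y.1.2 - x.1.2| < d /\
  `|y.2.1 - x.2.1| < d /\ `|y.2.2 - x.2.2| < d.

Lemma measurable_close d x : measurable (close d x).
Proof.
have m (f : R4 -> R) (c : R) : measurable_fun setT f -> measurable [set y | `|f y - c| < d].
  move=> mf; apply: measurable_lt_fun => //.
  apply: measurableT_comp => //; exact: measurable_funB.
rewrite (_ : close d x = [set y | `|y.1.1 - x.1.1| < d] `&` ([set y | `|y.1.2 - x.1.2| < d] `&`
  ([set y | `|y.2.1 - x.2.1| < d] `&` [set y | `|y.2.2 - x.2.2| < d])))//.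
have m1 := @measurable_fst _ _ (mR * mR)%type (mR * mR)%type.
have m2 := @measurable_snd _ _ (mR * mR)%type (mR * mR)%type.
have n1 := @measurable_fst _ _ mR mR.
have n2 := @measurable_snd _ _ mR mR.
apply: measurableI; [apply: (m (fun y => y.1.1))|apply: measurableI;
  [apply: (m (fun y => y.1.2))|apply: measurableI; [apply: (m (fun y => y.2.1))|apply: (m (fun y => y.2.2))]]].
- exact: (measurableT_comp n1 m1).
- exact: (measurableT_comp n2 m1).
- exact: (measurableT_comp n1 m2).
- exact: (measurableT_comp n2 m2).
Qed.

Lemma rat_close (c d : R) : 0 < d -> exists q : rat, `|c - ratr q| < d.
Proof.
move=> d0; have := @rat_in_itvoo R (c - d) (c + d); case.
  by rewrite ltrBlDr -addrA ltrDl addr_gt0.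
move=> q; rewrite in_itv /= => /andP[h1 h2]; exists q.
by rewrite ltr_norml; lra.
Qed.

(* Every point of a relatively open set has a rational box around it. *)
Lemma measurable_rel_open (D A : set R4) : measurable D -> A `<=` D ->
  (forall x, A x -> exists2 d : R, 0 < d & forall y, D y -> close d x y -> A y) ->
  measurable A.
Proof.
move=> mD AD HA.
pose I := ((rat * rat) * (rat * rat) * nat)%type.
pose ctr (i : I) : R4 := ((ratr i.1.1.1, ratr i.1.1.2), (ratr i.1.2.1, ratr i.1.2.2)).
pose B (i : I) := close i.2.+1%:R^-1 (ctr i).
pose F (i : I) : set R4 := if pselect (D `&` B i `<=` A) then D `&` B i else set0.
have -> : A = \bigcup_i F i.
  apply/seteqP; split => [x Ax|x [i _]]; last first.
    by rewrite /F; case: pselect => // H /H.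
  have [d d0 Hd] := HA x Ax.
  have [n Hn] : exists n : nat, n.+1%:R^-1 + n.+1%:R^-1 < d.
    exists (Num.bound (2 / d)); have h0 : 0 <= 2 / d by rewrite divr_ge0// ltW.
    have h := archi_boundP h0.
    set m := Num.bound _ in h *.
    have m0 : 0 < m.+1%:R :> R by rewrite ltr0n.
    have -> : m.+1%:R^-1 + m.+1%:R^-1 = 2 / m.+1%:R :> R by rewrite mulr2n mulrDl mul1r.
    rewrite ltr_pdivrMr// mulrC -ltr_pdivrMr// (lt_le_trans h)//.
    by rewrite ler_nat.
  have n0 : 0 < n.+1%:R^-1 :> R by rewrite invr_gt0.
  have [q1 h1] := rat_close x.1.1 n0; have [q2 h2] := rat_close x.1.2 n0.
  have [q3 h3] := rat_close x.2.1 n0; have [q4 h4] := rat_close x.2.2 n0.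
  pose i : I := (((q1, q2), (q3, q4)), n).
  exists i => //; rewrite /F; case: pselect => [H|H]; first by split; [exact: AD|].
  exfalso; apply: H => y [Dy [k1 [k2 [k3 k4]]]]; apply: Hd => //.
  have tri (a b : R) (q : rat) : `|a - ratr q| < n.+1%:R^-1 -> `|b - ratr q| < n.+1%:R^-1 -> `|b - a| < d.
    move=> ha hb; rewrite (lt_trans _ Hn)//.
    have -> : b - a = (b - ratr q) - (a - ratr q) by ring.
    by rewrite (le_lt_trans (ler_normB _ _))// ltrD.
  by split; [exact: tri h1 k1|split; [exact: tri h2 k2|split; [exact: tri h3 k3|exact: tri h4 k4]]].
apply: countable_bigcupT_measurable; first exact: countableP.
move=> i; rewrite /F; case: pselect => h /=; last exact: measurable0.
by apply: measurableI => //; exact: measurable_close.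
Qed.

(** Superlevel sets are relatively open in D. Nothing is asked of u outside D, because the functions
    at hand are continuous only at points of the domain or of a torus. *)
Lemma measurable_rel_cont (D : set R4) (u : R4 -> R) : measurable D ->
  (forall x, D x -> forall e, 0 < e -> exists2 d : R, 0 < d &
    forall y, D y -> close d x y -> `|u y - u x| < e) -> measurable_fun D u.
Proof.
move=> mD Hu mD'; apply: (measurability _ (RGenOInfty.measurableE R)) => //.
move=> _ [_ [a ->] <-]; rewrite preimage_itvoy.
apply: (measurable_rel_open mD); first by move=> x [].
move=> x [Dx /= ax]; have [|d d0 Hd] := Hu x Dx (u x - a); first by rewrite subr_gt0.
exists d => // y Dy /(Hd y Dy); rewrite ltr_norml => /andP[h _]; split => //=.
by rewrite opprB ltrBrDr addrC subrKC in h.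
Qed.

Lemma c2cont_measurable (D : set R4) F : measurable D ->
  (forall x, D x -> c2cont F (czz x)) ->
  measurable_fun D (fun x => complex.Re (F (czz x))) /\
  measurable_fun D (fun x => complex.Im (F (czz x))).
Proof.
move=> mD HF.
have K x : D x -> forall e, 0 < e -> exists2 d : R, 0 < d &
    forall y, D y -> close d x y -> cabs (F (czz y) - F (czz x)) < e.
  move=> Dx e e0; have [d [d0 Hd]] := HF x Dx e e0.
  exists (d / 2); first by rewrite divr_gt0.
  move=> y _ [h1 [h2 [h3 h4]]].
  apply: Hd => /=; rewrite (le_lt_trans (cabs_le_ReIm _))//= (splitr d); exact: ltrD.
split; apply: measurable_rel_cont => // x Dx e e0; have [d d0 Hd] := K x Dx e e0;
  exists d => // y Dy xy; apply: le_lt_trans (Hd y Dy xy).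
- by rewrite -CReB Re_le_cabs.
- by rewrite -CImB Im_le_cabs.
Qed.
End Continuity2.

(** * Averaging over a family of measure-preserving maps *)

Section Averaging.
Context d1 d2 (X : measurableType d1) (Th : measurableType d2) (R : realType).
Variable mu : {sigma_finite_measure set X -> \bar R}.
Variable nu : {sigma_finite_measure set Th -> \bar R}.
Variables (S : set Th) (c : R) (T : Th * X -> X).
Hypotheses (mS : measurable S) (nuS : nu S = c%:E) (mT : measurable_fun setT T).
Hypothesis pT : forall t, preserving mu (fun x => T (t, x)).
Local Open Scope ereal_scope.

Lemma integral_preserving (f : X -> X) (g : X -> \bar R) : preserving mu f ->
  mu.-integrable setT g -> \int[mu]_x g (f x) = \int[mu]_x g x /\
  mu.-integrable setT (g \o f).
Proof.
move=> [mf pf] gi; have mg := measurable_int _ gi.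
have pE (h : X -> \bar R) : measurable_fun setT h -> (forall x, 0 <= h x) ->
    \int[mu]_x h (f x) = \int[mu]_x h x.
  move=> mh h0; rewrite -[LHS](ge0_integral_pushforward mf mu measurableT mh) //.
  pose m := pushforward mu f : {measure set X -> \bar R}.
  by apply: (@eq_measure_integral _ _ _ setT mu (m mf)) => A mA _; exact: pf.
have gfi : mu.-integrable setT (g \o f).
  apply/integrableP; split; first exact: measurableT_comp.
  have mag : measurable_fun setT (abse \o g) by exact: measurableT_comp.
  rewrite (pE (abse \o g) mag (fun x => abse_ge0 (g x))) //.
  by case/integrableP : gi.
split=> //; rewrite -[LHS](integral_pushforward mf mg gfi measurableT).
pose m := pushforward mu f : {measure set X -> \bar R}.
by apply: (@eq_measure_integral _ _ _ setT mu (m mf)) => A mA _; exact: pf.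
Qed.

(** Fubini's theorem for the indicator of S at t times g(T(t, x)). Integrating over x first gives
    the integral of g for every t, by invariance; integrating over t first gives H. *)
Lemma averaging (g H : X -> R) : mu.-integrable setT (EFin \o g) ->
  (forall x, \int[nu]_(t in S) (g (T (t, x)))%:E = (H x)%:E) ->
  \int[mu]_x (H x)%:E = c%:E * \int[mu]_x (g x)%:E.
Proof.
move=> gi gH; have mg := measurable_int _ gi.
pose G (p : Th * X) : \bar R := (\1_S p.1)%:E * (g (T p))%:E.
have m1S : measurable_fun setT (fun p : Th * X => (\1_S p.1)%:E : \bar R).
  by apply/measurable_EFinP; apply: measurableT_comp => //; exact: measurable_fst.
have mG : measurable_fun setT G.
  by apply: emeasurable_funM => //; exact: (measurableT_comp mg mT).
have c0 : 0 <= c%:E by rewrite -nuS measure_ge0.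
have iS : \int[nu]_t (\1_S t)%:E = c%:E by rewrite integral_indic// setIT; exact: nuS.
have intS (k : \bar R) : 0 <= k -> \int[nu]_t ((\1_S t)%:E * k) = c%:E * k.
  move=> k0; rewrite ge0_integralZr//; last exact/measurable_EFinP.
  by rewrite iS.
have Gi : (nu \x mu).-integrable setT G.
  apply/(integrable12ltyP nu mu mG).
  rewrite (eq_integral (fun t => (\1_S t)%:E * \int[mu]_x `|(g x)%:E|)); last first.
    move=> t _; under eq_integral do rewrite /G abseM /=.
    have ai : mu.-integrable setT (fun x => `|(g x)%:E|) by exact: integrable_abse gi.
    have [<- gti] := integral_preserving (pT t) ai.
    have mgt := measurable_int mu gti.
    transitivity (\int[mu]_x ((\1_S t)%:E * `|(g (T (t, x)))%:E|)).
      by apply: eq_integral => x _; rewrite /= ger0_norm.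
    rewrite ge0_integralZl//; exact: mgt.
  rewrite intS//; last exact: integral_ge0.
  by apply: lte_mul_pinfty => //; case/integrableP : gi.
have := Fubini Gi; rewrite /G /=.
rewrite (eq_integral (fun t => (\1_S t)%:E * \int[mu]_x (g x)%:E)); last first.
  move=> t _; have [<- gti] := integral_preserving (pT t) gi.
  by rewrite -integralZl.
rewrite [X in _ = X -> _](eq_integral (fun x => (H x)%:E)); last first.
  move=> x _; rewrite -gH [RHS]integral_mkcond; apply: eq_integral => t _.
  rewrite patchE indicE; case: ifP => _; first by rewrite mul1e.
  by rewrite mul0e.
move=> <-; have gf := integrable_fin_num measurableT gi.
rewrite -(fineK gf) integralZr//; last first.
  apply/integrableP; split; first exact/measurable_EFinP.
  rewrite (eq_integral (fun t => (\1_S t)%:E)); last by move=> t _; rewrite gee0_abs// lee_fin.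
  by rewrite iS ltry.
by rewrite iS.
Qed.
End Averaging.

Section Torus.
Variable R : realType.
Notation leb := (@lebesgue_measure R).
Notation mR := (measurableTypeR R).
Notation plane := (@plane R).
Notation I02 := (`[0, pi *+ 2]%classic : set mR).
Implicit Types (F K : C2 R -> R[i]) (z : C2 R).

Lemma polar_exists (z : R[i]) : exists2 t : R, 0 <= t <= pi *+ 2 & z = ((cabs z)%:C)%C * cis t.
Proof.
have p0 := @pi_ge0 R.
have [->|z0] := eqVneq z 0; first by exists 0; rewrite ?lexx ?pi2_ge0// cabs0 mul0r.
have k0 : 0 < cabs z by rewrite cabs_gt0.
pose x := complex.Re z / cabs z; pose y := complex.Im z / cabs z.
have xy : x ^+ 2 + y ^+ 2 = 1.
  by rewrite !expr_div_n -mulrDl -sqr_cabs divff// expf_neq0// gt_eqF.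
have x1 : -1 <= x <= 1.
  by rewrite -ler_norml normrM normfV (gtr0_norm k0) ler_pdivrMr// mul1r Re_le_cabs.
have [a0 ca] := acos_def x1.
have sa : sin (acos x) = `|y|.
  by rewrite sin_acos// -sqrtr_sqr; congr Num.sqrt; rewrite -xy addrAC subrr add0r.
have zE t : cos t = x -> sin t = y -> z = ((cabs z)%:C)%C * cis t.
  move=> ct st; apply: complex_eq; rewrite ?CReM ?CImM /= ct st mul0r ?subr0 ?addr0 /x /y mulrC divfK ?gt_eqF//.
have [y0|y0] := leP 0 y.
  exists (acos x); last by apply: zE; rewrite ?sa ?ger0_norm.
  by case/andP: a0 => -> h /=; rewrite (le_trans h)// mulr2n lerDl.
exists (pi *+ 2 - acos x).
  by case/andP: a0 => h h'; rewrite subr_ge0 (le_trans h') ?gerBl// mulr2n lerDl.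
apply: zE; first by rewrite addrC cosD2pi cosN.
by rewrite addrC sinD2pi sinN sa ltr0_norm// opprK.
Qed.

Lemma dist_cabs (a b : R[i]) : `|cabs a - cabs b| <= cabs (b - a).
Proof.
by rewrite ler_norml -[in X in _ && X]cabsC cabs_sub_ge andbT lerNl opprB cabs_sub_ge.
Qed.

Lemma cis_near (y0 d : R) : 0 < d -> exists2 e : R, 0 < e &
  forall y, `|y - y0| < e -> cabs (cis y - cis y0) < d.
Proof.
move=> /(pol_near 0 y0)[e e0 He]; exists e => // y ye.
by have := He 0 y; rewrite subrr normr0 /pol expR0 !mul1r; apply.
Qed.

Definition on_torus (r1 r2 : R) z := cabs z.1 = r1 /\ cabs z.2 = r2.

Lemma cabs_rcis (r t : R) : 0 <= r -> cabs ((r%:C)%C * cis t) = r.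
Proof. by move=> r0; rewrite cabsM cabs_cis mulr1 cabs_real ger0_norm. Qed.

(** The torus is the continuous image of a compact square of angles. The bound serves for Fubini's
    theorem and for the Laurent remainders. *)
Lemma torus_bounded K r1 r2 : 0 <= r1 -> 0 <= r2 ->
  (forall z, on_torus r1 r2 z -> c2cont K z) ->
  exists M, forall z, on_torus r1 r2 z -> cabs (K z) <= M.
Proof.
move=> r10 r20 HK.
pose phi (x : R^o * R^o) : R^o := cabs (K ((r1%:C)%C * cis x.1, (r2%:C)%C * cis x.2)).
have cphi : continuous phi.
  move=> [s t]; apply/(@cvgrPdist_lt _ R^o) => e e0.
  have [d [d0 Hd]] := HK ((r1%:C)%C * cis s, (r2%:C)%C * cis t) (conj (cabs_rcis s r10) (cabs_rcis t r20)) e e0.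
  pose M := r1 + r2 + 1; have M0 : 0 < M by rewrite ltr_wpDl// addr_ge0.
  have dM : 0 < d / M by rewrite divr_gt0.
  have [e1 e10 H1] := cis_near s dM; have [e2 e20 H2] := cis_near t dM.
  have : nbhs ((s, t) : R^o * R^o) (ball (s : R^o) e1 `*` ball (t : R^o) e2).
    by exists (ball (s : R^o) e1, ball (t : R^o) e2) => //; split; exact: nbhsx_ballx.
  apply: filterS => -[s' t'] [/= hs ht].
  have c1 : cabs (cis s' - cis s) < d / M by apply: H1; rewrite distrC.
  have c2 : cabs (cis t' - cis t) < d / M by apply: H2; rewrite distrC.
  have k (r : R) (u : R[i]) : 0 <= r -> r < M -> cabs u < d / M -> cabs ((r%:C)%C * u) < d.
    move=> r0 rM; rewrite cabsM cabs_real ger0_norm// ltr_pdivlMr// => h.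
    by rewrite (le_lt_trans _ h)// mulrC ler_wpM2l ?cabs_ge0// ltW.
  have : cabs (K ((r1%:C)%C * cis s', (r2%:C)%C * cis t') - K ((r1%:C)%C * cis s, (r2%:C)%C * cis t)) < e.
    apply: Hd; rewrite /= -mulrBr; apply: k => //; rewrite /M -addrA ?ltrDl; last by rewrite addrCA ltrDl ltr_wpDl.
    by rewrite ltr_wpDl.
  apply: le_lt_trans; exact: dist_cabs.
have cptI := @segment_compact R 0 (pi *+ 2).
have /compact_bounded[M [_ HM]] : compact (phi @` (`[0 : R, pi *+ 2]%classic `*` `[0 : R, pi *+ 2]%classic)).
  by apply: continuous_compact; [exact: continuous_subspaceT|exact: compact_setX].
exists (M + 1) => z [z1 z2].
have [s s0 zs] := polar_exists z.1; have [t t0 zt] := polar_exists z.2.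
have /HM : M < M + 1 by rewrite ltrDl.
move=> /(_ (phi (s, t))) h; apply: le_trans (ler_norm _) _.
have -> : cabs (K z) = phi (s, t) by rewrite /phi /= -z1 -zs -z2 -zt; case: (z).
apply: h; by exists (s, t).
Qed.

Definition square : set (mR * mR) := I02 `*` I02.

Lemma measurable_I02 : measurable I02.
Proof. exact: measurable_itv. Qed.

Lemma leb_I02 : leb I02 = (pi *+ 2)%:E.
Proof.
rewrite lebesgue_measure_itv /= lte_fin; case: ifPn => [_|]; first by rewrite sube0.
by rewrite -leNgt => h; have p0 := @pi_gt0 R; move: h; rewrite leNgt pmulrn_lgt0 ?p0.
Qed.

Lemma plane_square : plane square = ((pi *+ 2) ^+ 2)%:E.
Proof.
rewrite /square; apply: etrans (planeX measurable_I02 measurable_I02) _.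
by rewrite leb_I02 -EFinM expr2.
Qed.

Lemma measurable_square : measurable square.
Proof. by apply: measurableX; exact: measurable_I02. Qed.

Local Open Scope ereal_scope.

(** [Rintegral] keeps only the finite part of an extended integral. The bound M makes every section
    integral finite, so the real iterated integrals are the extended ones. *)
Lemma square_fubini (u : R -> R -> R) (M : R) :
  measurable_fun square (fun x : mR * mR => u x.1 x.2) ->
  (forall x, square x -> `|u x.1 x.2| <= M)%R ->
  [/\ \int[plane]_(x in square) (u x.1 x.2)%:E =
    (\int[leb]_(s in I02) (\int[leb]_(t in I02) u s t))%:E,
  \int[plane]_(x in square) (u x.1 x.2)%:E =
    (\int[leb]_(t in I02) (\int[leb]_(s in I02) u s t))%:E &
  leb.-integrable I02 (fun s => (\int[leb]_(t in I02) u s t)%R%:E)].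
Proof.
move=> mu uM; pose f (x : mR * mR) : \bar R := (u x.1 x.2)%:E.
have mS := measurable_square; have mI := measurable_I02.
have ltI : leb I02 < +oo by rewrite leb_I02 ltry.
have fi : plane.-integrable square f.
  apply: (@measurable_bounded_integrable _ _ _ plane (fun x => u x.1 x.2) square) => //.
    have lt : plane square < +oo by rewrite plane_square ltry.
    exact: lt.
  by exists M; split; [exact: num_real|move=> x Mx y Sy; exact: le_trans (uM y Sy) (ltW Mx)].
have fSi : (leb \x leb).-integrable setT (f \_ square).
  have := (integrable_restrict plane mS measurableT f).1; rewrite setTI; apply; exact: fi.
have sec1 s : \int[leb]_t (f \_ square) (s, t) =
    ((fun s => \int[leb]_(t in I02) (u s t)%:E) \_ I02) s.
  rewrite [RHS]patchE; case: ifPn => [|/negP] sI; rewrite inE in sI.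
    rewrite [RHS]integral_mkcond; apply: eq_integral => t _; rewrite !patchE.
    case: ifPn => [|/negP] tI; rewrite inE in tI; first by case: tI => _ /= tI; rewrite ifT// inE.
    by rewrite ifF//; apply/negP; rewrite inE => t2; apply: tI.
  apply: integral0_eq => t _; rewrite patchE ifF//; apply/negP; rewrite inE => -[/= s2 _].
  exact: sI.
have sec2 t : \int[leb]_s (f \_ square) (s, t) =
    ((fun t => \int[leb]_(s in I02) (u s t)%:E) \_ I02) t.
  rewrite [RHS]patchE; case: ifPn => [|/negP] tI; rewrite inE in tI.
    rewrite [RHS]integral_mkcond; apply: eq_integral => s _; rewrite !patchE.
    case: ifPn => [|/negP] sI; rewrite inE in sI; first by case: sI => /= sI _; rewrite ifT// inE.
    by rewrite ifF//; apply/negP; rewrite inE => s2; apply: sI.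
  apply: integral0_eq => s _; rewrite patchE ifF//; apply/negP; rewrite inE => -[_ /= t2].
  exact: tI.
have fin1 s : I02 s -> \int[leb]_(t in I02) (u s t)%:E = (\int[leb]_(t in I02) u s t)%:E.
  move=> sI; rewrite /Rintegral fineK//; apply: integrable_fin_num => //.
  apply: (@measurable_bounded_integrable _ _ _ leb (u s) I02) => //.
  - apply: (@measurable_comp _ _ _ _ _ _ square (fun x : mR * mR => u x.1 x.2) I02 (fun t : mR => (s : mR, t))) => //.
      by move=> _ [t tI <-].
    by apply: measurable_funTS; exact: pair1_measurable.
  - by exists M; split; [exact: num_real|move=> x Mx y Sy; exact: le_trans (uM (s, y) (conj sI Sy)) (ltW Mx)].
have fin2 t : I02 t -> \int[leb]_(s in I02) (u s t)%:E = (\int[leb]_(s in I02) u s t)%:E.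
  move=> tI; rewrite /Rintegral fineK//; apply: integrable_fin_num => //.
  apply: (@measurable_bounded_integrable _ _ _ leb (u^~ t) I02) => //.
  - apply: (@measurable_comp _ _ _ _ _ _ square (fun x : mR * mR => u x.1 x.2) I02 (fun s : mR => (s, t : mR))) => //.
      by move=> _ [s sI <-].
    by apply: measurable_funTS; exact: pair2_measurable.
  - by exists M; split; [exact: num_real|move=> x Mx y Sy; exact: le_trans (uM (y, t) (conj Sy tI)) (ltW Mx)].
have fn : \int[plane]_(x in square) f x \is a fin_num by exact: integrable_fin_num.
have e0 : \int[plane]_(x in square) f x = \int[leb \x leb]_x (f \_ square) x.
  by rewrite integral_mkcond.
have e1 : \int[plane]_(x in square) f x = \int[leb]_(s in I02) (\int[leb]_(t in I02) u s t)%:E.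
  rewrite e0 -(integral12_prod_meas1 fSi) [RHS]integral_mkcond; apply: eq_integral => s _.
  by rewrite /fubini_F sec1 !patchE; case: ifPn => // sI; rewrite inE in sI; exact: fin1.
have e2 : \int[plane]_(x in square) f x = \int[leb]_(t in I02) (\int[leb]_(s in I02) u s t)%:E.
  rewrite e0 -(integral21_prod_meas1 fSi) [RHS]integral_mkcond; apply: eq_integral => t _.
  by rewrite /fubini_G sec2 !patchE; case: ifPn => // tI; rewrite inE in tI; exact: fin2.
split.
- by rewrite [in RHS]/Rintegral -e1 fineK.
- by rewrite [in RHS]/Rintegral -e2 fineK.
- have Fi := integrable_fubini_F fSi.
  have : leb.-integrable (setT `&` I02) (fun s => \int[leb]_(t in I02) (u s t)%:E).
    apply/(integrable_restrict leb mI measurableT).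
    by apply: eq_integrable Fi => // s _; rewrite /fubini_F sec1.
  by rewrite setTI; apply: eq_integrable => // s; rewrite inE => /fin1.
Qed.
End Torus.

Section TorusIntegral.
Variable R : realType.
Notation leb := (@lebesgue_measure R).
Notation mR := (measurableTypeR R).
Notation plane := (@plane R).
Notation R4 := ((mR * mR) * (mR * mR))%type.
Notation I02 := (`[0, pi *+ 2]%classic : set mR).
Implicit Types (F K : C2 R -> R[i]) (h : R[i] -> R[i]).

Lemma measurable_cos : measurable_fun [set: mR] (fun t : mR => cos t : mR).
Proof.
have : measurable_fun [set: R] (fun t : R => cos t).
  by apply: continuous_measurable_fun => t; exact: continuous_cos.
exact.
Qed.

Lemma measurable_sin : measurable_fun [set: mR] (fun t : mR => sin t : mR).
Proof.
have : measurable_fun [set: R] (fun t : R => sin t).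
  by apply: continuous_measurable_fun => t; exact: continuous_sin.
exact.
Qed.

Definition torus (r1 r2 : R) K : R[i] := circ r1 (fun z1 => circ r2 (fun z2 => K (z1, z2))).

Definition torus_pt (r1 r2 : R) (x : mR * mR) : C2 R :=
  ((r1%:C)%C * cis x.1, (r2%:C)%C * cis x.2).

(** K is continuous only at points of the torus, so measurability is proved on the torus as a subset
    of R^4 and then composed with the parametrisation by angles. *)
Lemma measurable_torus_pt K r1 r2 : 0 <= r1 -> 0 <= r2 ->
  (forall z, on_torus r1 r2 z -> c2cont K z) ->
  measurable_fun setT (fun x => complex.Re (K (torus_pt r1 r2 x))) /\
  measurable_fun setT (fun x => complex.Im (K (torus_pt r1 r2 x))).
Proof.
move=> r10 r20 HK.
pose D : set R4 := (fun x : R4 => sq x.1 : R) @^-1` [set r1 ^+ 2] `&`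
  (fun x : R4 => sq x.2 : R) @^-1` [set r2 ^+ 2].
have mD : measurable D.
  by apply: measurableI; [exact: preimage_measurable (@measurable_sq1 R) (measurable_set1 _)|
    exact: preimage_measurable (@measurable_sq2 R) (measurable_set1 _)].
have onD x : D x -> on_torus r1 r2 (czz x).
  by move=> [/= h1 h2]; split; apply/eqP; rewrite -(eqrXn2 (n := 2)) ?cabs_ge0// sqr_cabs_cz ?h1 ?h2.
have [m1 m2] := c2cont_measurable mD (fun x Dx => HK _ (onD x Dx)).
pose g (x : mR * mR) : R4 := ((r1 * cos x.1, r1 * sin x.1), (r2 * cos x.2, r2 * sin x.2)).
have mg : measurable_fun setT g.
  have mc (r : R) : measurable_fun [set: mR] (fun t : mR => r * cos t : mR).
    by apply: measurable_funM => //; exact: measurable_cos.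
  have ms (r : R) : measurable_fun [set: mR] (fun t : mR => r * sin t : mR).
    by apply: measurable_funM => //; exact: measurable_sin.
  have p1 := @measurable_fst _ _ mR mR; have p2 := @measurable_snd _ _ mR mR.
  apply: measurable_fun_pair; apply: measurable_fun_pair.
  - exact: (measurableT_comp (mc r1) p1).
  - exact: (measurableT_comp (ms r1) p1).
  - exact: (measurableT_comp (mc r2) p2).
  - exact: (measurableT_comp (ms r2) p2).
have sqg r t : sq (r * cos t, r * sin t) = r ^+ 2.
  by rewrite /sq /= !exprMn -mulrDr cos2Dsin2 mulr1.
have gD : g @` setT `<=` D by move=> _ [x _ <-]; split; rewrite /= sqg.
have czg x : czz (g x) = torus_pt r1 r2 x.
  rewrite /czz /g /cz /torus_pt; congr pair.
    by apply: complex_eq; rewrite ?CReM ?CImM /= mul0r ?subr0 ?addr0.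
  by apply: complex_eq; rewrite ?CReM ?CImM /= mul0r ?subr0 ?addr0.
split.
- have h := measurable_comp mD gD m1 mg.
  by apply: eq_measurable_fun h => x _; rewrite /= czg.
- have h := measurable_comp mD gD m2 mg.
  by apply: eq_measurable_fun h => x _; rewrite /= czg.
Qed.

Lemma on_torus_pt r1 r2 x : 0 <= r1 -> 0 <= r2 -> on_torus r1 r2 (torus_pt r1 r2 x).
Proof. by move=> r10 r20; split; exact: cabs_rcis. Qed.

Lemma torusE K r1 r2 : 0 <= r1 -> 0 <= r2 -> (forall z, on_torus r1 r2 z -> c2cont K z) ->
  [/\ torus r1 r2 K = circ r2 (fun z2 => circ r1 (fun z1 => K (z1, z2))),
   (\int[plane]_(x in @square R) (complex.Re (K (torus_pt r1 r2 x)))%:E = (complex.Re (torus r1 r2 K))%:E)%E,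
   (\int[plane]_(x in @square R) (complex.Im (K (torus_pt r1 r2 x)))%:E = (complex.Im (torus r1 r2 K))%:E)%E &
   Cintegrable leb I02 (fun y => circ r2 (fun z2 => K ((r1%:C)%C * cis y, z2)))].
Proof.
move=> r10 r20 HK; have [m1 m2] := measurable_torus_pt r10 r20 HK.
have [M HM] := torus_bounded r10 r20 HK.
have b1 x : @square R x -> `|complex.Re (K (torus_pt r1 r2 x))| <= M.
  by move=> _; rewrite (le_trans (Re_le_cabs _))// HM//; exact: on_torus_pt.
have b2 x : @square R x -> `|complex.Im (K (torus_pt r1 r2 x))| <= M.
  by move=> _; rewrite (le_trans (Im_le_cabs _))// HM//; exact: on_torus_pt.
have [e1 e1' i1] := @square_fubini R (fun s t => complex.Re (K (torus_pt r1 r2 (s, t)))) M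
  (measurable_funTS m1) b1.
have [e2 e2' i2] := @square_fubini R (fun s t => complex.Im (K (torus_pt r1 r2 (s, t)))) M
  (measurable_funTS m2) b2.
split; [|exact: e1|exact: e2|by split; [exact: i1|exact: i2]].
apply: complex_eq.
- exact: (EFin_inj (etrans (esym e1) e1')).
- exact: (EFin_inj (etrans (esym e2) e2')).
Qed.

(** The translated interval [p, 2 pi + p] gains a piece of length p at the end and loses the
    congruent piece at the start. *)
Lemma periodic_integral (f : R -> R) (p : R) : continuous f -> 0 <= p <= pi *+ 2 ->
  (forall y, f (y + pi *+ 2) = f y) ->
  \int[leb]_(y in I02) f (y + p) = \int[leb]_(y in I02) f y.
Proof.
move=> cf /andP[p0 p2] per.
have fi a b : leb.-integrable `[a, b] (EFin \o f).
  by apply: integrable_segment_pt => y _; exact: cf.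
have shift a b c : \int[leb]_(y in `[a, b]) f (y + c) = \int[leb]_(y in `[a + c, b + c]) f y.
  rewrite /Rintegral; congr fine.
  rewrite [RHS]integral_mkcond [LHS]integral_mkcond.
  have gi : leb.-integrable setT ((EFin \o f) \_ `[a + c, b + c]).
    have mI : measurable (`[a + c, b + c]%classic : set mR) by exact: measurable_itv.
    by have := (integrable_restrict leb mI measurableT (EFin \o f)).1; rewrite setTI; apply; exact: fi.
  have [<- _] := integral_preserving (lebesgue_shift c) gi.
  apply: eq_integral => y _; rewrite !patchE /=.
  by congr (if _ then _ else _); apply/idP/idP; rewrite !inE /= !in_itv /= !lerD2r.
rewrite shift add0r.
have pi0 := @pi2_ge0 R.
have p2p : p <= pi *+ 2 + p by rewrite lerDr.
have pip : pi *+ 2 <= pi *+ 2 + p by rewrite lerDl.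
have E1 := Rintegral_segmentD p0 p2p (fi 0 (pi *+ 2 + p)).
have E2 := Rintegral_segmentD pi0 pip (fi 0 (pi *+ 2 + p)).
have E3 : \int[leb]_(y in `[pi *+ 2, pi *+ 2 + p]) f y = \int[leb]_(y in `[0, p]) f y.
  have := shift 0 p (pi *+ 2); rewrite add0r [p + _]addrC => <-.
  by apply: eq_Rintegral => y _; rewrite per.
by have := etrans (esym E1) E2; rewrite E3 [X in _ = X]addrC => /addrI.
Qed.

Lemma circ_rot h r p : 0 <= r -> 0 <= p <= pi *+ 2 -> circ_cont r h ->
  circ r (fun z => h (z * cis p)) = circ r h.
Proof.
move=> r0 p02 hc.
have per y : cis (y + pi *+ 2) = cis y by rewrite cisD cis2pi mulr1.
have E y : (r%:C)%C * cis y * cis p = (r%:C)%C * cis (y + p) by rewrite cisD mulrA.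
apply: complex_eq => /=.
- under eq_Rintegral do rewrite E.
  apply: (@periodic_integral (fun y => complex.Re (h ((r%:C)%C * cis y)))) => //.
    by move=> y; have [] := circ_cont_pt y r0 hc.
  by move=> y; rewrite per.
- under eq_Rintegral do rewrite E.
  apply: (@periodic_integral (fun y => complex.Im (h ((r%:C)%C * cis y)))) => //.
    by move=> y; have [] := circ_cont_pt y r0 hc.
  by move=> y; rewrite per.
Qed.

Lemma c2cont_circ1 K r1 z2 : (forall z1, cabs z1 = r1 -> c2cont K (z1, z2)) -> 0 <= r1 ->
  circ_cont r1 (fun z1 => K (z1, z2)).
Proof.
move=> H r10 y e e0; have [d [d0 Hd]] := H _ (cabs_rcis y r10) e e0.
by exists d => // z zd; apply: Hd => //=; rewrite subrr cabs0.
Qed.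

Lemma c2cont_circ2 K r2 z1 : (forall z2, cabs z2 = r2 -> c2cont K (z1, z2)) -> 0 <= r2 ->
  circ_cont r2 (fun z2 => K (z1, z2)).
Proof.
move=> H r20 y e e0; have [d [d0 Hd]] := H _ (cabs_rcis y r20) e e0.
by exists d => // z zd; apply: Hd => //=; rewrite subrr cabs0.
Qed.

(** Each rotation acts on the inner circle integral, where continuity of the integrand is at hand.
    Exchanging the order of integration brings z1 inside. *)
Lemma torus_rot K (r1 r2 p q : R) : 0 <= r1 -> 0 <= r2 -> 0 <= p <= pi *+ 2 -> 0 <= q <= pi *+ 2 ->
  (forall z, on_torus r1 r2 z -> c2cont K z) ->
  torus r1 r2 (fun z => K (z.1 * cis p, z.2 * cis q)) = torus r1 r2 K.
Proof.
move=> r10 r20 pp qq HK.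
have rot (r : R) (z : R[i]) (t : R) : cabs z = r -> cabs (z * cis t) = r by move=> zr; rewrite cabsM cabs_cis mulr1.
transitivity (torus r1 r2 (fun z => K (z.1 * cis p, z.2))).
  apply: eq_circ => // z1 z1r /=.
  apply: (circ_rot (h := fun z2 => K (z1 * cis p, z2))) => //.
  by apply: c2cont_circ2 => // z2 z2r; apply: HK; split => //=; exact: rot.
have H1 z : on_torus r1 r2 z -> c2cont (fun z => K (z.1 * cis p, z.2)) z.
  move=> [z1 z2] e e0; have [d [d0 Hd]] := HK (z.1 * cis p, z.2) (conj (rot _ _ p z1) z2) e e0.
  exists d; split=> // w w1 w2; apply: Hd => //=.
  by rewrite -mulrBl cabsM cabs_cis mulr1.
have [-> _ _ _] := torusE r10 r20 H1.
have [-> _ _ _] := torusE r10 r20 HK.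
apply: eq_circ => // z2 z2r /=.
apply: (circ_rot (h := fun z1 => K (z1, z2))) => //.
by apply: c2cont_circ1 => // z1 z1r; apply: HK.
Qed.
End TorusIntegral.

(** * Laurent coefficients of square integrable functions *)

Section Coefficients.
Variable R : realType.
Notation mR := (measurableTypeR R).
Notation R4 := ((mR * mR) * (mR * mR))%type.
Variables (g : R) (F : C2 R -> R[i]).
Hypothesis g0 : 0 < g.
Hypothesis HF : holomorphic_on (Hgamma g) F.

Definition monomial (a : nat) (b : int) (z : C2 R) : R[i] := z.1 ^+ a * z.2 ^ b.

Definition laurent_term (a : int) (b : int) (z : C2 R) : R[i] :=
  F z * z.1 ^ (- a) * z.2 ^ (- b).

(** The moduli of the points of the domain with z1 nonzero, that is its Reinhardt shadow off the
    axis. *)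
Definition in_base (r1 r2 : R) := [/\ 0 < r1, r1 `^ g < r2 & r2 < 1].

Lemma in_base_pos r1 r2 : in_base r1 r2 -> 0 < r2.
Proof. by move=> [_ h _]; rewrite (le_lt_trans _ h)// powR_ge0. Qed.

Lemma in_base_Hgamma r1 r2 z : in_base r1 r2 -> on_torus r1 r2 z -> Hgamma g z.
Proof. by move=> [_ h1 h2] [e1 e2]; rewrite /Hgamma /= e1 e2. Qed.

Lemma Hgamma_neq0 z : Hgamma g z -> z.2 != 0.
Proof. by move=> [h _]; rewrite -cabs_gt0 (le_lt_trans _ h)// powR_ge0. Qed.

Lemma holo_c2cont z : Hgamma g z -> c2cont F z.
Proof. by move=> /HF[]. Qed.

Lemma holo_cdiff1 z1 z2 : Hgamma g (z1, z2) -> cdifferentiable_at (fun t => F (t, z2)) z1.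
Proof. by move=> /HF[_ []]. Qed.

Lemma holo_cdiff2 z1 z2 : Hgamma g (z1, z2) -> cdifferentiable_at (fun t => F (z1, t)) z2.
Proof. by move=> /HF[_ []]. Qed.

Lemma ccont_exprz (b : int) (z : R[i]) : z != 0 -> ccont (fun t => t ^ b) z.
Proof. by move=> z0; apply/cdiff_ccont/cdiffXz => //; exact: cdiff_id. Qed.

Lemma laurent_term_c2cont a b z : Hgamma g z -> z.1 != 0 -> c2cont (laurent_term a b) z.
Proof.
move=> Hz z10; apply: c2contM.
  apply: c2contM; first exact: holo_c2cont.
  by apply: (c2cont_fst (f := fun t => t ^ (- a))); exact: ccont_exprz.
apply: (c2cont_snd (f := fun t => t ^ (- b))); apply: ccont_exprz.
exact: Hgamma_neq0.
Qed.

Lemma in_base_c2cont a b r1 r2 z : in_base r1 r2 -> on_torus r1 r2 z ->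
  c2cont (laurent_term a b) z.
Proof.
move=> Hr zt; apply: laurent_term_c2cont; first exact: in_base_Hgamma zt.
by case: Hr => r1p _ _; case: zt => e1 _; rewrite -cabs_gt0 e1.
Qed.

(** (2 pi)^2 times the Laurent coefficient of z1^a z2^b. *)
Definition coef2 r1 r2 a b := torus r1 r2 (laurent_term a b).

Lemma coef2E r1 r2 a b : in_base r1 r2 -> coef2 r1 r2 a b =
  circ r2 (fun z2 => circ r1 (fun z1 => laurent_term a b (z1, z2))).
Proof.
move=> Hr; have r2p := in_base_pos Hr; case: (Hr) => r1p _ _.
have H z (zt : on_torus r1 r2 z) : c2cont (laurent_term a b) z.
  exact (in_base_c2cont a b Hr zt).
have [h _ _ _] := torusE (ltW r1p) (ltW r2p) H.
exact h.
Qed.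

Lemma coef2_r1 r1 r1' r2 a b : r1 <= r1' -> in_base r1 r2 -> in_base r1' r2 ->
  coef2 r1 r2 a b = coef2 r1' r2 a b.
Proof.
move=> rr Hr Hr'; rewrite (coef2E a b Hr) (coef2E a b Hr'); case: (Hr) => r1p _ _.
apply: eq_circ => [|z2 z2r]; first exact: ltW (in_base_pos Hr).
apply: circ_eq => // z1 /andP[h1 h2]; rewrite /laurent_term /=.
have z10 : z1 != 0 by rewrite -cabs_gt0 (lt_le_trans r1p).
apply: cdiffM; last exact: cdiff_cst.
apply: cdiffM; last by apply: cdiffXz => //; exact: cdiff_id.
apply: holo_cdiff1; case: Hr' => r1p' h3 h4; split => /=; rewrite z2r//.
by rewrite (le_lt_trans _ h3)// ge0_ler_powR ?nnegrE ?cabs_ge0// ltW.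
Qed.

Lemma coef2_r2 r1 r2 r2' a b : r2 <= r2' -> in_base r1 r2 -> in_base r1 r2' ->
  coef2 r1 r2 a b = coef2 r1 r2' a b.
Proof.
move=> rr Hr Hr'; case: (Hr) => r1p h3 _; case: (Hr') => _ _ h4.
have r2p := in_base_pos Hr.
apply: eq_circ => [|z1 z1r]; first exact: ltW.
apply: circ_eq => // z2 /andP[h1 h2]; rewrite /laurent_term /=.
have z20 : z2 != 0 by rewrite -cabs_gt0 (lt_le_trans r2p).
apply: cdiffM; last by apply: cdiffXz => //; exact: cdiff_id.
apply: cdiffM; last exact: cdiff_cst.
apply: holo_cdiff2; split => /=; rewrite ?z1r; first exact: lt_le_trans h3 h1.
exact: le_lt_trans h2 h4.
Qed.

(** Cauchy's theorem moves one radius at a time. With r1 <= r1' the corner (r1, r2') stays in the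
    base, since decreasing the first radius preserves the inequality. *)
Lemma coef2_const r1 r2 r1' r2' a b : in_base r1 r2 -> in_base r1' r2' ->
  coef2 r1 r2 a b = coef2 r1' r2' a b.
Proof.
wlog r12 : r1 r2 r1' r2' / r1 <= r1'.
  move=> H Hr Hr'; have [r|r] := leP r1 r1'; first exact: H.
  by apply/esym/H => //; exact: ltW.
move=> Hr Hr'; have [r1p h1 h2] := Hr; have [r1p' h1' h2'] := Hr'.
have Hm : in_base r1 r2'.
  split=> //; rewrite (le_lt_trans _ h1')// ge0_ler_powR ?nnegrE// ltW//.
rewrite -(coef2_r1 a b r12 Hm Hr').
by have [r|/ltW r] := leP r2 r2'; [exact: coef2_r2|apply/esym/coef2_r2].
Qed.

(** On the domain, the squared modulus of the monomial; the real power in the second factor is the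
    form that [integral_monomial] expects. *)
Definition weight (a : nat) (b : int) (x : R4) : R := sq x.1 ^+ a * sq x.2 `^ b%:~R.

Definition pairing (a : nat) (b : int) (z : C2 R) : R[i] := (monomial a b z)^*%C * F z.

(** The conjugate of u^n is |u|^(2n) u^(-n). Hence pairing with a monomial is a rotation-invariant
    weight times the integrand of a Laurent coefficient. *)
Lemma pairingE a b z : Hgamma g z -> z.1 != 0 ->
  pairing a b z = ((cabs z.1 ^+ 2) ^+ a * (cabs z.2 ^+ 2) ^ b)%:C%C * laurent_term a b z.
Proof.
move=> Hz z10; have z20 := Hgamma_neq0 Hz.
have E (u : R[i]) (n : int) : u != 0 -> (u ^ n)^*%C = ((cabs u ^+ 2) ^ n)%:C%C * u ^ (- n).
  move=> u0; have -> : ((cabs u ^+ 2) ^ n)%:C%C = (((cabs u ^+ 2)%:C)%C) ^ n.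
    by rewrite -!/(real_complex R _) rmorphXz// unitfE expf_neq0// cabs_eq0.
  rewrite -mul_conj expfzMl mulrAC -expfzDr// subrr expr0z mul1r.
  by rewrite -!/(conjc _) rmorphXz ?unitfE.
rewrite /pairing /monomial rmorphM /= E// (E z.1 a%:Z z10) /laurent_term.
by rewrite rmorphM /=; ring.
Qed.
End Coefficients.

(** * Inner products with monomials as Laurent coefficients *)

Section Pairing.
Variable R : realType.
Notation mR := (measurableTypeR R).
Notation plane := (@plane R).
Notation plane2 := (@plane2 R).
Notation square := (@square R).
Notation R4 := ((mR * mR) * (mR * mR))%type.
Variables (g : R) (F : C2 R -> R[i]).
Hypothesis g0 : 0 < g.
Hypothesis HF : holomorphic_on (Hgamma g) F.

Lemma cz_rot (s : R) (p : mR * mR) : cz (rotation s p) = cz p * cis s.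
Proof. by apply: complex_eq; rewrite ?CReM ?CImM. Qed.

Lemma sq_rot (s : R) (p : mR * mR) : sq (rotation s p) = sq p.
Proof. by rewrite -!sqr_cabs_cz cz_rot cabsM cabs_cis mulr1. Qed.

Definition rot2 (q : (mR * mR) * R4) : R4 := (rotation q.1.1 q.2.1, rotation q.1.2 q.2.2).

Lemma measurable_rot2 : measurable_fun setT rot2.
Proof.
have f1 := @measurable_fst _ _ (mR * mR)%type R4.
have f2 := @measurable_snd _ _ (mR * mR)%type R4.
have h1 := @measurable_fst _ _ (mR * mR)%type (mR * mR)%type.
have h2 := @measurable_snd _ _ (mR * mR)%type (mR * mR)%type.
have n1 := @measurable_fst _ _ mR mR.
have n2 := @measurable_snd _ _ mR mR.
have mc := @measurable_cos R. have ms := @measurable_sin R.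
have s1 := measurableT_comp n1 f1. have s2 := measurableT_comp n2 f1.
have x1 := measurableT_comp h1 f2. have x2 := measurableT_comp h2 f2.
have c1 := measurableT_comp mc s1. have d1 := measurableT_comp ms s1.
have c2 := measurableT_comp mc s2. have d2 := measurableT_comp ms s2.
have u1 := measurableT_comp n1 x1. have v1 := measurableT_comp n2 x1.
have u2 := measurableT_comp n1 x2. have v2 := measurableT_comp n2 x2.
by apply: measurable_fun_pair; apply: measurable_fun_pair;
  [apply: measurable_funB|apply: measurable_funD|apply: measurable_funB|apply: measurable_funD];
  exact: measurable_funM.
Qed.

Lemma Hset_rot2 e q : Hset g e (rot2 q) <-> Hset g e q.2.
Proof.
by case: q => t x; rewrite /Hset /Hgamma /= !cz_rot !cabsM !cabs_cis !mulr1 !sq_rot.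
Qed.

Lemma Hset_in_base e (x : R4) : Hset g e x -> in_base g (cabs (cz x.1)) (cabs (cz x.2)).
Proof.
move=> [[h1 h2] [h3 _]]; split=> //.
by move: h3; rewrite -sqr_cabs_cz exprn_even_gt0//= => h; rewrite lt_neqAle eq_sym h cabs_ge0.
Qed.

Lemma c2cont_rot K (p q : R) (z : C2 R) : c2cont K (z.1 * cis p, z.2 * cis q) ->
  c2cont (fun z => K (z.1 * cis p, z.2 * cis q)) z.
Proof.
move=> HK e /HK[d [d0 Hd]]; exists d; split=> // w w1 w2; apply: Hd => /=.
  by rewrite -mulrBl cabsM cabs_cis mulr1.
by rewrite -mulrBl cabsM cabs_cis mulr1.
Qed.

(** Lets each statement on real integrals be proved once for both components. *)
Definition part (phi : R[i] -> R) := phi = @complex.Re R \/ phi = @complex.Im R.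

Lemma partM phi (k : R) z : part phi -> phi ((k%:C)%C * z) = k * phi z.
Proof. by case=> ->; rewrite ?CReM ?CImM /= mul0r ?subr0 ?addr0. Qed.

Lemma part_le_cabs phi z : part phi -> `|phi z| <= cabs z.
Proof. by case=> ->; [exact: Re_le_cabs|exact: Im_le_cabs]. Qed.

Lemma part_torus phi K r1 r2 (k : R) : part phi -> 0 <= r1 -> 0 <= r2 ->
  (forall z, on_torus r1 r2 z -> c2cont K z) ->
  (\int[plane]_(x in square) (k * phi (K (torus_pt r1 r2 x)))%:E = (k * phi (torus r1 r2 K))%:E)%E.
Proof.
move=> hp r10 r20 HK; have [m1 m2] := measurable_torus_pt r10 r20 HK.
have [M HM] := torus_bounded r10 r20 HK.
have [_ e1 e2 _] := torusE r10 r20 HK.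
have mphi : measurable_fun setT (fun x => phi (K (torus_pt r1 r2 x))) by case: hp => ->.
have fi : plane.-integrable square (EFin \o (fun x => phi (K (torus_pt r1 r2 x)))).
  apply: measurable_bounded_integrable; first exact: measurable_square.
  - have lt : (plane square < +oo)%E by rewrite plane_square ltry.
    exact: lt.
  - exact: measurable_funTS.
  - exists M; split; first exact: num_real.
    move=> y My x _; apply: le_trans (ltW My); apply: le_trans (part_le_cabs _ hp) _.
    by apply: HM; exact: on_torus_pt.
under eq_integral do rewrite EFinM.
rewrite (integralZl (@measurable_square R) fi) EFinM; congr (_ * _)%E.
by case: hp => ->; [exact: e1|exact: e2].
Qed.

Variables (a : nat) (b : int) (c0 : R[i]).
Hypothesis coef2c : forall r1 r2, in_base g r1 r2 -> coef2 F r1 r2 a b = c0.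

Lemma ge0_weight (x : R4) : 0 <= weight a b x.
Proof. by rewrite mulr_ge0 ?exprn_ge0 ?sq_ge0 ?powR_ge0. Qed.

Lemma measurable_weight : measurable_fun [set: R4] (weight a b).
Proof.
apply: measurable_funM.
  by apply: measurable_funX; exact: measurable_sq1.
exact: (measurableT_comp (measurable_powR b%:~R) (@measurable_sq2 R)).
Qed.

Lemma weightE e (x : R4) : Hset g e x ->
  weight a b x = (cabs (cz x.1) ^+ 2) ^+ a * (cabs (cz x.2) ^+ 2) ^ b.
Proof. by move=> _; rewrite /weight powR_intmul ?sq_ge0// !sqr_cabs_cz. Qed.

(** Rotating x by all pairs of angles sweeps out its torus, on which the weight is constant and the
    other factor integrates to the coefficient. *)
Lemma pairing_average phi e (x : R4) : part phi -> Hset g e x ->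
  (\int[plane]_(t in square) (phi (pairing F a b (czz (rot2 (t, x)))))%:E =
   (weight a b x * phi c0)%:E)%E.
Proof.
move=> hp Hx; have Hb := Hset_in_base Hx; have [r1p _ _] := Hb.
have r2p := in_base_pos Hb.
(* The sweep starts at the angles of x instead of 0; [torus_rot] absorbs this offset. *)
have [p p0 z1E] := polar_exists (cz x.1); have [q q0 z2E] := polar_exists (cz x.2).
set r1 := cabs (cz x.1) in Hb r1p z1E *; set r2 := cabs (cz x.2) in Hb r2p z2E *.
pose L := laurent_term F a b.
have HL z : on_torus r1 r2 z -> c2cont L z by move=> zt; exact: (in_base_c2cont HF a b Hb zt).
pose K (z : C2 R) := L (z.1 * cis p, z.2 * cis q).
have HK z : on_torus r1 r2 z -> c2cont K z.
  by move=> [z1 z2]; apply: c2cont_rot; apply: HL; split; rewrite /= cabsM cabs_cis mulr1.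
have -> : c0 = torus r1 r2 K.
  by rewrite -(coef2c Hb) /coef2; apply: esym; apply: torus_rot => //; exact: ltW.
rewrite -(part_torus (weight a b x) hp (ltW r1p) (ltW r2p) HK).
apply: eq_integral => t _.
have cE : czz (rot2 (t, x)) = ((torus_pt r1 r2 t).1 * cis p, (torus_pt r1 r2 t).2 * cis q).
  by rewrite /czz /rot2 /= !cz_rot z1E z2E; congr pair; rewrite mulrAC.
have Ht : on_torus r1 r2 (czz (rot2 (t, x))).
  by split; rewrite /= cz_rot cabsM cabs_cis mulr1.
rewrite (pairingE F a b (in_base_Hgamma Hb Ht)); last first.
  by case: Ht => h _; rewrite -cabs_gt0 h.
have [h1 h2] := Ht; rewrite (partM _ _ hp) h1 h2 -(weightE Hx).
have -> : K (torus_pt r1 r2 t) = laurent_term F a b (czz (rot2 (t, x))) by rewrite /K -cE.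
reflexivity.
Qed.

(** Averaging over rotations preserves [Hset] and the integral, so the inner product with a monomial
    is, up to (2 pi)^2, the squared norm [i] times the coefficient. *)
Lemma pairing_integral phi e (i : R) : part phi -> 0 <= e ->
  plane2.-integrable (Hset g e) (fun x => (phi (pairing F a b (czz x)))%:E) ->
  (\int[plane2]_(x in Hset g e) (weight a b x)%:E = i%:E)%E ->
  (i * phi c0)%:E =
    (((pi *+ 2) ^+ 2)%:E * \int[plane2]_(x in Hset g e) (phi (pairing F a b (czz x)))%:E)%E.
Proof.
move=> hp e0 fi wi; have mH := measurable_Hset g0 e0.
pose f (x : R4) := phi (pairing F a b (czz x)).
pose h (x : R4) := weight a b x * phi c0.
have fiT : plane2.-integrable setT (EFin \o (f \_ (Hset g e))).
  rewrite -restrict_EFin.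
  by have := (integrable_restrict plane2 mH measurableT (EFin \o f)).1; rewrite setTI; apply.
have avg (x : R4) : (\int[plane]_(t in square) ((f \_ (Hset g e)) (rot2 (t, x)))%:E = ((h \_ (Hset g e)) x)%:E)%E.
  rewrite [in RHS]patchE; case: ifPn => [|/negP] xH; rewrite inE in xH.
    rewrite -(pairing_average hp xH); apply: eq_integral => t _.
    by rewrite patchE ifT// inE; apply/Hset_rot2.
  apply: integral0_eq => t _; rewrite patchE ifF//; apply/negP; rewrite inE => /Hset_rot2.
  exact: xH.
have := averaging (@measurable_square R) (@plane_square R) measurable_rot2
  (fun t => preserving_rot2 t.1 t.2) fiT avg.
rewrite -/f.
have -> : (\int[plane2]_x ((f \_ (Hset g e)) x)%:E = \int[plane2]_(x in Hset g e) (f x)%:E)%E.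
  by rewrite [RHS]integral_mkcond (restrict_EFin f).
move=> <-.
have wint : plane2.-integrable (Hset g e) (fun x => (weight a b x)%:E).
  apply/integrableP; split; first by apply/measurable_EFinP; apply: measurable_funTS; exact: measurable_weight.
  under eq_integral do rewrite gee0_abs ?lee_fin ?ge0_weight//.
  by rewrite wi ltry.
transitivity (\int[plane2]_(x in Hset g e) (h x)%:E)%E.
  rewrite /h; under eq_integral do rewrite EFinM.
  by rewrite (integralZr mH wint) wi.
by rewrite [LHS]integral_mkcond (restrict_EFin h).
Qed.
End Pairing.

(** * Coefficients of monomials of infinite norm vanish *)

Section Vanishing.
Variable R : realType.
Notation leb := (@lebesgue_measure R).
Notation mR := (measurableTypeR R).
Notation plane2 := (@plane2 R).
Notation R4 := ((mR * mR) * (mR * mR))%type.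
Variables (g : R) (F : C2 R -> R[i]) (N : R).
Hypothesis g0 : 0 < g.
Hypothesis HF : holomorphic_on (Hgamma g) F.
Hypothesis HN : (\int[plane2]_(x in Hset g 0) (cabs (F (czz x)) ^+ 2)%:E <= N%:E)%E.
Variables (a : nat) (b : int).

Lemma sqr_cabs_monomial e (x : R4) : Hset g e x -> cabs (monomial a b (czz x)) ^+ 2 = weight a b x.
Proof.
move=> Hx; rewrite (weightE a b Hx) /monomial cabsM cabsX cabsXz /= exprMn.
by congr (_ * _); [rewrite exprAC|rewrite !expr2 expfzMl].
Qed.

Lemma c2cont_pairing z : Hgamma g z -> c2cont (pairing F a b) z.
Proof.
move=> Hz; apply: c2contM; last exact: (holo_c2cont HF).
apply: c2cont_conj; apply: c2contM.
  by apply: (c2cont_fst (f := fun t => t ^+ a)); exact: cdiff_ccont (cdiffX _ (cdiff_id _)).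
by apply: (c2cont_snd (f := fun t => t ^ b)); apply: ccont_exprz; exact: Hgamma_neq0 Hz.
Qed.

Lemma measurable_sqr_cabs e : 0 <= e -> measurable_fun (Hset g e) (fun x => cabs (F (czz x)) ^+ 2).
Proof.
move=> e0; have mH := measurable_Hset g0 e0.
have [m1 m2] := c2cont_measurable (F := F) mH (fun x Hx => holo_c2cont HF Hx.1).
rewrite (_ : (fun x => _) = (fun x => complex.Re (F (czz x)) ^+ 2 + complex.Im (F (czz x)) ^+ 2)).
  by apply: measurable_funD; exact: measurable_funX.
by apply/funext => x; rewrite sqr_cabs.
Qed.

Lemma Hset_sub e : 0 <= e -> Hset g e `<=` Hset g 0.
Proof. by move=> e0 x [h1 [h2 h3]]; split=> //; split=> //; exact: le_lt_trans h3. Qed.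

(** The pointwise inequality x y <= l x^2 + y^2 / l plays the role of Cauchy-Schwarz; the parameter
    l is optimised later. *)
Lemma pairing_bound phi e (l i : R) : part phi -> 0 <= e -> 0 < l ->
  (\int[plane2]_(x in Hset g e) (weight a b x)%:E = i%:E)%E ->
  (\int[plane2]_(x in Hset g e) `|(phi (pairing F a b (czz x)))%:E| <= (l * i + N / l)%:E)%E.
Proof.
move=> hp e0 l0 wi; have mH := measurable_Hset g0 e0.
have mw : measurable_fun (Hset g e) (weight a b) by apply: measurable_funTS; exact: measurable_weight.
have mF := measurable_sqr_cabs e0.
have [m1 m2] := c2cont_measurable (F := pairing F a b) mH (fun x Hx => c2cont_pairing Hx.1).
have mp : measurable_fun (Hset g e) (fun x => phi (pairing F a b (czz x))) by case: hp => ->.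
pose u (x : R4) : \bar R := (l%:E * (weight a b x)%:E + l^-1%:E * (cabs (F (czz x)) ^+ 2)%:E)%E.
have l1 : 0 <= l^-1 by rewrite invr_ge0 ltW.
have pt x : Hset g e x -> (`|(phi (pairing F a b (czz x)))%:E| <= u x)%E.
  move=> Hx; rewrite /u -!EFinM -EFinD lee_fin -(sqr_cabs_monomial Hx).
  apply: le_trans (part_le_cabs _ hp) _; rewrite /pairing cabsM cabs_conj.
  move: (cabs (monomial _ _ _)) (cabs (F _)) (cabs_ge0 (monomial a b (czz x))) (cabs_ge0 (F (czz x))).
  move=> x1 y1 x0 y0; rewrite -(ler_pM2l l0) mulrDr mulrA [l * (l^-1 * _)]mulrA divff ?gt_eqF// mul1r.
  have := sqr_ge0 (l * x1 - y1); have := mulr_ge0 (mulr_ge0 (ltW l0) x0) y0; nra.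
have mlw : measurable_fun (Hset g e) (fun x => (l%:E * (weight a b x)%:E)%E).
  by apply: measurable_funeM; exact/measurable_EFinP.
have mlF : measurable_fun (Hset g e) (fun x => (l^-1%:E * (cabs (F (czz x)) ^+ 2)%:E)%E).
  by apply: measurable_funeM; exact/measurable_EFinP.
apply: (@le_trans _ _ (\int[plane2]_(x in Hset g e) u x)%E).
  apply: ge0_le_integral => //.
  - by apply: measurableT_comp => //; exact/measurable_EFinP.
  - exact: emeasurable_funD.
rewrite /u ge0_integralD//; last 2 first.
- by move=> x _; rewrite -EFinM lee_fin mulr_ge0 ?ge0_weight// ltW.
- by move=> x _; rewrite -EFinM lee_fin mulr_ge0 ?sqr_ge0.
rewrite ge0_integralZl//; last 3 first.
- exact/measurable_EFinP.
- by move=> x _; rewrite lee_fin ge0_weight.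
- by rewrite lee_fin ltW.
rewrite ge0_integralZl//; last 2 first.
- exact/measurable_EFinP.
- by move=> x _; rewrite lee_fin sqr_ge0.
rewrite wi EFinD EFinM; apply: leeD => //; rewrite [(N / l)]mulrC EFinM.
apply: lee_wpmul2l; first by rewrite lee_fin.
apply: le_trans HN; apply: ge0_subset_integral => //.
- exact: measurable_Hset.
- by apply/measurable_EFinP; exact: measurable_sqr_cabs.
- by move=> x _; rewrite lee_fin sqr_ge0.
- exact: Hset_sub.
Qed.

Lemma pairing_integrable phi e (i : R) : part phi -> 0 <= e ->
  (\int[plane2]_(x in Hset g e) (weight a b x)%:E = i%:E)%E ->
  plane2.-integrable (Hset g e) (fun x => (phi (pairing F a b (czz x)))%:E).
Proof.
move=> hp e0 wi; have mH := measurable_Hset g0 e0.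
have [m1 m2] := c2cont_measurable (F := pairing F a b) mH (fun x Hx => c2cont_pairing Hx.1).
apply/integrableP; split; first by apply/measurable_EFinP; case: hp => ->.
exact: le_lt_trans (pairing_bound hp e0 ltr01 wi) (ltry _).
Qed.

Variable c0 : R[i].
Hypothesis coef2c : forall r1 r2, in_base g r1 r2 -> coef2 F r1 r2 a b = c0.

Lemma coef2_bound phi e (l i : R) : part phi -> 0 <= e -> 0 < l ->
  (\int[plane2]_(x in Hset g e) (weight a b x)%:E = i%:E)%E ->
  `|i * phi c0| <= (pi *+ 2) ^+ 2 * (l * i + N / l).
Proof.
move=> hp e0 l0 wi; have mH := measurable_Hset g0 e0.
have fi := pairing_integrable hp e0 wi.
have E := pairing_integral g0 HF coef2c hp e0 fi wi.
have P0 : (0 <= ((pi *+ 2) ^+ 2 : R)%:E)%E by rewrite lee_fin sqr_ge0.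
rewrite -lee_fin EFinM (_ : `|i * phi c0|%:E = `|(i * phi c0)%:E|%E)// E abseM gee0_abs//.
apply: lee_wpmul2l => //; apply: le_trans (pairing_bound hp e0 l0 wi).
exact: le_abse_integral (measurable_int _ fi).
Qed.

(* By coef2_bound, |c0| I(e) is at most a constant times l I(e) + N / l for every l > 0, where
   I(e), the squared norm of the monomial on |z2|^2 > e, tends to infinity as e -> 0. *)
Lemma coef2_vanish : b%:~R + a.+1%:R / g <= -1 -> c0 = 0.
Proof.
move=> hab; pose p := b%:~R + a.+1%:R / g; pose A := disc_area R ^+ 2 / a.+1%:R.
have A0 : 0 < A by rewrite divr_gt0// exprn_gt0// disc_area_gt0.
have H e : 0 < e -> e < 1 -> exists2 i : R, A * (- ln e) <= i &
    (\int[plane2]_(x in Hset g e) (weight a b x)%:E = i%:E)%E.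
  move=> e0 e1; have e0' := ltW e0.
  have E := integral_monomial a b%:~R g0 e0'; rewrite -/p -/A in E.
  have lb := integral_powR_ge e0 e1 hab.
  pose J : set mR := `[e, 1]%classic.
  have oc : (\int[leb]_(v in `]e, 1%R[) (v `^ p)%:E = \int[leb]_(v in `[e, 1%R]) (v `^ p)%:E)%E.
    apply/esym; apply: (@integral_itv_bndoo _ e 1 _ true false).
    by apply/measurable_EFinP; apply: measurable_funTS; exact: measurable_powR.
  have fi : leb.-integrable `[e, 1] (fun v => (v `^ p)%:E).
    apply: integrable_segment_pt => v /andP[ev _]; apply: continuous_powR_pos.
    exact: lt_le_trans ev.
  have mJ : measurable J by exact: measurable_itv.
  have fn := integrable_fin_num mJ fi.
  exists (A * fine (\int[leb]_(v in `[e, 1%R]) (v `^ p)%:E)%E).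
    by rewrite ler_pM2l// -lee_fin fineK.
  by rewrite EFinM fineK// -oc; exact: E.
suff part0 phi : part phi -> phi c0 = 0.
  by apply: complex_eq; apply: part0; [left|right].
move=> hp; apply/eqP; apply: contraT => c00.
have t0 : 0 < `|phi c0| by rewrite normr_gt0.
set t := `|phi c0| in t0; pose P : R := (pi *+ 2) ^+ 2.
have P0 : 0 < P by rewrite exprn_gt0// pmulrn_lgt0 ?pi_gt0.
have l0 : 0 < t / (2 * P) by rewrite divr_gt0// mulr_gt0.
(* With l = t / (2 P), half of t i is absorbed in i t <= P (l i + N / l), and what is left says i <=
   M. The cutoff e is then chosen so small that i is at least M + 1. *)
pose M := 4 * P ^+ 2 * N / t ^+ 2.
have N0 : 0 <= N.
  rewrite -lee_fin; apply: le_trans HN; apply: integral_ge0 => x _.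
  by rewrite lee_fin sqr_ge0.
have M0 : 0 <= M by rewrite divr_ge0 ?sqr_ge0// mulr_ge0// mulr_ge0// sqr_ge0.
pose e := expR (- ((M + 1) / A)).
have e0 : 0 < e by exact: expR_gt0.
have e1 : e < 1 by rewrite expR_lt1 oppr_lt0 divr_gt0// ltr_wpDl.
have [i ie wi] := H e e0 e1.
have iM : M + 1 <= i by move: ie; rewrite /e expRK opprK mulrC divfK// gt_eqF.
have := coef2_bound hp (ltW e0) l0 wi.
have i0 : 0 < i by rewrite (lt_le_trans _ iM)// ltr_wpDl.
rewrite normrM (gtr0_norm i0) -/t -/P => h.
have : P * (t / (2 * P) * i + N / (t / (2 * P))) = t * i / 2 + t / 2 * M.
  by rewrite /M; field; rewrite !gt_eqF.
move=> hE; rewrite hE in h; exfalso; clear -h iM t0.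
nra.
Qed.
End Vanishing.

(** * Laurent coefficients of the Bergman kernel *)

Section Transfer.
Variable R : realType.
Notation mR := (measurableTypeR R).
Notation plane := (@plane R).
Notation plane2 := (@plane2 R).
Notation R4 := ((mR * mR) * (mR * mR))%type.
Notation R4' := (mR * (mR * (mR * mR)))%type.
Variable g : R.

Definition unassoc4 (p : R4') : R4 := ((p.1, p.2.1), p.2.2).

Lemma measurable_unassoc4 : measurable_fun setT unassoc4.
Proof.
have f1 := @measurable_fst _ _ mR (mR * (mR * mR))%type.
have f2 := @measurable_snd _ _ mR (mR * (mR * mR))%type.
have n1 := @measurable_fst _ _ mR (mR * mR)%type.
have n2 := @measurable_snd _ _ mR (mR * mR)%type.
apply: measurable_fun_pair; last exact: (measurableT_comp n2 f2).
by apply: measurable_fun_pair => //; exact: (measurableT_comp n1 f2).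
Qed.

Definition Hplane : set R4 := [set x | Hgamma g (czz x)].

Lemma cabs_cz (p : mR * mR) : cabs (cz p) = sq p `^ 2^-1.
Proof. by rewrite powR12_sqrt// sq_ge0. Qed.

Lemma measurable_Hplane : measurable Hplane.
Proof.
have m1 := @measurable_sq1 R; have m2 := @measurable_sq2 R.
have -> : Hplane = [set x : R4 | (sq x.1 `^ 2^-1) `^ g < sq x.2 `^ 2^-1] `&`
    [set x : R4 | sq x.2 `^ 2^-1 < 1].
  by apply/seteqP; split => x; rewrite /Hplane /Hgamma /= !cabs_cz.
have k2 : measurable_fun setT (fun x : R4 => sq x.2 `^ 2^-1 : R).
  exact: (measurableT_comp (measurable_powR 2^-1) m2).
apply: measurableI; apply: measurable_lt_fun => //.
have k1 : measurable_fun setT (fun x : R4 => sq x.1 `^ 2^-1 : R).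
  exact: (measurableT_comp (measurable_powR 2^-1) m1).
exact: (measurableT_comp (measurable_powR g) k1).
Qed.

Local Open Scope ereal_scope.

Lemma plane2_slice : plane2 (disc 0%R `*` setT) = 0.
Proof.
have mD := @measurable_disc R 0%R.
have d0 : plane (disc (0%R : R)) = 0 by rewrite plane_disc// mul0r.
have h : plane2 (disc 0%R `*` setT) = plane (disc (0%R : R)) * plane setT.
  exact: product_measure1E mD measurableT.
by rewrite h d0 mul0e.
Qed.

Lemma Hplane_Hset : Hplane `\` (disc 0%R `*` setT) = Hset g 0.
Proof.
apply/seteqP; split => x.
  move=> [Hx Nx]; split=> //; split.
    by rewrite ltNge; apply/negP => h; apply: Nx; split.
  by rewrite -sqr_cabs_cz exprn_gt0// cabs_gt0; exact: Hgamma_neq0 Hx.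
move=> [Hx [h1 h2]]; split => // -[/=]; rewrite /disc /= leNgt h1.
by [].
Qed.

(** [vol4] is the push-forward of [plane2] under regrouping, and the part of the domain with z1 = 0
    is a null set. *)
Lemma ge0_transfer (u : R4 -> \bar R) : measurable_fun Hplane u -> (forall x, Hplane x -> 0 <= u x) ->
  \int[vol4 R]_(p in @toC2 R @^-1` Hgamma g) u (unassoc4 p) = \int[plane2]_(x in Hset g 0) u x.
Proof.
move=> mu u0; have mH := measurable_Hplane.
have mA := @measurable_assoc4 R; have mU := measurable_unassoc4.
pose D : set R4' := unassoc4 @^-1` Hplane.
have mD : measurable D by exact: preimage_measurable.
have mv : measurable_fun D (u \o unassoc4).
  apply: (@measurable_comp _ _ _ _ _ _ Hplane u D unassoc4) => //.
    by move=> _ [x Dx <-].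
  exact: measurable_funTS.
pose nu := pushforward plane2 (@assoc4 R) : {measure set R4' -> \bar R}.
have e1 : \int[vol4 R]_(p in D) u (unassoc4 p) = \int[nu mA]_(p in D) u (unassoc4 p).
  by apply: eq_measure_integral => A mA' _; exact: vol4_assoc mA'.
apply: etrans e1 _.
have v0 : {in D, forall y, 0 <= (u \o unassoc4) y} by move=> y; rewrite inE => /u0.
apply: etrans (ge0_integral_pushforward mA plane2 mD mv v0) _.
have -> : @assoc4 R @^-1` D = Hplane by apply/seteqP; split => -[[x y] [z t]].
rewrite -Hplane_Hset.
have mN : measurable (disc (0%R : R) `*` [set: (mR * mR)%type]) by apply: measurableX => //; exact: measurable_disc.
rewrite -(ge0_negligible_integral mN mH mu u0 plane2_slice).
by apply: eq_integral => -[[x y] [z t]].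
Qed.

(** Positive and negative parts are transferred separately, so the identity holds for merely
    measurable u. *)
Lemma transfer (u : R4 -> R) : measurable_fun Hplane u ->
  \int[vol4 R]_(p in @toC2 R @^-1` Hgamma g) (u (unassoc4 p))%:E = \int[plane2]_(x in Hset g 0) (u x)%:E.
Proof.
move=> mu; rewrite integralE [RHS]integralE.
have mE : measurable_fun Hplane (EFin \o u) by exact/measurable_EFinP.
have mp := measurable_funepos mE; have mn := measurable_funeneg mE.
congr (_ - _).
- apply: etrans (etrans (ge0_transfer mp (fun x _ => funepos_ge0 _ x)) _).
    by apply: eq_integral => p _; rewrite !funeposE.
  by apply: eq_integral => p _; rewrite !funeposE.
- apply: etrans (etrans (ge0_transfer mn (fun x _ => funeneg_ge0 _ x)) _).
    by apply: eq_integral => p _; rewrite !funenegE.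
  by apply: eq_integral => p _; rewrite !funenegE.
Qed.

Lemma c2cont_Hplane (G : C2 R -> R[i]) : (forall z, Hgamma g z -> c2cont G z) ->
  measurable_fun Hplane (fun x => complex.Re (G (czz x))) /\
  measurable_fun Hplane (fun x => complex.Im (G (czz x))).
Proof. by move=> HG; apply: c2cont_measurable => [|x]; [exact: measurable_Hplane|exact: HG]. Qed.

Lemma inA2E (f : C2 R -> R[i]) : holomorphic_on (Hgamma g) f ->
  \int[vol4 R]_(p in @toC2 R @^-1` Hgamma g) (cabs (f (toC2 p)) ^+ 2)%:E =
  \int[plane2]_(x in Hset g 0) (cabs (f (czz x)) ^+ 2)%:E.
Proof.
move=> hf; have [m1 m2] := c2cont_Hplane (holo_c2cont hf).
apply: (@transfer (fun x => cabs (f (czz x)) ^+ 2)%R).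
rewrite (_ : (fun x => _) = (fun x => complex.Re (f (czz x)) ^+ 2 + complex.Im (f (czz x)) ^+ 2)%R).
  by apply: measurable_funD; exact: measurable_funX.
by apply/funext => x; rewrite sqr_cabs.
Qed.

Lemma inA2_bound (f : C2 R -> R[i]) : inA2 (Hgamma g) f ->
  exists N : R, \int[plane2]_(x in Hset g 0) (cabs (f (czz x)) ^+ 2)%:E <= N%:E.
Proof.
move=> [hf fN]; exists (fine (\int[plane2]_(x in Hset g 0) (cabs (f (czz x)) ^+ 2)%:E)).
rewrite fineK// ge0_fin_numE -?(inA2E hf)//.
by apply: integral_ge0 => x _; rewrite lee_fin sqr_ge0.
Qed.

Lemma cintegralE (G : C2 R -> R[i]) : (forall z, Hgamma g z -> c2cont G z) ->
  cintegral (Hgamma g) G =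
  ((\int[plane2]_(x in Hset g 0) complex.Re (G (czz x)))%R +i*
   (\int[plane2]_(x in Hset g 0) complex.Im (G (czz x)))%R)%C.
Proof.
move=> HG; have [m1 m2] := c2cont_Hplane HG.
by apply: complex_eq; rewrite /= /Rintegral; congr fine; [exact: (transfer m1)|exact: (transfer m2)].
Qed.
End Transfer.

(** * The reproducing identity applied to monomials *)

Section Reproducing.
Variable R : realType.
Notation plane2 := (@plane2 R).
Variables (g : R) (B : C2 R -> C2 R -> R[i]).
Hypothesis g0 : 0 < g.
Hypothesis HB : is_bergman_kernel (Hgamma g) B.

Lemma monomial_holo a b : holomorphic_on (Hgamma g) (@monomial R a b).
Proof.
move=> z Hz; have z20 := Hgamma_neq0 Hz.
have d1 : cdifferentiable_at (fun t => t ^+ a) z.1 by exact: cdiffX _ (cdiff_id _).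
have d2 : cdifferentiable_at (fun t => t ^ b) z.2 by apply: cdiffXz => //; exact: cdiff_id.
split; [|split].
- apply: c2contM; first by apply: (c2cont_fst (f := fun t => t ^+ a)); exact: cdiff_ccont.
  by apply: (c2cont_snd (f := fun t => t ^ b)); exact: cdiff_ccont.
- exact: (cdiffM (f := fun t => t ^+ a) (g := fun=> z.2 ^ b) d1 (cdiff_cst _ _)).
- exact: (cdiffM (f := fun=> z.1 ^+ a) (g := fun t => t ^ b) (cdiff_cst _ _) d2).
Qed.

Variables (a : nat) (b : int).
Hypothesis hab : -1 < b%:~R + a.+1%:R / g.
Let p := b%:~R + a.+1%:R / g.

Lemma weight_integral :
  (\int[plane2]_(x in Hset g 0) (weight a b x)%:E =
   (disc_area R ^+ 2 / (a.+1%:R * (p + 1)))%:E)%E.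
Proof.
have E := integral_monomial a b%:~R g0 (lexx 0).
apply: etrans E _; rewrite integral_powR0// powR1 -EFinM; congr _%:E.
have p1 : 0 < p + 1 by rewrite -ltrBlDr sub0r.
rewrite -/p; field; rewrite ?nat1r ?natr1 pnatr_eq0//= gt_eqF//.
Qed.

Lemma monomial_inA2 : inA2 (Hgamma g) (@monomial R a b).
Proof.
split; first exact: monomial_holo.
rewrite (inA2E (monomial_holo a b)).
rewrite (_ : (\int[plane2]_(x in Hset g 0) _)%E = (\int[plane2]_(x in Hset g 0) (weight a b x)%:E)%E).
  by rewrite weight_integral ltry.
by apply: eq_integral => x; rewrite inE => Hx; rewrite (sqr_cabs_monomial a b Hx).
Qed.

(** The reproducing property for the monomial m says that the inner product of F with m is the
    conjugate of m(w). By [pairing_integral] it is also the squared norm of m times the coefficient,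
    up to (2 pi)^2. *)
Lemma kernel_coef2 w r1 r2 : Hgamma g w -> in_base g r1 r2 ->
  coef2 (B^~ w) r1 r2 a b =
  (((pi *+ 2) ^+ 2 * (a.+1%:R * (p + 1) / disc_area R ^+ 2))%:C)%C * (monomial a b w)^*%C.
Proof.
move=> Hw Hr; have [[HF FN] rep] := HB Hw.
pose F := B^~ w.
have p1 : 0 < p + 1 by rewrite -ltrBlDr sub0r.
have A0 := disc_area_gt0 R.
pose i := disc_area R ^+ 2 / (a.+1%:R * (p + 1)).
have i0 : 0 < i by rewrite divr_gt0 ?exprn_gt0// mulr_gt0.
have [N HN] : exists N : R, (\int[plane2]_(x in Hset g 0) (cabs (F (czz x)) ^+ 2)%:E <= N%:E)%E.
  exact: inA2_bound.
have cc r1' r2' : in_base g r1' r2' -> coef2 F r1' r2' a b = coef2 F r1 r2 a b.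
  by move=> Hr'; exact: (coef2_const g0 HF a b Hr' Hr).
have M := rep _ monomial_inA2.
have Hc z : Hgamma g z -> c2cont (fun z => monomial a b z * (F z)^*%C) z.
  move=> Hz; apply: c2contM; first exact: (holo_c2cont (monomial_holo a b) Hz).
  by apply: c2cont_conj; exact: (holo_c2cont HF Hz).
have M' := etrans M (cintegralE Hc).
have PE z : monomial a b z * (F z)^*%C = (pairing F a b z)^*%C.
  by rewrite /pairing rmorphM /= conjcK.
have part0 phi : part phi -> i * phi (coef2 F r1 r2 a b) =
    (pi *+ 2) ^+ 2 * \int[plane2]_(x in Hset g 0) phi (pairing F a b (czz x)).
  move=> hp; have fi := pairing_integrable g0 HF HN hp (lexx 0) weight_integral.
  have mH := measurable_Hset g0 (lexx 0).
  have E := pairing_integral g0 HF cc hp (lexx 0) fi weight_integral.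
  rewrite -(fineK (integrable_fin_num mH fi)) -EFinM in E.
  exact: (EFin_inj E).
have mRe : complex.Re (monomial a b w) =
    \int[plane2]_(x in Hset g 0) complex.Re (pairing F a b (czz x)).
  rewrite M' /=; apply: eq_Rintegral => x _; rewrite PE.
  by case: (pairing F a b (czz x)).
(* The reproducing integrand is the conjugate of [pairing], hence the sign. *)
have mIm : complex.Im (monomial a b w) =
    - \int[plane2]_(x in Hset g 0) complex.Im (pairing F a b (czz x)).
  rewrite -mulN1r; have hp : part (@complex.Im R) by right.
  have fi := pairing_integrable g0 HF HN hp (lexx 0) weight_integral.
  have <- : \int[plane2]_(x in Hset g 0) (-1 * complex.Im (pairing F a b (czz x))) =
      -1 * \int[plane2]_(x in Hset g 0) complex.Im (pairing F a b (czz x)).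
    by apply: RintegralZl; [exact: measurable_Hset g0 (lexx 0)|exact: fi].
  rewrite M' /=.
  apply: eq_Rintegral => x _; rewrite PE mulN1r.
  by case: (pairing F a b (czz x)).
have hRe := part0 (@complex.Re R) (or_introl erefl).
have hIm := part0 (@complex.Im R) (or_intror erefl).
rewrite -mRe in hRe; rewrite -[X in _ = _ * X]opprK -mIm in hIm.
have kE : (pi *+ 2) ^+ 2 * (a.+1%:R * (p + 1) / disc_area R ^+ 2) = (pi *+ 2) ^+ 2 / i.
  by rewrite /i invf_div.
rewrite kE; move: hRe hIm; rewrite -/F.
case: (coef2 F r1 r2 a b) => x y; case: (monomial a b w) => x' y' /= hx hy.
apply: complex_eq; rewrite ?CReM ?CImM /= mul0r ?subr0 ?addr0.
  by apply: (mulfI (lt0r_neq0 i0)); rewrite hx mulrA [i * _]mulrC divfK ?gt_eqF.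
by apply: (mulfI (lt0r_neq0 i0)); rewrite hy mulrA [i * _]mulrC divfK ?gt_eqF.
Qed.
End Reproducing.

(** * Iterated Laurent expansion *)

Section Limits.
Variable R : realType.
Implicit Types (u : nat -> R[i]) (l : R[i]) (q : R).

Definition ctends u l := forall e : R, 0 < e ->
  exists N : nat, forall n, (N <= n)%N -> cabs (u n - l) < e.

Lemma ctends_unique u l l' : ctends u l -> ctends u l' -> l = l'.
Proof.
move=> h h'; apply/eqP; rewrite -subr_eq0; apply: contraT => d0.
have e0 : 0 < cabs (l - l') / 2 by rewrite divr_gt0// cabs_gt0.
have [N HN] := h _ e0; have [N' HN'] := h' _ e0.
have h1 := HN (maxn N N') (leq_maxl _ _); have h2 := HN' (maxn N N') (leq_maxr _ _).
have : cabs (l - l') < cabs (l - l').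
  rewrite {2}(splitr (cabs (l - l'))); apply: le_lt_trans (ltrD h2 h1).
  rewrite (_ : l - l' = (u (maxn N N') - l') - (u (maxn N N') - l)); last by ring.
  exact: le_cabsB.
by rewrite ltxx.
Qed.

Lemma nexp_bound q n : 0 <= q -> q < 1 -> n.+1%:R * q ^+ n * (1 - q) <= 1.
Proof.
move=> q0 q1.
(* This compares (n + 1) q^n with the geometric sum 1 + q + ... + q^n, and unlike the weaker claim
   it passes through the induction. *)
suff : n.+1%:R * q ^+ n * (1 - q) + q ^+ n.+1 <= 1.
  by apply: le_trans; rewrite lerDl exprn_ge0.
elim: n => [|n IH]; first by rewrite expr0 expr1 !mul1r subrK.
apply: le_trans IH; rewrite -subr_ge0.
rewrite (_ : _ - _ = q ^+ n * n.+1%:R * (1 - q) ^+ 2).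
  apply: mulr_ge0 (sqr_ge0 _); apply: mulr_ge0 => //; exact: exprn_ge0.
by rewrite -[n.+2%:R]natr1 !exprS; ring.
Qed.

Lemma nexp_small q C e : 0 <= q -> q < 1 -> 0 < e ->
  exists N : nat, forall n, (N <= n)%N -> C * n.+1%:R * q ^+ n < e.
Proof.
(* Since q^n = r^n r^n, one factor absorbs n + 1 by [nexp_bound] and the other tends to 0. *)
move=> q0 q1 e0; pose r := Num.sqrt q.
have r0 : 0 <= r := sqrtr_ge0 q.
have r1 : r < 1 by rewrite -[X in _ < X]sqrtr1 ltr_sqrt.
have r1' : 0 < 1 - r by rewrite subr_gt0.
have qr : q = r * r by rewrite -expr2 sqr_sqrtr.
pose d := e * (1 - r) / (`|C| + 1).
have C1 : 0 < `|C| + 1 by rewrite ltr_wpDl.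
have d0 : 0 < d by rewrite divr_gt0// mulr_gt0.
have rn : `|r| < 1 by rewrite ger0_norm.
have /(@cvgrPdist_lt _ R^o)/(_ d d0)[N _ HN] := cvg_expr rn.
exists N => n /HN /=; rewrite sub0r normrN ger0_norm ?exprn_ge0// => h.
have h1 := nexp_bound n r0 r1.
rewrite qr exprMn.
have h2 : C * n.+1%:R * (r ^+ n * r ^+ n) * (1 - r) <= (`|C| + 1) * r ^+ n.
  rewrite (_ : _ * (1 - r) = C * r ^+ n * (n.+1%:R * r ^+ n * (1 - r))); last by ring.
  apply: (@le_trans _ _ ((`|C| + 1) * r ^+ n * (n.+1%:R * r ^+ n * (1 - r)))).
    apply: ler_wpM2r; first by rewrite !mulr_ge0 ?exprn_ge0 ?ler0n// ltW.
    by apply: ler_wpM2r; [rewrite exprn_ge0|rewrite (le_trans (ler_norm C))// lerDl].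
  by rewrite -[X in _ <= X]mulr1 ler_wpM2l// mulr_ge0 ?exprn_ge0// ltW.
rewrite -(ltr_pM2r r1'); apply: le_lt_trans h2 _.
by rewrite mulrC -ltr_pdivlMr.
Qed.

Lemma ctends_bound u l C q m : 0 <= q -> q < 1 ->
  (forall n, (m <= n)%N -> cabs (u n - l) <= C * n.+1%:R * q ^+ n) -> ctends u l.
Proof.
move=> q0 q1 H e e0; have [N HN] := nexp_small C q0 q1 e0.
exists (maxn m N) => n; rewrite geq_max => /andP[mn /HN]; exact: le_lt_trans (H n mn).
Qed.

Lemma ctends_geom u l C x y p q : 0 <= C -> 0 <= x -> x < 1 -> 0 <= y -> y < 1 ->
  0 <= p -> 0 <= q ->
  (forall n, cabs (u n - l) <= C * (x ^+ n.+1 * p + y ^+ n.+1 * q)) -> ctends u l.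
Proof.
move=> C0 x0 x1 y0 y1 p0 q0 H; pose z := Num.max x y.
have xz : x <= z by rewrite le_max lexx.
have yz : y <= z by rewrite le_max lexx orbT.
have z0 : 0 <= z := le_trans x0 xz.
have z1 : z < 1 by rewrite gt_max x1.
apply: (@ctends_bound u l (C * (p + q)) z 0) => // n _; apply: le_trans (H n) _.
rewrite -!mulrA; apply: ler_wpM2l => //; rewrite mulrDl.
have k (t s : R) : 0 <= t -> t <= z -> 0 <= s -> t ^+ n.+1 * s <= s * (n.+1%:R * z ^+ n).
  move=> t0 tz s0; rewrite mulrC; apply: ler_wpM2l => //.
  apply: (@le_trans _ _ (z ^+ n.+1)); first by rewrite lerXn2r ?nnegrE.
  rewrite exprS; apply: ler_wpM2r; first exact: exprn_ge0.
  by rewrite (le_trans (ltW z1))// ler1n.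
by apply: lerD; exact: k.
Qed.

Lemma ctends_annulus u l C r r0 r' : 0 <= C -> 0 < r -> r < r0 -> r0 < r' ->
  (forall n, cabs (u n - l) <=
    C * ((r0 / r') ^+ n.+1 * (r' / (r' - r0)) + (r / r0) ^+ n.+1 * (r / (r0 - r)))) -> ctends u l.
Proof.
move=> C0 rp rr0 r0r'; have r0p := lt_trans rp rr0; have r'p := lt_trans r0p r0r'.
by apply: ctends_geom => //; rewrite ?divr_ge0 ?subr_ge0 ?ltr_pdivrMr ?mul1r// ltW.
Qed.
End Limits.

Section CintB.
Context d (T : measurableType d) (R : realType).
Variables (mu : {measure set T -> \bar R}) (D : set T).
Hypothesis mD : measurable D.
Implicit Types (g h : T -> R[i]).

Lemma CintegrableB g h : Cintegrable mu D g -> Cintegrable mu D h ->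
  Cintegrable mu D (fun x => g x - h x).
Proof.
move=> gi hi; apply: (eq_Cintegrable mD _ (CintegrableD mD gi (CintegrableZ mD (-1) hi))) => x _.
by rewrite mulN1r.
Qed.

Lemma CintB g h : Cintegrable mu D g -> Cintegrable mu D h ->
  Cint mu D (fun x => g x - h x) = Cint mu D g - Cint mu D h.
Proof.
move=> gi hi; rewrite -mulN1r -(CintZ mD (-1) hi) -(CintD mD gi (CintegrableZ mD (-1) hi)).
by apply: eq_Cint => x _; rewrite mulN1r.
Qed.
End CintB.

(** * Expansion in z1 along a slice, then of its coefficients in z2 *)

Section Expansion.
Variable R : realType.
Notation leb := (@lebesgue_measure R).
Notation mR := (measurableTypeR R).
Notation I02 := (`[0, pi *+ 2]%classic : set mR).
Variables (g : R) (F : C2 R -> R[i]).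
Hypothesis g0 : 0 < g.
Hypothesis HF : holomorphic_on (Hgamma g) F.
Variables (c1 c2 r1 r2 r2' : R).
Hypotheses (c10 : 0 < c1) (cr1 : c1 < r1) (rr : r1 `^ g < r2) (rc2 : r2 < c2) (cr2 : c2 < r2')
  (r2'1 : r2' < 1).
(** The coordinates are negative because [laurent] is stated at negative reals. The radii are such
    that the disc |z1| <= r1 times the annulus r2 <= |z2| <= r2' lies in the domain. *)
Let w1 : R[i] := - (c1%:C)%C.
Let w2 : R[i] := - (c2%:C)%C.

Let r10 : 0 < r1 := lt_trans c10 cr1.
Let r20 : 0 < r2 := le_lt_trans (powR_ge0 r1 g) rr.
Let c20 : 0 < c2 := lt_trans r20 rc2.
Let r2'0 : 0 < r2' := lt_trans c20 cr2.
Let base1 : in_base g r1 r2. Proof. by split=> //; rewrite (lt_trans rc2)// (lt_trans cr2). Qed.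
Let base2 : in_base g r1 c2. Proof. by split=> //; [exact: lt_trans rc2|exact: lt_trans r2'1]. Qed.
Let base3 : in_base g r1 r2'. Proof. by split=> //; rewrite (lt_trans rr)// (lt_trans rc2). Qed.
Let cw1 : cabs w1 = c1. Proof. by rewrite cabsN cabs_real gtr0_norm. Qed.
Let cw2 : cabs w2 = c2. Proof. by rewrite cabsN cabs_real gtr0_norm. Qed.

(** The circle can be shrunk to the origin without changing the integral, and the integrand is
    continuous there with value 0. *)
Lemma circ_disc0 (h : R[i] -> R[i]) (r : R) n : 0 < r ->
  (forall z, cabs z <= r -> cdifferentiable_at h z) -> circ r (fun z => h z * z ^+ n.+1) = 0.
Proof.
move=> rp H; apply/eqP; rewrite -cabs_eq0 eq_le cabs_ge0 andbT.
have Hd z : cabs z <= r -> cdifferentiable_at (fun z => h z * z ^+ n.+1) z.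
  by move=> zr; apply: cdiffM; [exact: H|exact: cdiffX (cdiff_id _)].
apply/ler_addgt0Pl => e e0; rewrite addr0.
have pp : 0 < pi *+ 2 :> R by rewrite pmulrn_lgt0 ?pi_gt0.
have e'0 : 0 < e / (2 * (pi *+ 2)) by rewrite divr_gt0// mulr_gt0.
have z0 : cabs (0 : R[i]) <= r by rewrite cabs0 ltW.
have [d d0 Hc] := cdiff_ccont (Hd 0 z0) e'0.
pose s := Num.min r (d / 2).
have s0 : 0 < s by rewrite lt_min rp divr_gt0.
have sr : s <= r by rewrite ge_min lexx.
have sd : s < d by rewrite (@le_lt_trans _ _ (d / 2))//; [rewrite ge_min lexx orbT|rewrite ltr_pdivrMr// mulr2n mulrDr mulr1 ltrDl].
have -> : circ r (fun z => h z * z ^+ n.+1) = circ s (fun z => h z * z ^+ n.+1).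
  by apply/esym/circ_eq => // z /andP[_ zr]; exact: Hd.
have sc : circ_cont s (fun z => h z * z ^+ n.+1).
  apply: circ_cont_cdiff; first exact: ltW.
  by move=> z zs; apply: Hd; rewrite zs.
apply: (@le_trans _ _ (2 * (e / (2 * (pi *+ 2))) * (pi *+ 2))).
  apply: le_cabs_circ => //; first exact: ltW.
  move=> z zs; have := Hc z; rewrite !subr0 zs expr0n /= mulr0 subr0 => /(_ sd).
  exact: ltW.
have k (P : R) : 0 < P -> 2 * (e / (2 * P)) * P = e by move=> P0; field; rewrite gt_eqF.
by rewrite k.
Qed.

Lemma torus_bound3 K (a b c : R) (x y z : R) : 0 <= a -> 0 <= b -> 0 <= c -> 0 <= x -> 0 <= y -> 0 <= z ->
  (forall u, on_torus a x u -> c2cont K u) ->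
  (forall u, on_torus b y u -> c2cont K u) ->
  (forall u, on_torus c z u -> c2cont K u) ->
  exists M : R, forall u, on_torus a x u \/ on_torus b y u \/ on_torus c z u -> cabs (K u) <= M.
Proof.
move=> a0 b0 c0 x0 y0 z0 h1 h2 h3.
have [M1 H1] := torus_bounded a0 x0 h1; have [M2 H2] := torus_bounded b0 y0 h2.
have [M3 H3] := torus_bounded c0 z0 h3.
exists (Num.max M1 (Num.max M2 M3)) => u [/H1|[/H2|/H3]] h; rewrite !le_max h ?orbT//.
Qed.

(** 2 pi times the coefficient of z1^a on the slice z2 = w2. *)
Definition slice_coef (a : nat) : R[i] := coef r1 a%:Z (fun z1 => F (z1, w2)).

(** [laurent] is applied with inner radius c1 / 2; its negative powers drop out because the slice
    contains the whole disc |z1| <= r1. *)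
Lemma slice_expansion :
  ctends (fun n => \sum_(0 <= k < n.+1) w1 ^+ k * slice_coef k) (((pi *+ 2)%:C)%C * F (w1, w2)).
Proof.
pose h z1 := F (z1, w2); pose r := c1 / 2.
have rp : 0 < r by rewrite divr_gt0.
have rc : r < c1 by rewrite ltr_pdivrMr// mulr2n mulrDr mulr1 ltrDl.
have Hh z1 : cabs z1 <= r1 -> Hgamma g (z1, w2).
  move=> zr; case: base2 => _ b2 b3; split; rewrite /= cw2//.
  by rewrite (le_lt_trans _ b2)// ge0_ler_powR ?nnegrE ?cabs_ge0// ltW.
have dh z1 : cabs z1 <= r1 -> cdifferentiable_at h z1 by move=> /Hh; exact: holo_cdiff1.
have tc (s : R) : s <= r1 -> forall u, on_torus s c2 u -> c2cont F u.
  move=> sr [u1 u2] [/= e1 e2]; apply: holo_c2cont HF _ _; case: base2 => _ b2 b3.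
  split; rewrite /= ?e2 ?e1//; rewrite (le_lt_trans _ b2)//.
  by rewrite ge0_ler_powR ?nnegrE ?cabs_ge0// -?e1 ?cabs_ge0 ?e1// ltW.
have [M HM] := torus_bound3 (ltW rp) (ltW c10) (ltW r10) (ltW c20) (ltW c20) (ltW c20)
  (tc r (ltW (lt_trans rc cr1))) (tc c1 (ltW cr1)) (tc r1 (lexx _)).
have M0 : 0 <= M.
  apply: le_trans (HM (w1, w2) _); first exact: cabs_ge0.
  by right; left; split; rewrite /= ?cw1 ?cw2.
have dd z1 : r <= cabs z1 <= r1 -> cdifferentiable_at h z1 by move=> /andP[_]; exact: dh.
have hM z1 : cabs z1 = r \/ cabs z1 = r1 \/ z1 = w1 -> cabs (h z1) <= M.
  move=> hz; apply: HM; case: hz => [e|[e|e]]; [left|right; right|right; left].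
  - by split; rewrite /= ?cw2.
  - by split; rewrite /= ?cw2.
  - by split; rewrite /= ?cw2 ?e ?cw1.
have pp := @pi2_ge0 R.
apply: (ctends_annulus (C := 4 * M * (pi *+ 2)) _ rp rc cr1); first by rewrite !mulr_ge0.
move=> n; have := @laurent R h r c1 r1 M n rp rc cr1 dd hM.
rewrite -/w1 [X in _ - X](_ : _ = 0) ?subr0; first by rewrite cabsC.
rewrite big1_seq// => k _; rewrite /coef.
rewrite (_ : (fun z => _) = (fun z : R[i] => h z * z ^+ k.+1)).
  rewrite circ_disc0 ?mulr0// => z zr; apply: dh.
  by rewrite (le_trans zr)// ltW// (lt_trans rc).
by apply/funext => z; rewrite opprK.
Qed.

Definition laurent_sum (a : int) (n : nat) : R[i] :=
  \sum_(0 <= k < n.+1) w2 ^+ k * coef2 F r1 c2 a k%:Z +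
  \sum_(0 <= k < n.+1) w2 ^ (- k.+1%:Z) * coef2 F r1 c2 a (- k.+1%:Z).

(** For each z1 on the circle the function is expanded in z2. The remainder bound of [laurent] is
    uniform in z1, so integrating over the circle preserves it. *)
Lemma slice_coef_expansion (a : nat) :
  ctends (laurent_sum a) (((pi *+ 2)%:C)%C * slice_coef a).
Proof.
pose K (z : C2 R) := F z * z.1 ^ (- a%:Z).
have HK s (u : C2 R) : in_base g r1 s -> on_torus r1 s u -> c2cont K u.
  move=> Hb ut; apply: c2contM; first exact: (holo_c2cont HF (in_base_Hgamma Hb ut)).
  apply: (c2cont_fst (f := fun t => t ^ (- a%:Z))); apply: ccont_exprz.
  by case: ut => e _; rewrite -cabs_gt0 e.
have HL s b (u : C2 R) : in_base g r1 s -> on_torus r1 s u -> c2cont (laurent_term F a b) u.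
  by move=> Hb ut; exact: (in_base_c2cont HF a b Hb ut).
have [M HM] := torus_bound3 (ltW r10) (ltW r10) (ltW r10) (ltW r20) (ltW c20) (ltW r2'0)
  (fun u => @HK r2 u base1) (fun u => @HK c2 u base2) (fun u => @HK r2' u base3).
have M0 : 0 <= M.
  apply: le_trans (HM ((r1%:C)%C, w2) _); first exact: cabs_ge0.
  by right; left; split; rewrite /= ?cw2// cabs_real gtr0_norm.
pose h z1 z2 := K (z1, z2).
pose X z1 n := ((pi *+ 2)%:C)%C * h z1 w2
    - \sum_(0 <= k < n.+1) w2 ^+ k * coef r2' k (h z1)
    - \sum_(0 <= k < n.+1) w2 ^ (- k.+1%:Z) * coef r2 (- k.+1%:Z) (h z1).
have Xb n z1 : cabs z1 = r1 -> cabs (X z1 n) <= 4 * M * (pi *+ 2) *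
    ((c2 / r2') ^+ n.+1 * (r2' / (r2' - c2)) + (r2 / c2) ^+ n.+1 * (r2 / (c2 - r2))).
  move=> zr; apply: laurent => //.
    move=> z2 /andP[h1 h2]; apply: cdiffM; last exact: cdiff_cst.
    apply: (holo_cdiff2 HF); split; rewrite /= ?zr; first exact: lt_le_trans rr h1.
    exact: le_lt_trans h2 r2'1.
  move=> z2 hz; apply: HM; case: hz => [e|[e|->]]; [left|right; right|right; left]; split => //.
pose Y (f : R[i] -> R[i]) := fun y : mR => f ((r1%:C)%C * cis y).
have i0 : Cintegrable leb I02 (Y (fun z1 => h z1 w2)).
  apply: circ_integrable; first exact: ltW.
  by apply: c2cont_circ1 (ltW r10) => z1 z1r; apply: (HK c2); [exact: base2|split; rewrite /= ?cw2].
have ik s (b : int) : in_base g r1 s -> Cintegrable leb I02 (Y (fun z1 => coef s b (h z1))).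
  by move=> Hb; have [_ _ _] := torusE (ltW r10) (ltW (in_base_pos Hb)) (fun u => HL s b u Hb).
have mI := @measurable_I02 R.
have iX n : Cintegrable leb I02 (Y (X ^~ n)).
  have iB k := CintegrableZ mI (w2 ^+ k) (ik r2' k%:Z base3).
  have iD (k : nat) := CintegrableZ mI (w2 ^ (- k.+1%:Z)) (ik r2 (- k.+1%:Z) base1).
  apply: (CintegrableB mI (CintegrableB mI (CintegrableZ mI ((pi *+ 2)%:C)%C i0) _) _).
    exact: (Cintegrable_sum mI (index_iota 0 n.+1) iB).
  exact: (Cintegrable_sum mI (index_iota 0 n.+1) iD).
have E n : circ r1 (X ^~ n) = ((pi *+ 2)%:C)%C * slice_coef a - laurent_sum a n.
  have iA := CintegrableZ mI ((pi *+ 2)%:C)%C i0.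
  have iB k := CintegrableZ mI (w2 ^+ k) (ik r2' k%:Z base3).
  have iD (k : nat) := CintegrableZ mI (w2 ^ (- k.+1%:Z)) (ik r2 (- k.+1%:Z) base1).
  have isB := Cintegrable_sum mI (index_iota 0 n.+1) iB.
  have isD := Cintegrable_sum mI (index_iota 0 n.+1) iD.
  have e1 := CintB mI (CintegrableB mI iA isB) isD.
  have e2 := CintB mI iA isB.
  (* [laurent] uses the radius r2' for nonnegative and r2 for negative powers; [coef2_const] brings
     both to the common radius c2. *)
  apply: etrans e1 _; rewrite e2 /laurent_sum opprD addrA; congr (_ - _ - _).
  - exact: etrans (CintZ mI _ i0) _.
  - rewrite (Cint_sum mI _ iB); apply: eq_bigr => k _.
    apply: etrans (CintZ mI _ (ik r2' k%:Z base3)) _.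
    exact: (congr1 (fun c => w2 ^+ k * c) (coef2_const g0 HF a k%:Z base3 base2)).
  - rewrite (Cint_sum mI _ iD); apply: eq_bigr => k _.
    apply: etrans (CintZ mI _ (ik r2 (- k.+1%:Z) base1)) _.
    exact: (congr1 (fun c => w2 ^ (- k.+1%:Z) * c) (coef2_const g0 HF a (- k.+1%:Z) base1 base2)).
have pp := @pi2_ge0 R.
apply: (ctends_annulus (C := 2 * (4 * M * (pi *+ 2)) * (pi *+ 2)) _ r20 rc2 cr2).
  by rewrite !mulr_ge0.
move=> n; rewrite cabsC -E.
apply: le_trans (le_cabs_Cint (iX n) (fun y _ => Xb n _ (cabs_rcis y (ltW r10)))) _.
by rewrite -!mulrA [X in _ <= 2 * (4 * (M * X))]mulrC -!mulrA.
Qed.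
End Expansion.

(** * Summation and zeros *)

Section ArithmeticGeometric.
Variable R : realType.
Implicit Types (t d : R).

(* The sum of the series \sum_k (k + d) t ^+ k. *)
Definition gsum t d : R := t / (1 - t) ^+ 2 + d / (1 - t).

Lemma arith_geom t d n : t != 1 -> \sum_(0 <= k < n) (k%:R + d) * t ^+ k =
  gsum t d - t ^+ n * ((n%:R + d) / (1 - t) + t / (1 - t) ^+ 2).
Proof.
move=> t1; have h : 1 - t != 0 by rewrite subr_eq0 eq_sym.
elim: n => [|n IH]; first by rewrite big_nil expr0 /gsum; field.
by rewrite big_nat_recr//= IH -[n.+1%:R]natr1 (exprS t n) /gsum; field.
Qed.

Lemma gsum_shift t d : t != 1 -> gsum t d = d + t * gsum t (d + 1).
Proof. by move=> t1; rewrite /gsum; field; rewrite subr_eq0 eq_sym. Qed.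

(** With e = d + j + 1, the left side sums (k + e) t^k over all k >= -(j + 1), negative powers
    apart. Reindexing by m = k + j + 1 turns it into t^-(j+1) times the sum of (m + d) t^m. *)
Lemma principal_part t d j : t != 0 -> t != 1 ->
  gsum t (d + j.+1%:R) + \sum_(0 <= k < j.+1) (j%:R - k%:R + d) * t ^- k.+1 = t ^- j.+1 * gsum t d.
Proof.
move=> t0 t1; elim: j => [|j IH].
  by rewrite big_nat1 subrr add0r expr1 (gsum_shift d t1); field.
rewrite big_nat_recl//= (eq_big_nat _ _ (F2 := fun k => t^-1 * ((j%:R - k%:R + d) * t ^- k.+1))); last first.
  move=> k _; rewrite -(natr1 j) -(natr1 k) (exprS t k.+1) invfM; ring.
rewrite -big_distrr /= (_ : \sum_(0 <= k < j.+1) _ = t ^- j.+1 * gsum t d - gsum t (d + j.+1%:R)); last first.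
  by rewrite -IH addrC addKr.
rewrite (gsum_shift (d + j.+1%:R) t1) -[j.+2%:R]natr1 (addrA d) (exprS t j.+1) subr0 expr1 invfM.
by field; rewrite t0 expf_neq0.
Qed.

Lemma arith_geom_bound t d n : `|t| < 1 ->
  `|\sum_(0 <= k < n.+1) (k%:R + d) * t ^+ k - gsum t d| <=
  ((1 + `|d|) / (1 - t) + (1 - t) ^- 2) * n.+1%:R * `|t| ^+ n.
Proof.
move=> t1; have t1' : t < 1 := le_lt_trans (ler_norm t) t1.
have h : 0 < 1 - t by rewrite subr_gt0.
rewrite arith_geom ?lt_eqF// addrC addKr normrN normrM normrX (exprS `|t| n) mulrAC.
apply: ler_wpM2r; first exact: exprn_ge0.
apply: (@le_trans _ _ (1 * `|(n.+1%:R + d) / (1 - t) + t / (1 - t) ^+ 2|)).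
  by apply: ler_wpM2r => //; exact: ltW.
rewrite mul1r (le_trans (ler_normD _ _))// !normrM !normfV normrX (gtr0_norm h) mulrDl.
have n1 : 1 <= n.+1%:R :> R by rewrite ler1n.
apply: lerD.
  rewrite mulrAC; apply: ler_wpM2r; first by rewrite invr_ge0 ltW.
  rewrite (le_trans (ler_normD _ _))// ger0_norm// mulrDl mul1r lerD2l.
  by rewrite ler_peMr.
rewrite mulrC; apply: ler_wpM2l; first by rewrite invr_ge0 exprn_ge0// ltW.
exact: le_trans (ltW t1) n1.
Qed.
End ArithmeticGeometric.

(** * Closed form of the slice coefficients of the kernel *)

Section KernelCoefficients.
Variable R : realType.
Variables (g : R) (B : C2 R -> C2 R -> R[i]).
Hypothesis g0 : 0 < g.
Hypothesis HB : is_bergman_kernel (Hgamma g) B.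
Variables (s v : R).
Hypothesis v0 : 0 < v.
Let w : C2 R := ((s%:C)%C, (v%:C)%C).
Hypothesis Hw : Hgamma g w.
Let F := B^~ w.
Let HF : holomorphic_on (Hgamma g) F := (HB Hw).1.1.

Definition kappa : R := (pi *+ 2) ^+ 2 / disc_area R ^+ 2.

(** The sign of q decides whether the monomial is square integrable: if it is, the reproducing
    identity gives the coefficient, otherwise the vanishing lemma applies. *)
Lemma kernel_coef2_real r1 r2 (a : nat) (b : int) (q := b%:~R + 1 + a.+1%:R / g) : in_base g r1 r2 ->
  coef2 F r1 r2 a b = ((kappa * a.+1%:R * s ^+ a * (v ^ b * (if 0 < q then q else 0)))%:C)%C.
Proof.
move=> Hr; have qE : q = b%:~R + a.+1%:R / g + 1 by rewrite /q addrAC.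
have mE : (monomial a b w)^*%C = ((s ^+ a * v ^ b)%:C)%C.
  have -> : monomial a b w = ((s ^+ a * v ^ b)%:C)%C.
    rewrite /monomial /w /= -!/(real_complex R _) rmorphM rmorphXn /=; congr (_ * _).
    by rewrite -!/(real_complex R _) rmorphXz// unitfE gt_eqF.
  by apply: complex_eq; rewrite /= ?oppr0.
case: ifPn => [q0|]; last rewrite -leNgt => q0.
  have hab : -1 < b%:~R + a.+1%:R / g by rewrite -subr_gt0 opprK -qE.
  rewrite (kernel_coef2 g0 HB hab Hw Hr) mE -qE /kappa -!/(real_complex R _) -rmorphM /=.
  by congr (real_complex R _); ring.
rewrite !mulr0; have [N HN] := inA2_bound (HB Hw).1.
apply: (coef2_vanish g0 HF HN (fun _ _ Hr' => coef2_const g0 HF a b Hr' Hr)).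
by rewrite -subr_le0 opprK -qE.
Qed.

Variables (c1 c2 r1 r2 r2' : R).
Hypotheses (c10 : 0 < c1) (cr1 : c1 < r1) (rr : r1 `^ g < r2) (rc2 : r2 < c2) (cr2 : c2 < r2')
  (r2'1 : r2' < 1).
Let base : in_base g r1 c2.
Proof. by split; [exact: lt_trans cr1|exact: lt_trans rc2|exact: lt_trans r2'1]. Qed.
Let t := - c2 * v.

(** At b = -(j + 1) the factor q equals d > 0, and one step lower it is d - 1 <= 0. So the series in
    z2 starts exactly at t^-(j+1), and [principal_part] sums it. *)
Lemma slice_coef_value (a j : nat) (d : R) : 0 < d -> d <= 1 -> a.+1%:R / g = j%:R + d ->
  slice_coef F c2 r1 a =
  ((kappa / (pi *+ 2) * a.+1%:R * s ^+ a * (t ^- j.+1 * gsum t d))%:C)%C.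
Proof.
move=> d0 d1 Ea; have pp : 0 < pi *+ 2 :> R by rewrite pmulrn_lgt0 ?pi_gt0.
have c20 : 0 < c2 := in_base_pos base.
have v1 : v < 1 by case: Hw => _; rewrite /= cabs_real gtr0_norm.
have t0 : t < 0 by rewrite /t mulNr oppr_lt0 mulr_gt0.
have nt : `|t| < 1.
  have [_ _ c21] := base; rewrite /t normrM normrN (gtr0_norm c20) (gtr0_norm v0).
  exact: mulr_ilt1 (ltW c20) (ltW v0) c21 v1.
have t1 : t != 1 by rewrite lt_eqF// (lt_trans t0).
pose K := kappa * a.+1%:R * s ^+ a.
suff E : ((pi *+ 2)%:C)%C * slice_coef F c2 r1 a = ((K * (t ^- j.+1 * gsum t d))%:C)%C.
  have p0 : ((pi *+ 2)%:C)%C != 0 :> R[i] by rewrite -cabs_gt0 cabs_real gtr0_norm.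
  apply: (mulfI p0); rewrite E -!/(real_complex R _) -rmorphM /=.
  have k (P x y z u : R) : P != 0 -> x * y * z * u = P * (x / P * y * z * u) by move=> P0; field.
  congr (real_complex R _); apply: k; exact: lt0r_neq0.
apply: ctends_unique (slice_coef_expansion g0 HF c10 cr1 rr rc2 cr2 r2'1 a) _.
pose e := d + j.+1%:R.
have qE (b : int) : b%:~R + 1 + a.+1%:R / g = b%:~R + e.
  by rewrite Ea /e -natr1; ring.
have w2E : - (c2%:C)%C = ((- c2)%:C)%C :> R[i] by rewrite -!/(real_complex R _) rmorphN.
have S1 n : \sum_(0 <= k < n.+1) (- (c2%:C)%C) ^+ k * coef2 F r1 c2 a k%:Z =
    ((K * \sum_(0 <= k < n.+1) (k%:R + e) * t ^+ k)%:C)%C.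
  rewrite big_distrr /= -!/(real_complex R _) rmorph_sum /=; apply: eq_bigr => k _.
  rewrite (kernel_coef2_real _ _ base) qE ifT; last by rewrite ltr_wpDl// /e ltr_wpDr.
  rewrite w2E -!/(real_complex R _) -rmorphXn -rmorphM /=; congr (real_complex R _).
  by rewrite /t exprMn -/K -exprnP; ring.
have S2 n : (j <= n)%N -> \sum_(0 <= k < n.+1) (- (c2%:C)%C) ^ (- k.+1%:Z) * coef2 F r1 c2 a (- k.+1%:Z) =
    ((K * \sum_(0 <= k < j.+1) (j%:R - k%:R + d) * t ^- k.+1)%:C)%C.
  move=> jn; rewrite (big_cat_nat _ (n := j.+1))//= [X in _ + X]big_nat_cond [X in _ + X]big1 ?addr0; last first.
    (* For k > j the factor q is j - k + d <= d - 1 <= 0, so the coefficient is 0. *)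
    move=> k /andP[/andP[jk _] _]; rewrite (kernel_coef2_real _ _ base) qE ifF; first by rewrite !mulr0.
    apply/negP/negP; rewrite -leNgt /e mulrNz.
    have : j.+1%:R <= k%:R :> R by rewrite ler_nat.
    by rewrite -[(k.+1%:Z)%:~R](natr1 k) => h; lra.
  rewrite big_distrr /= -!/(real_complex R _) rmorph_sum /=; apply: eq_big_nat => k /andP[_ kj].
  have qk : (- k.+1%:Z)%:~R + e = j%:R - k%:R + d.
    by rewrite /e mulrNz -(natr1 j) -[(k.+1%:Z)%:~R](natr1 k); ring.
  rewrite (kernel_coef2_real _ _ base) qE qk ifT; last first.
    have : k%:R <= j%:R :> R by rewrite ler_nat.
    by move=> h; lra.
  rewrite w2E -!/(real_complex R _) -rmorphXz ?unitfE ?oppr_eq0 ?gt_eqF// -rmorphM /=; congr (real_complex R _).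
  rewrite -/K -!exprnN /t exprMn invfM; ring.
apply: (@ctends_bound R _ _ (`|K| * ((1 + `|e|) / (1 - t) + (1 - t) ^- 2)) `|t| j) => // n jn.
rewrite [laurent_sum _ _ _ _ _](f_equal2 +%R (S1 n) (S2 n jn)) -(principal_part d j (ltr0_neq0 t0) t1) -/e.
rewrite -!/(real_complex R _) -rmorphD -rmorphB /= -!/(real_complex R _) cabs_real.
rewrite -mulrDr -mulrBr opprD addrACA subrr addr0 normrM -!mulrA; apply: ler_wpM2l => //.
by rewrite !mulrA; exact: arith_geom_bound.
Qed.

Lemma slice_coef0 a : s = 0 -> (0 < a)%N -> slice_coef F c2 r1 a = 0.
Proof.
move=> s0 a0; have pp : 0 < pi *+ 2 :> R by rewrite pmulrn_lgt0 ?pi_gt0.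
have p0 : ((pi *+ 2)%:C)%C != 0 :> R[i] by rewrite -cabs_gt0 cabs_real gtr0_norm.
apply: (mulfI p0); rewrite mulr0.
apply: ctends_unique (slice_coef_expansion g0 HF c10 cr1 rr rc2 cr2 r2'1 a) _.
have c0 b : coef2 F r1 c2 a b = 0.
  by rewrite (kernel_coef2_real _ _ base) s0 expr0n gtn_eqF// mulr0 mul0r.
have z n (f : nat -> R[i]) (b : nat -> int) : \sum_(0 <= k < n.+1) f k * coef2 F r1 c2 a (b k) = 0.
  by apply: big1 => k _; rewrite c0 mulr0.
move=> e e0; exists 0 => n _.
rewrite [laurent_sum _ _ _ _ _](f_equal2 +%R
  (z n (fun k => (- (c2%:C)%C) ^+ k) (fun k => k%:Z))
  (z n (fun k => (- (c2%:C)%C) ^ (- k.+1%:Z)) (fun k => - k.+1%:Z))).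
by rewrite addr0 subr0 cabs0.
Qed.
End KernelCoefficients.

Lemma radii_exist (R : realType) (g c1 c2 : R) : 0 < g -> 0 < c1 -> c1 `^ g < c2 -> c2 < 1 ->
  exists r : R * R * R,
    [/\ c1 < r.1.1, r.1.1 `^ g < r.1.2, r.1.2 < c2, c2 < r.2 & r.2 < 1].
Proof.
move=> g0 c10 h1 h2; pose m := (c1 `^ g + c2) / 2.
have m1 : c1 `^ g < m by rewrite /m; lra.
have m2 : m < c2 by rewrite /m; lra.
have m0 : 0 <= m by rewrite (le_trans (powR_ge0 c1 g))// ltW.
have ng := gt_eqF g0.
(* The first radius is chosen so that its power g is the midpoint m of c1^g and c2. *)
exists (m `^ g^-1, (m + c2) / 2, (c2 + 1) / 2) => /=; split; try lra.
  have -> : c1 = (c1 `^ g) `^ g^-1 by rewrite -powRrM mulfV ?ng// powRr1// ltW.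
  by apply: gt0_ltr_powR; rewrite ?invr_gt0// nnegrE ?powR_ge0.
by rewrite -powRrM mulVf ?ng// powRr1//; lra.
Qed.

Lemma sum_pairs (V : nmodType) (f : nat -> V) n :
  \sum_(0 <= k < n.*2) f k = \sum_(0 <= j < n) (f j.*2 + f j.*2.+1).
Proof.
elim: n => [|n IH]; first by rewrite !big_nil.
by rewrite doubleS !big_nat_recr//= IH addrA.
Qed.

(** * Explicit zeros *)

Section Zeros.
Variable R : realType.
Variables (g : R) (B : C2 R -> C2 R -> R[i]).
Hypothesis HB : is_bergman_kernel (Hgamma g) B.

Let p0 : ((pi *+ 2)%:C)%C != 0 :> R[i].
Proof. by rewrite -cabs_gt0 cabs_real gtr0_norm pmulrn_lgt0 ?pi_gt0. Qed.

Lemma kernel_zero_gt2 : 2 < g -> exists z w : C2 R, Hgamma g z /\ Hgamma g w /\ B z w = 0.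
Proof.
move=> g2; have g0 : 0 < g by lra.
have u0 : 0 < (g - 1)^-1 by rewrite invr_gt0; lra.
have u1 : (g - 1)^-1 < 1 by rewrite invf_lt1; lra.
(* With z2 = -c and w2 = c the product is -1 / (g - 1), the root of [gsum] with shift 1/g. The
   strict inequality g > 2 gives c < 1. *)
pose c := Num.sqrt (g - 1)^-1.
have cc : c ^+ 2 = (g - 1)^-1 by rewrite sqr_sqrtr// ltW.
have c0 : 0 < c by rewrite sqrtr_gt0.
have c1 : c < 1 by rewrite -[X in _ < X]sqrtr1 ltr_sqrt.
(* A radius with c'^g = c / 2 < c, so that z1 = -c' is admissible over z2 = -c. *)
pose c' := (c / 2) `^ g^-1.
have c'0 : 0 < c' by rewrite powR_gt0// divr_gt0.
have c'c : c' `^ g < c by rewrite -powRrM mulVf ?gt_eqF// powRr1; lra.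
have [[[r1 r2] r2'] /= [h1 h2 h3 h4 h5]] := radii_exist g0 c'0 c'c c1.
have Hw : Hgamma g ((0%:C)%C, (c%:C)%C).
  by split; rewrite /= !cabs_real ?normr0 (gtr0_norm c0)// powR0 ?gt_eqF.
exists (- (c'%:C)%C, - (c%:C)%C), ((0%:C)%C, (c%:C)%C); split; last split=> //.
  by split; rewrite /= !cabsN !cabs_real !gtr0_norm.
have HF := (HB Hw).1.1.
apply: (mulfI p0); rewrite mulr0.
apply: ctends_unique (slice_expansion g0 HF c'0 h1 h2 h3 h4 h5) _.
(* Every slice coefficient vanishes: those with k > 0 because w1 = 0, the one with k = 0 by the
   choice of c. *)
have sc k : slice_coef (B^~ ((0%:C)%C, (c%:C)%C)) c r1 k = 0.
  case: k => [|k]; last first.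
    exact: (slice_coef0 g0 HB c0 Hw c'0 h1 h2 h3 h4 h5 erefl (ltn0Sn k)).
  have d0 : 0 < g^-1 by rewrite invr_gt0.
  have d1 : g^-1 <= 1 by rewrite invf_le1; lra.
  have E : 1%:R / g = 0%:R + g^-1 by rewrite div1r add0r.
  rewrite (slice_coef_value g0 HB c0 Hw c'0 h1 h2 h3 h4 h5 d0 d1 E).
  have -> : gsum (- c * c) g^-1 = 0.
    rewrite mulNr -expr2 cc /gsum; field; apply/andP; split; apply: lt0r_neq0; lra.
  by rewrite !mulr0.
move=> e e0; exists 0 => n _; rewrite big1; first by rewrite subr0 cabs0.
by move=> k _; rewrite sc mulr0.
Qed.

Lemma kernel_zero_eq2 : g = 2 -> exists z w : C2 R, Hgamma g z /\ Hgamma g w /\ B z w = 0.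
Proof.
move=> g2; have g0 : 0 < g by rewrite g2.
have pw (x : R) : 0 <= x -> x `^ g = x ^+ 2 by move=> x0; rewrite g2 powR_mulrn.
(* The points are z = (-1/2, -1/2) and w = (1/3, 1/2), with coordinate products -1/6 and -1/4. *)
pose c : R := 1 / 2; pose s : R := 1 / 3.
have c0 : 0 < c by rewrite /c; lra.
have c1 : c < 1 by rewrite /c; lra.
have s0 : 0 < s by rewrite /s; lra.
have cg : c `^ g < c by rewrite pw ?ltW// /c; lra.
have sg : s `^ g < c by rewrite pw ?ltW// /c /s; lra.
have [[[r1 r2] r2'] /= [h1 h2 h3 h4 h5]] := radii_exist g0 c0 cg c1.
have Hw : Hgamma g ((s%:C)%C, (c%:C)%C) by split; rewrite /= !cabs_real !gtr0_norm.
exists (- (c%:C)%C, - (c%:C)%C), ((s%:C)%C, (c%:C)%C); split; last split=> //.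
  by split; rewrite /= !cabsN !cabs_real !gtr0_norm.
have HF := (HB Hw).1.1; set F := B^~ _ in HF.
apply: (mulfI p0); rewrite mulr0.
pose f k : R[i] := (- (c%:C)%C) ^+ k * slice_coef F c r1 k.
have S := slice_expansion g0 HF c0 h1 h2 h3 h4 h5.
(* Put sigma = z1 w1 = -1/6 and t = z2 w2 = -1/4. Then x = sigma^2 / t is the ratio of consecutive
   pairs, and d = (G1 + 2 sigma G2) / (2 (G1 + sigma G2)), where G1 and G2 are the values of [gsum]
   at t with shifts 1/2 and 1. The points are chosen so that d = -x / (1 - x), which is the equation
   [gsum x d] = 0. *)
pose x : R := - (1 / 9); pose d : R := 1 / 10.
(* Here 16/15 = 4 * 2 (G1 + sigma G2), the factor -4 being 1 / t. *)
pose k0 : R := - (kappa R / (pi *+ 2) * (16 / 15)).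
have t4 : - c * c = - (1 / 4) by rewrite /c; lra.
have G1 : gsum (- (1 / 4)) (1 / 2) = 6 / 25 :> R by rewrite /gsum; field.
have G2 : gsum (- (1 / 4)) 1 = 16 / 25 :> R by rewrite /gsum; field.
(* Consecutive even and odd terms combine into (j + 1/10) (-1/9)^j, whose series sums to 0. *)
have fE j : f j.*2 + f j.*2.+1 = ((k0 * ((j%:R + d) * x ^+ j))%:C)%C.
  have d20 : 0 < 1 / 2 :> R by lra.
  have d21 : 1 / 2 <= 1 :> R by lra.
  have E1 : j.*2.+1%:R / g = j%:R + 1 / 2 by rewrite g2 -natr1 -muln2 natrM; field.
  have E2 : j.*2.+2%:R / g = j%:R + 1 by rewrite g2 -doubleS -muln2 natrM -natr1; field.
  rewrite /f (slice_coef_value g0 HB c0 Hw c0 h1 h2 h3 h4 h5 d20 d21 E1).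
  rewrite (slice_coef_value g0 HB c0 Hw c0 h1 h2 h3 h4 h5 ltr01 (lexx _) E2).
  have -> : - (c%:C)%C = ((- c)%:C)%C :> R[i] by rewrite -!/(real_complex R _) rmorphN.
  rewrite -!/(real_complex R _) -!rmorphXn -!rmorphM -rmorphD /=; congr (real_complex R _).
  rewrite t4 G1 G2 -[j.*2.+2%:R]natr1 -[j.*2.+1%:R]natr1 -[in j.*2%:R]muln2 natrM.
  rewrite (exprS (- c) j.*2) (exprS s j.*2) -(mul2n j) !exprM -exprVn (exprS _ j).
  have -> : x ^+ j = ((- c) ^+ 2) ^+ j * (s ^+ 2) ^+ j * ((- (1 / 4))^-1) ^+ j.
    by rewrite -!exprMn; congr (_ ^+ j); rewrite /x /c /s; field.
  rewrite /k0 /d /c /s.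
  move: (((- (1 / 2)) ^+ 2) ^+ j) (((1 / 3) ^+ 2) ^+ j) (((- (1 / 4))^-1) ^+ j) => X Y Z.
  move: (kappa R / _) => K.
  by field.
(* Passing to partial sums of even length, which consist of complete pairs. *)
have S' : ctends (fun m => \sum_(0 <= k < m.+1.*2) f k) (((pi *+ 2)%:C)%C * F (- (c%:C)%C, - (c%:C)%C)).
  move=> e /S[N HN]; exists N => n Nn; rewrite doubleS; apply: HN.
  by rewrite -addnn (leq_trans Nn)// -addSn leq_addl.
apply: ctends_unique S' _.
have x1 : `|x| < 1 by rewrite /x normrN gtr0_norm; lra.
have Gx : gsum x d = 0 by rewrite /gsum /x /d; field.
apply: (@ctends_bound R _ _ (`|k0| * ((1 + `|d|) / (1 - x) + (1 - x) ^- 2)) `|x| 0) => // n _.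
rewrite sum_pairs (eq_bigr _ (fun j _ => fE j)) subr0.
rewrite -!/(real_complex R _) -rmorph_sum /= -!/(real_complex R _) cabs_real -big_distrr /= normrM.
rewrite -!mulrA; apply: ler_wpM2l => //; rewrite !mulrA.
by have := arith_geom_bound d n x1; rewrite Gx subr0.
Qed.
End Zeros.

Theorem theorem2p8 (R : realType) (gamma : R) (hgamma : 2 <= gamma)
    (B : C2 R -> C2 R -> R[i]) :
  is_bergman_kernel (Hgamma gamma) B ->
  exists z w : C2 R, Hgamma gamma z /\ Hgamma gamma w /\ B z w = 0.
Proof.
move=> HB; move: hgamma; rewrite le_eqVlt => /predU1P[g2|g2].
  by apply: kernel_zero_eq2 => //; rewrite -g2.
exact: kernel_zero_gt2.
Qed.
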